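(* Let $l\ge1$ be an integer and let $\Phi$ be a $c_0$-symbol with $c_0\ge1$ such that $\Phi(s)=c_0s+\varphi(s)$ with $\varphi(s)=\sum_{n=1}^{+\infty}c_nn^{-s}$ where $c_n=0$ if $p^+(n)>l$. Assume that $\mathrm{Im}(\varphi)$ is bounded on $\mathbb{C}_+$ and that $\Phi$ is finite-valent. Then the following assertions are equivalent: (i) $C_\Phi$ is compact on $\mathcal{H}^2$. (ii) $\displaystyle\lim_{\Re(s)\to0}\frac{\Re(s)}{\Re(\Phi(s))}=0$. (iii) $N_\Phi(s)=o(\Re(s))$ when $\Re(s)$ goes to $0$.
   Context: For $\theta\in\mathbb{R}$, $\mathbb{C}_\theta=\{s\in\mathbb{C}:\Re(s)>\theta\}$ and $\mathbb{C}_+=\mathbb{C}_0$. $\mathcal{D}$ is the class of functions representable by a convergent Dirichlet series in some half-plane. $\mathcal{H}^2$ is the Hilbert space of Dirichlet series $f=\sum_{n\ge1}a_nn^{-s}$ with $\|f\|^2=\sum|a_n|^2<\infty$ (analytic functions on $\mathbb{C}_{1/2}$). For an integer $c_0\ge1$, a $c_0$-symbol is an analytic function $\Phi:\mathbb{C}_{1/2}\to\mathbb{C}_{1/2}$, $\Phi(s)=c_0s+\varphi(s)$ with $\varphi\in\mathcal{D}$, such that the Dirichlet series of $\varphi$ converges uniformly on $\mathbb{C}_\varepsilon$ for every $\varepsilon>0$ and $\varphi(\mathbb{C}_+)\subset\mathbb{C}_+$ (the paper's characterization, for $c_0\ge1$, of boundedness of $C_\Phi:f\mapsto f\circ\Phi$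 on its weighted Bergman spaces $\mathcal{A}^2_\mu$ of Dirichlet series). Then $\varphi$ and $\Phi$ are regarded as analytic functions on $\mathbb{C}_+$, and $C_\Phi$ is bounded on $\mathcal{H}^2$. $p^+(n)$ is the greatest prime divisor of $n$ (with $p^+(1)=1$). An analytic function $\Phi:\mathbb{C}_+\to\mathbb{C}_+$ is $k$-valent ($k\in\mathbb{N}$) if for every $w\in\mathbb{C}_+$ the equation $\Phi(s)=w$ has at most $k$ solutions in $\mathbb{C}_+$, and finite-valent if it is $k$-valent for some $k\in\mathbb{N}$. $N_\Phi(s)=\sum_{a\in\mathbb{C}_+,\,\Phi(a)=s}\Re(a)$ for $s\in\Phi(\mathbb{C}_+)$, $N_\Phi(s)=0$ otherwise. Limits and $o(\cdot)$ as $\Re(s)\to0$ (with $s\in\mathbb{C}_+$) are uniform in $\mathrm{Im}(s)$, i.e. $\lim_{\Re(s)\to0}F(s)=0$ means $\lim_{\theta\to0^+}\sup_{0<\Re(s)<\theta}|F(s)|=0$. *)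

(* Defs.v *)
From HB Require Import structures.
From mathcomp Require Import all_boot all_order all_algebra.
From mathcomp Require Import all_classical all_reals all_analysis.
From mathcomp Require Import ring complex.

Set Implicit Arguments.
Unset Strict Implicit.
Unset Printing Implicit Defensive.

Import Order.TTheory GRing.Theory Num.Theory.
Import numFieldNormedType.Exports.

Local Open Scope classical_set_scope.
Local Open Scope ring_scope.
Local Open Scope complex_scope.

(* Topological notions on R[i] are taken on R[i]^o, i.e. R[i] as a normed
   module over itself; derivability there is complex differentiability. *)

Section Complex.
Variable R : realType.
Implicit Types (s z : R[i]) (A B : set R[i]) (f : R[i] -> R[i]).

Definition halfplane (theta : R) : set R[i] := [set s | theta < complex.Re s].

Definition analytic_on A f : Prop :=
  forall s, A s -> derivable (f : R[i]^o -> R[i]^o) s 1.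

Definition cexp z : R[i] :=
  (expR (complex.Re z))%:C * (cos (complex.Im z) +i* sin (complex.Im z)).

(* n ^ (- s), for n >= 1 *)
Definition natpowN (n : nat) s : R[i] := cexp (- (s * (ln n%:R)%:C)).

(* A Dirichlet series is given by a : nat -> R[i], where a n is the coefficient
   of n ^ (- s); the index 0 is not used. *)
Definition dirichlet_psum (a : nat -> R[i]) (N : nat) s : R[i] :=
  \sum_(1 <= n < N.+1) a n * natpowN n s.

Definition dirichlet_series (a : nat -> R[i]) s : R[i] :=
  limn (fun N => dirichlet_psum a N s : R[i]^o).

(* f belongs to the class D, with Dirichlet series a *)
Definition dirichlet_represents (a : nat -> R[i]) f : Prop :=
  exists theta : R, forall s, halfplane theta s ->
    (fun N => dirichlet_psum a N s : R[i]^o) @ \oo --> (f s : R[i]^o).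

End Complex.

Section SquareSummable.
Variable R : realType.
Implicit Types (x y : R[i]) (a b : nat -> R[i]).

Definition sqmod x : R := complex.Re x ^+ 2 + complex.Im x ^+ 2.

Lemma sqmod_ge0 x : 0 <= sqmod x.
Proof. by rewrite addr_ge0 ?sqr_ge0. Qed.

Lemma norm_sqmod x : `|x| = (Num.sqrt (sqmod x))%:C.
Proof. exact: normc_def. Qed.

Lemma sqmod0 : sqmod 0 = 0.
Proof. by rewrite /sqmod/= expr0n/= addr0. Qed.

Lemma sqmod_eq0 x : sqmod x = 0 -> x = 0.
Proof. by move=> x0; apply/eqP; rewrite -normr_eq0 norm_sqmod x0 sqrtr0. Qed.

Lemma sqmodM x y : sqmod (x * y) = sqmod x * sqmod y.
Proof. by case: x y => [x1 x2] [y1 y2]; rewrite /sqmod/=; ring. Qed.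

Lemma sqmodD_le (t : R) x y : 0 < t ->
  sqmod (x + y) <= (1 + t) * sqmod x + (1 + t^-1) * sqmod y.
Proof.
move=> t0; rewrite -subr_ge0.
set d := (X in 0 <= X).
have -> : d = t^-1 * sqmod (t%:C * x - y).
  rewrite /d; clear d; case: x y => [x1 x2] [y1 y2]; rewrite /sqmod/=.
  by field; rewrite gt_eqF.
by rewrite mulr_ge0 ?sqmod_ge0// invr_ge0 ltW.
Qed.

Definition sqsum a : R := limn (series (sqmod \o a)).

Definition sqsummable a : Prop := cvgn (series (sqmod \o a)).

Lemma sqseries_nd a : nondecreasing_seq (series (sqmod \o a)).
Proof.
by apply: nondecreasing_series => n _ _; exact: sqmod_ge0.
Qed.

Lemma sqseries_le a N : sqsummable a -> series (sqmod \o a) N <= sqsum a.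
Proof. by move=> ca; apply: nondecreasing_cvgn_le => //; exact: sqseries_nd. Qed.

Lemma sqsummable_bounded a (M : R) :
  (forall N, series (sqmod \o a) N <= M) -> sqsummable a /\ sqsum a <= M.
Proof.
move=> aM.
have ca : sqsummable a.
  apply: nondecreasing_is_cvgn; first exact: sqseries_nd.
  by exists M => _ [N _ <-].
by split => //; apply: limr_le => //; exact: nearW.
Qed.

Lemma sqsum_ge0 a : sqsummable a -> 0 <= sqsum a.
Proof.
by move=> /(sqseries_le 0); apply: le_trans; rewrite /series/= big_geq.
Qed.

Lemma sqmod_le_sqsum a n : sqsummable a -> sqmod (a n) <= sqsum a.
Proof.
move=> /(sqseries_le n.+1); apply: le_trans.
rewrite /series/= big_nat_recr//= lerDr sumr_ge0// => i _; exact: sqmod_ge0.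
Qed.

Lemma sqsum_eq0 a : sqsummable a -> sqsum a = 0 -> a = 0.
Proof.
move=> ca a0; apply/funext => n; apply: sqmod_eq0.
by apply/eqP; rewrite eq_le sqmod_ge0 andbT -a0 sqmod_le_sqsum.
Qed.

Lemma sqsummable0 : sqsummable (0 : nat -> R[i]).
Proof.
apply: (proj1 (@sqsummable_bounded _ 0 _)) => N.
by rewrite /series/= big1// => i _; exact: sqmod0.
Qed.

Lemma sqsumD_le (t : R) a b : 0 < t -> sqsummable a -> sqsummable b ->
  sqsummable (a + b) /\
  sqsum (a + b) <= (1 + t) * sqsum a + (1 + t^-1) * sqsum b.
Proof.
move=> t0 ca cb; apply: sqsummable_bounded => N.
apply: (@le_trans _ _ ((1 + t) * series (sqmod \o a) N +
                       (1 + t^-1) * series (sqmod \o b) N)).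
  rewrite /series/= !mulr_sumr -big_split/=.
  by apply: ler_sum => i _; exact: sqmodD_le.
by apply: lerD; apply: ler_wpM2l; rewrite ?sqseries_le// addr_ge0// ?invr_ge0 ltW.
Qed.

Lemma sqsumZ (k : R[i]) a : sqsummable a ->
  sqsummable (k *: a) /\ sqsum (k *: a) = sqmod k * sqsum a.
Proof.
move=> ca.
have E : series (sqmod \o (k *: a)) = (fun N => sqmod k * series (sqmod \o a) N).
  apply/funext => N; rewrite /series/= mulr_sumr.
  by apply: eq_bigr => i _; rewrite -sqmodM.
have H : series (sqmod \o (k *: a)) @ \oo --> sqmod k * sqsum a.
  by rewrite E; exact: cvgMr.
split; first by apply/cvg_ex; exists (sqmod k * sqsum a).
exact: cvg_lim H.
Qed.

Lemma sqrt_sqsumD a b : sqsummable a -> sqsummable b ->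
  Num.sqrt (sqsum (a + b)) <= Num.sqrt (sqsum a) + Num.sqrt (sqsum b).
Proof.
move=> ca cb.
have [a0|a0] := eqVneq (sqsum a) 0.
  by rewrite (sqsum_eq0 ca a0) add0r lerDr sqrtr_ge0.
have [b0|b0] := eqVneq (sqsum b) 0.
  by rewrite (sqsum_eq0 cb b0) addr0 lerDl sqrtr_ge0.
have {}a0 : 0 < sqsum a by rewrite lt_def a0 sqsum_ge0.
have {}b0 : 0 < sqsum b by rewrite lt_def b0 sqsum_ge0.
set u := Num.sqrt (sqsum a); set v := Num.sqrt (sqsum b).
have u0 : 0 < u by rewrite sqrtr_gt0.
have v0 : 0 < v by rewrite sqrtr_gt0.
have [_] := sqsumD_le (divr_gt0 v0 u0) ca cb.
rewrite -(sqr_sqrtr (ltW a0)) -(sqr_sqrtr (ltW b0)) -/u -/v => H.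
rewrite -[leRHS](ger0_norm (addr_ge0 (ltW u0) (ltW v0))) -sqrtr_sqr.
apply: ler_wsqrtr; apply: (le_trans H).
rewrite le_eqVlt; apply/orP; left; apply/eqP; field.
by rewrite !gt_eqF.
Qed.

End SquareSummable.

Section H2.
Variable R : realType.

Definition h2_pred : {pred nat -> R[i]} :=
  fun a => `[< a 0%N = 0 /\ sqsummable a >].

(* The space H^2, its elements being identified with their coefficients. The
   index 0 carries no term of the series: its coefficient is 0. *)
Record H2 := MkH2 { h2_coef :> nat -> R[i]; h2_coefP : h2_coef \in h2_pred }.

Lemma h2_coef0 (f : H2) : f 0%N = 0.
Proof. by have /asboolP[] := h2_coefP f. Qed.

Lemma h2_sqsummable (f : H2) : sqsummable f.
Proof. by have /asboolP[] := h2_coefP f. Qed.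

Lemma h2_submod_closed : submod_closed h2_pred.
Proof.
split; first by apply/asboolP; split => //; exact: sqsummable0.
move=> k a b /asboolP[a0 ca] /asboolP[b0 cb]; apply/asboolP; split.
  by rewrite -[LHS]/(k * a 0%N + b 0%N) a0 b0 mulr0 addr0.
by have [] := sqsumD_le ltr01 (sqsumZ k ca).1 cb.
Qed.

HB.instance Definition _ :=
  GRing.isSubmodClosed.Build R[i] (nat -> R[i]) h2_pred h2_submod_closed.
HB.instance Definition _ := [isSub for h2_coef].
HB.instance Definition _ := [Choice of H2 by <:].
HB.instance Definition _ := [SubChoice_isSubLmodule of H2 by <:].

(* The square root of the sum of the |a_n|^2, as a (real) complex number since
   the norm of a normed module takes its values in the scalars *)
Definition h2_norm (f : H2) : R[i] := (Num.sqrt (sqsum f))%:C.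

Lemma h2_normD (f g : H2) : h2_norm (f + g) <= h2_norm f + h2_norm g.
Proof.
by rewrite /h2_norm -rmorphD/= lecR sqrt_sqsumD//; exact: h2_sqsummable.
Qed.

Lemma h2_normZ (k : R[i]) (f : H2) : h2_norm (k *: f) = `|k| * h2_norm f.
Proof.
rewrite /h2_norm norm_sqmod -rmorphM/= -sqrtrM ?sqmod_ge0//.
by rewrite (sqsumZ k (@h2_sqsummable f)).2.
Qed.

Lemma h2_norm_eq0 (f : H2) : h2_norm f = 0 -> f = 0.
Proof.
move=> [/eqP]; rewrite sqrtr_eq0 => f0; apply: val_inj => /=.
apply: (sqsum_eq0 (@h2_sqsummable f)).
by apply/eqP; rewrite eq_le f0 sqsum_ge0//; exact: h2_sqsummable.
Qed.

HB.instance Definition _ :=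
  Lmodule_isNormed.Build R[i] H2 h2_normD h2_normZ h2_norm_eq0.

End H2.

Definition compact_operator (R : realType) (V W : normedModType R[i])
    (T : {linear V -> W}) : Prop :=
  compact (closure (T @` [set v : V | `|v| <= 1])).

(* T is the composition operator f |-> f \o Phi on H^2; such a T is unique
   since a Dirichlet series determines its coefficients *)
Definition is_composition_operator (R : realType) (Phi : R[i] -> R[i])
    (T : {linear H2 R -> H2 R}) : Prop :=
  forall (f : H2 R) (s : R[i]), halfplane 2^-1 s ->
    dirichlet_series (T f) s = dirichlet_series f (Phi s).

Definition composition_compact_on_H2 (R : realType) (Phi : R[i] -> R[i]) :=
  exists2 T : {linear H2 R -> H2 R},
    is_composition_operator Phi T & compact_operator T.

(* phi and Phi are total functions of which only the values on halfplane 0,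
   where they are given by the Dirichlet series of phi, are specified. *)
Record c0_symbol (R : realType) (c0 : nat) (Phi phi : R[i] -> R[i])
    (c : nat -> R[i]) : Prop := {
  symbol_c0_ge1 : (1 <= c0)%N ;
  symbol_analytic : analytic_on (halfplane 2^-1) Phi ;
  symbol_maps : Phi @` halfplane 2^-1 `<=` halfplane 2^-1 ;
  symbolE : forall s, halfplane 0 s -> Phi s = c0%:R * s + phi s ;
  symbol_dirichlet : dirichlet_represents c phi ;
  symbol_uniform : forall eps : R, 0 < eps ->
    {uniform halfplane eps,
      (dirichlet_psum c : nat -> R[i] -> R[i]^o) @ \oo -->
      (phi : R[i] -> R[i]^o)} ;
  symbol_phi_maps : phi @` halfplane 0 `<=` halfplane 0 }.

Definition valent (R : realType) (k : nat) (Phi : R[i] -> R[i]) : Prop :=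
  forall w, halfplane 0 w -> ([set s | halfplane 0 s /\ Phi s = w] #<= `I_k)%card.

Definition finite_valent (R : realType) (Phi : R[i] -> R[i]) : Prop :=
  exists k, valent k Phi.

(* The sum is over distinct preimages; it is 0 if there is none. *)
Definition counting_function (R : realType) (Phi : R[i] -> R[i]) (s : R[i]) :
    \bar R :=
  (\esum_(a in [set a | halfplane 0%R a /\ Phi a = s]) (complex.Re a)%:E)%E.

(* F(s) tends to 0 as Re s tends to 0 in halfplane 0, uniformly in Im s *)
Definition vanishes_at_boundary (R : realType) (F : R[i] -> \bar R) : Prop :=
  ereal_sup [set `|F s|%E | s in [set s | 0 < complex.Re s < theta]]
    @[theta --> (0 : R)^'+] --> 0%E.

(* Main.v *)
Require Import Defs.
From HB Require Import structures.
From mathcomp Require Import all_boot all_order all_algebra.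
From mathcomp Require Import all_classical all_reals all_analysis.
From mathcomp Require Import complex.
From mathcomp Require Import ring lra.

Set Implicit Arguments.
Unset Strict Implicit.
Unset Printing Implicit Defensive.

Import Order.TTheory GRing.Theory Num.Theory.
Import numFieldNormedType.Exports.
Import Normc.

Local Open Scope classical_set_scope.
Local Open Scope ring_scope.

Local Notation Re := complex.Re.
Local Notation Im := complex.Im.
Local Notation dpsum := dirichlet_psum.

(** The composition operator is studied through the coefficients of the
    composed series. Since [phi] is supported on smooth integers and the
    sum of n^(-x) over smooth integers is finite for every x > 0
    ([smooth_sum_bounded]), the series of [phi] converges absolutely on
    the whole right half-plane ([symbol_abs_conv]). Hence n^(-Phi(s)) =
    n^(-c0 s) exp(- phi(s) ln n) is a uniform limit of Dirichlet
    polynomials whose indices are products of n^c0 by smooth integers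
    ([natpow_symbol_limit]), and it has coefficients b_{n,m} that vanish
    for m < n. Composition with [Phi] is therefore given by a triangular
    matrix and finite sums ([composition_coefs], [tri_op]), which reduces
    the theorem to inequalities on finite sums. All of the analysis is
    discrete: integrals are replaced by sums over fine grids, and
    derivatives are only used through Taylor estimates.

    That compactness follows from the vanishing of Re s / Re Phi(s) is due
    to a Littlewood-Paley bound. For a Dirichlet polynomial f, the sum of
    |b_m|^2 over the coefficients of f(Phi), the constant one excepted, is
    controlled by the mean over vertical lines of Re s |f'(Phi(s))|^2
    |Phi'(s)|^2 ([mean_square_characters], [lower_riemann_sum]). A change
    of variables turns this into a mean of |f'|^2 ([area_estimate]): [Phi]
    is locally invertible where its derivative is not small, each value is
    taken at most k times, and a rectangle of height T is sent into one of
    height c0 T + O(1) because Im phi is bounded. If Re s <= eps Re Phi(s)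
    whenever Re s < delta, the weight Re s becomes eps Re w, plus Re w /
    c0 for the points w with Re w at least c0 delta / 2, up to absolute
    constants, and the result is [key_estimate]: the sum of |b_m|^2 is at
    most a constant times the sum of |a_n|^2 (eps + n^(-c0 delta / 2)),
    where a_n are the coefficients of f. As Re s <= Re Phi(s), this bound
    with eps = 1 shows that the operator is bounded; with eps small it
    shows that the operator is small on the sequences supported far away,
    hence compact ([tri_op_compact]).

    Conversely, the image of the unit ball under a compact operator has
    uniformly small tails ([compact_uniform_tails]). Let f be the
    normalized reproducing kernel at Phi(s), restricted to finitely many
    smooth integers: its value there is essentially the norm of that
    kernel. This value is also that of the image of f at s, which small
    tails force to be negligible with respect to the norm of the kernel at
    s when s approaches the boundary, where this norm is unbounded
    ([smooth_sum_unbounded]). But [smooth_sum_le] bounds the norm of the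
    kernel at s by a constant times that of the kernel at Phi(s) as long
    as Re Phi(s) <= K Re s. So the ratio Re s / Re Phi(s) must tend to 0
    ([compact_ratio]).

    Finally the conditions on the ratio and on N_Phi are equivalent
    because a value w is taken at most k times, at points with real part
    at most Re w ([ratio_iff_counting]). *)

(** * The modulus and the exponential *)

Section ComplexModulus.
Variable R : realType.
Implicit Types (z w : R[i]) (x y : R).

Lemma le_of_eq x y : x = y -> x <= y. Proof. by move->. Qed.

Lemma normcE_sqmod z : normc z = Num.sqrt (sqmod z).
Proof. by case: z. Qed.

Lemma normc_ge0 z : 0 <= normc z.
Proof. by rewrite normcE_sqmod sqrtr_ge0. Qed.

Lemma normcX2 z : normc z ^+ 2 = sqmod z.
Proof. by rewrite normcE_sqmod sqr_sqrtr// sqmod_ge0. Qed.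

Lemma normrE_normc z : `|z| = (normc z)%:C%C.
Proof. by rewrite norm_sqmod normcE_sqmod. Qed.

Lemma normcD_le z w : normc (z + w) <= normc z + normc w.
Proof. exact: le_normcD. Qed.

Lemma normc_opp z : normc (- z) = normc z.
Proof. exact: normcN. Qed.

Lemma normcB z w : normc (z - w) = normc (w - z).
Proof. by rewrite -normc_opp opprB. Qed.

Lemma normcB_le z w : normc (z - w) <= normc z + normc w.
Proof. by rewrite -(normc_opp w) normcD_le. Qed.

Lemma normc_tri z w u : normc (z - w) <= normc (z - u) + normc (u - w).
Proof. by have := normcD_le (z - u) (u - w); rewrite addrA subrK. Qed.

Lemma normc_zero : normc (0 : R[i]) = 0. Proof. exact: normc0. Qed.
Lemma normc_one : normc (1 : R[i]) = 1. Proof. exact: normc1. Qed.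

Lemma normc_real x : normc (x%:C)%C = `|x|.
Proof. by rewrite normcE_sqmod /sqmod/= expr0n/= addr0 sqrtr_sqr. Qed.

Lemma normc_sum I (r : seq I) (P : pred I) (F : I -> R[i]) :
  normc (\sum_(i <- r | P i) F i) <= \sum_(i <- r | P i) normc (F i).
Proof.
elim/big_ind2 : _ => [|z x w y zx wy|i _]; rewrite ?normc_zero//.
exact: (le_trans (normcD_le _ _) (lerD _ _)).
Qed.

Lemma normcX z n : normc (z ^+ n) = normc z ^+ n.
Proof.
elim: n => [|n IH]; first by rewrite !expr0 normc_one.
by rewrite !exprS normcM IH.
Qed.

Lemma Re_le_normc z : `|Re z| <= normc z.
Proof.
by rewrite normcE_sqmod -sqrtr_sqr ler_wsqrtr// /sqmod lerDl sqr_ge0.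
Qed.

Lemma Im_le_normc z : `|Im z| <= normc z.
Proof.
by rewrite normcE_sqmod -sqrtr_sqr ler_wsqrtr// /sqmod lerDr sqr_ge0.
Qed.

Lemma normc_le_ReIm z : normc z <= `|Re z| + `|Im z|.
Proof.
rewrite normcE_sqmod -[leRHS]ger0_norm ?addr_ge0// -sqrtr_sqr ler_wsqrtr//.
rewrite /sqmod sqrrD -!normrX !(ger0_norm (sqr_ge0 _)) lerD2r lerDl.
by rewrite mulrn_wge0// mulr_ge0.
Qed.

Lemma cReD z w : Re (z + w) = Re z + Re w.
Proof. by case: z w => [? ?] []. Qed.
Lemma cImD z w : Im (z + w) = Im z + Im w.
Proof. by case: z w => [? ?] []. Qed.
Lemma cReN z : Re (- z) = - Re z.
Proof. by case: z. Qed.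
Lemma cImN z : Im (- z) = - Im z.
Proof. by case: z. Qed.
Lemma cReMr z x : Re (z * x%:C%C) = Re z * x.
Proof. by case: z => a b /=; rewrite mulr0 subr0. Qed.
Lemma cImMr z x : Im (z * x%:C%C) = Im z * x.
Proof. by case: z => a b /=; rewrite mulr0 add0r. Qed.
Lemma Re_natM n z : Re (n%:R * z) = n%:R * Re z.
Proof. by rewrite !mulr_natl; elim: n => [|n IH]; rewrite ?mulr0n// !mulrS cReD IH. Qed.
Lemma Im_natM n z : Im (n%:R * z) = n%:R * Im z.
Proof. by rewrite !mulr_natl; elim: n => [|n IH]; rewrite ?mulr0n// !mulrS cImD IH. Qed.

Lemma complex_ext z w :
  Re z = Re w -> Im z = Im w -> z = w.
Proof. by case: z w => [? ?] [? ?] /= -> ->. Qed.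

Lemma natrC n : (n%:R : R[i]) = (n%:R)%:C%C.
Proof. by rewrite rmorph_nat. Qed.

Lemma normc_nat n : normc (n%:R : R[i]) = n%:R.
Proof. by rewrite natrC normc_real ger0_norm. Qed.

Lemma normc_eq0P z : normc z <= 0 -> z = 0.
Proof. by move=> h; apply: eq0_normc; apply/eqP; rewrite eq_le h normc_ge0. Qed.

Lemma sin_le_abs y : `|sin y| <= `|y|.
Proof.
wlog y0 : y / 0 <= y.
  move=> H; have [/H//|/ltW y0] := leP 0 y.
  by rewrite -normrN -sinN -[leRHS]normrN H// oppr_ge0.
have [c _] := @MVT_segment R sin cos 0 y y0 (fun x _ => is_derive_sin x)
   (continuous_subspaceT (@continuous_sin R)).
rewrite sin0 !subr0 => ->; rewrite normrM ler_piMl//; exact: cos_max.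
Qed.

Lemma cosB1_le_sqr y : `|cos y - 1| <= y ^+ 2.
Proof.
wlog y0 : y / 0 <= y.
  move=> H; have [/H//|/ltW y0] := leP 0 y.
  by rewrite -cosN -sqrrN H// oppr_ge0.
have [c] := @MVT_segment R cos (fun x => - sin x) 0 y y0
   (fun x _ => is_derive_cos x) (continuous_subspaceT (@continuous_cos R)).
rewrite in_itv/= => /andP[c0 cy].
rewrite cos0 !subr0 => ->; rewrite normrM normrN expr2 (ger0_norm y0).
rewrite ler_wpM2r//; apply: (le_trans (sin_le_abs _)).
by rewrite ger0_norm.
Qed.

Lemma cosB1_le_abs y : `|cos y - 1| <= `|y|.
Proof.
wlog y0 : y / 0 <= y.
  move=> H; have [/H//|/ltW y0] := leP 0 y.
  by rewrite -cosN -[leRHS]normrN H// oppr_ge0.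
have [c _] := @MVT_segment R cos (fun x => - sin x) 0 y y0
   (fun x _ => is_derive_cos x) (continuous_subspaceT (@continuous_cos R)).
rewrite cos0 !subr0 => ->; rewrite normrM normrN ler_piMl//; exact: sin_max.
Qed.

Lemma sinBid_le_sqr y : `|sin y - y| <= y ^+ 2.
Proof.
wlog y0 : y / 0 <= y.
  move=> H; have [/H//|/ltW y0] := leP 0 y.
  have := H (- y); rewrite oppr_ge0 => /(_ y0).
  by rewrite sinN -opprD normrN sqrrN.
have [c] := @MVT_segment R sin cos 0 y y0 (fun x _ => is_derive_sin x)
   (continuous_subspaceT (@continuous_sin R)).
rewrite in_itv/= => /andP[c0 cy].
rewrite sin0 !subr0 => ->; rewrite -[X in _ - X]mul1r -mulrBl normrM.
rewrite expr2 (ger0_norm y0) ler_wpM2r//.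
by apply: (le_trans (cosB1_le_abs _)); rewrite ger0_norm.
Qed.

Lemma expRB1_le x : x <= 0 -> `|expR x - 1| <= `|x|.
Proof.
move=> x0; rewrite ler0_norm ?subr_le0 ?expR_le1// (ler0_norm x0).
by have := expR_ge1Dx x; lra.
Qed.

Lemma expRB1D_le x : x <= 0 -> `|expR x - 1 - x| <= x ^+ 2.
Proof.
move=> x0; rewrite ger0_norm; last by have := expR_ge1Dx x; lra.
have h : expR x <= (1 - x)^-1.
  rewrite -[x in leLHS]opprK expRN lef_pV2 ?posrE ?expR_gt0//; last lra.
  exact: expR_ge1Dx.
have : (1 - x)^-1 <= 1 + x + x ^+ 2.
  rewrite -[leLHS]mul1r ler_pdivrMr; last lra.
  have -> : (1 + x + x ^+ 2) * (1 - x) = 1 - x ^+ 3 by ring.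
  by rewrite lerDl oppr_ge0 exprS mulr_le0_ge0// sqr_ge0.
by move: h; lra.
Qed.

End ComplexModulus.

Section ComplexExp.
Variable R : realType.
Implicit Types (z w : R[i]) (x y : R).

Lemma cexpD z w : cexp (z + w) = cexp z * cexp w.
Proof.
case: z w => [a b] [c d]; rewrite /cexp/= expRD cosD sinD.
by apply: complex_ext => /=; ring.
Qed.

Lemma cexp0 : cexp (0 : R[i]) = 1.
Proof. by rewrite /cexp/= expR0 cos0 sin0; apply: complex_ext => /=; ring. Qed.

Lemma normc_cexp z : normc (cexp z) = expR (Re z).
Proof.
rewrite /cexp normcM normc_real (ger0_norm (expR_ge0 _)).
by rewrite [normc (_ +i* _)%C]normcE_sqmod /sqmod/= cos2Dsin2 sqrtr1 mulr1.
Qed.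

Lemma cexp_natM n z : cexp (n%:R * z) = cexp z ^+ n.
Proof.
elim: n => [|n IH]; first by rewrite mul0r cexp0 expr0.
by rewrite -natr1 mulrDl mul1r cexpD IH exprSr.
Qed.

Lemma cexpB1_le w : Re w <= 0 -> normc (cexp w - 1) <= 3 * normc w.
Proof.
case: w => x y; rewrite [Re _]/= => x0.
have h4 := Re_le_normc (x +i* y)%C; have h5 := Im_le_normc (x +i* y)%C.
move: h4 h5; set W := normc _; rewrite [Re _]/= [Im _]/= => h4 h5.
apply: (le_trans (normc_le_ReIm _)); rewrite /cexp/=.
have -> : expR x * cos y - 0 * sin y - 1 = expR x * (cos y - 1) + (expR x - 1).
  by ring.
have -> : expR x * sin y + 0 * cos y - 0 = expR x * sin y by ring.
have e1 : expR x <= 1 by rewrite expR_le1.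
have e0 := expR_ge0 x.
have h1 := cosB1_le_abs y; have h2 := expRB1_le x0; have h3 := sin_le_abs y.
have h6 : `|expR x * (cos y - 1)| <= `|y|.
  by rewrite normrM (ger0_norm e0); apply: le_trans h1; rewrite ler_piMl.
have h7 : `|expR x * sin y| <= `|y|.
  by rewrite normrM (ger0_norm e0); apply: le_trans h3; rewrite ler_piMl.
have h8 := ler_normD (expR x * (cos y - 1)) (expR x - 1).
lra.
Qed.

Lemma cexpB1D_le w :
  Re w <= 0 -> normc (cexp w - 1 - w) <= 4 * normc w ^+ 2.
Proof.
case: w => x y; rewrite [Re _]/= => x0.
apply: (le_trans (normc_le_ReIm _)); rewrite /cexp/= sqr_sqrtr ?addr_ge0 ?sqr_ge0//.
have -> : expR x * cos y - 0 * sin y - 1 - x =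
  expR x * (cos y - 1) + (expR x - 1 - x) by ring.
have -> : expR x * sin y + 0 * cos y - 0 - y =
  expR x * (sin y - y) + (expR x - 1) * y by ring.
have e1 : expR x <= 1 by rewrite expR_le1.
have e0 := expR_ge0 x.
have h1 := cosB1_le_sqr y; have h2 := expRB1D_le x0.
have h3 := sinBid_le_sqr y.
have h6 : `|expR x * (cos y - 1)| <= y ^+ 2.
  by rewrite normrM (ger0_norm e0); apply: le_trans h1; rewrite ler_piMl.
have h7 : `|expR x * (sin y - y)| <= y ^+ 2.
  by rewrite normrM (ger0_norm e0); apply: le_trans h3; rewrite ler_piMl.
have h8 := ler_normD (expR x * (cos y - 1)) (expR x - 1 - x).
have h9 := ler_normD (expR x * (sin y - y)) ((expR x - 1) * y).
have h10 : `|(expR x - 1) * y| <= x ^+ 2 + y ^+ 2.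
  rewrite normrM; apply: (@le_trans _ _ (`|x| * `|y|)).
    by rewrite ler_wpM2r// expRB1_le.
  have := sqr_ge0 (`|x| - `|y|).
  rewrite sqrrB !real_normK ?num_real// => h.
  have hh : 0 <= `|x| * `|y| by rewrite mulr_ge0.
  by move: h hh; rewrite mulr2n; lra.
have := sqr_ge0 x; have := sqr_ge0 y.
lra.
Qed.

(** The two estimates are invariant under exchange of the two points, so only
    the case where the quotient of the exponentials has modulus at most 1
    matters. *)
Lemma cexp_lipschitz (m : R) z z' : Re z <= m -> Re z' <= m ->
  normc (cexp z - cexp z') <= 3 * expR m * normc (z - z').
Proof.
wlog : z z' / Re z <= Re z' => [H zm zm'|zz' zm zm'].
  have [/H|/ltW h] := leP (Re z) (Re z'); first exact.
  by rewrite normcB [normc (z - z')]normcB; apply: H.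
have -> : cexp z - cexp z' = cexp z' * (cexp (z - z') - 1).
  by rewrite mulrBr mulr1 -cexpD addrCA subrr addr0.
rewrite normcM normc_cexp (mulrC 3) -mulrA ler_pM ?expR_ge0 ?normc_ge0//.
  by rewrite ler_expR.
by apply: cexpB1_le; rewrite cReD cReN subr_le0.
Qed.

Lemma cexp_taylor (m : R) z z' z0 :
  Re z <= m -> Re z' <= m -> Re z0 <= m ->
  normc (cexp z - cexp z' - cexp z0 * (z - z')) <=
    7 * expR m * normc (z - z') * (normc (z - z0) + normc (z' - z0)).
Proof.
wlog : z z' / Re z <= Re z' => [H zm zm' z0m|zz' zm zm' z0m].
  have [/H|/ltW h] := leP (Re z) (Re z'); first exact.
  have -> : cexp z - cexp z' - cexp z0 * (z - z') =
    - (cexp z' - cexp z - cexp z0 * (z' - z)) by ring.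
  by rewrite normc_opp [normc (z - z')]normcB (addrC (normc (z - z0))); apply: H.
have -> : cexp z - cexp z' - cexp z0 * (z - z') =
    cexp z' * (cexp (z - z') - 1 - (z - z')) +
    (cexp z' - cexp z0) * (z - z').
  have -> : cexp z = cexp z' * cexp (z - z').
    by rewrite -cexpD addrCA subrr addr0.
  by ring.
apply: (le_trans (normcD_le _ _)).
set w := normc (z - z').
have w0 : 0 <= w by exact: normc_ge0.
have h1 : normc (cexp z' * (cexp (z - z') - 1 - (z - z'))) <=
  expR m * (4 * w ^+ 2).
  rewrite normcM normc_cexp ler_pM ?expR_ge0 ?normc_ge0 ?ler_expR//.
  by apply: cexpB1D_le; rewrite cReD cReN subr_le0.
have h2 : normc ((cexp z' - cexp z0) * (z - z')) <=
  (3 * expR m * normc (z' - z0)) * w.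
  by rewrite normcM ler_wpM2r// cexp_lipschitz.
have h3 : w <= normc (z - z0) + normc (z' - z0).
  by rewrite (normcB z' z0) normc_tri.
have e0 := expR_ge0 m.
have h4 : expR m * (4 * w ^+ 2) <=
   4 * expR m * w * (normc (z - z0) + normc (z' - z0)).
  have -> : expR m * (4 * w ^+ 2) = 4 * expR m * w * w by ring.
  by rewrite ler_wpM2l// !mulr_ge0.
have h5 : 0 <= 3 * expR m * w * normc (z - z0).
  by rewrite !mulr_ge0 ?normc_ge0.
have h6 := lerD h1 h2.
have h7 : 4 * expR m * w * (normc (z - z0) + normc (z' - z0)) +
  3 * expR m * w * (normc (z - z0) + normc (z' - z0)) =
  7 * expR m * w * (normc (z - z0) + normc (z' - z0)) by ring.
rewrite -h7.
apply: (le_trans h6).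
rewrite lerD// [leRHS]mulrDr.
have -> : 3 * expR m * normc (z' - z0) * w = 3 * expR m * w * normc (z' - z0).
  by ring.
by rewrite lerDr.
Qed.

End ComplexExp.

(** * Dirichlet polynomials and their uniform limits *)

Section DirichletPolynomials.
Variable R : realType.
Implicit Types (s z w : R[i]) (x y : R) (p q : nat -> R[i]) (S : set nat).

Definition npow n x : R := expR (- (x * ln n%:R)).

Lemma npow_gt0 n x : 0 < npow n x. Proof. exact: expR_gt0. Qed.
Lemma npow_ge0 n x : 0 <= npow n x. Proof. exact: expR_ge0. Qed.

Lemma lnn_ge0 n : 0 <= ln n%:R :> R.
Proof. by case: n => [|n]; [rewrite ln0|rewrite ln_ge0// ler1n]. Qed.

Lemma npowD n x y : npow n (x + y) = npow n x * npow n y.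
Proof. by rewrite /npow -expRD mulrDl opprD. Qed.

Lemma npow_sqr n x : npow n x ^+ 2 = npow n (2 * x).
Proof. by rewrite /npow -expRM_natl; congr expR; ring. Qed.

Lemma npow_le n x y : x <= y -> npow n y <= npow n x.
Proof. by move=> xy; rewrite ler_expR lerN2 ler_wpM2r// lnn_ge0. Qed.

Lemma npow_le1 n x : 0 <= x -> npow n x <= 1.
Proof. by move=> x0; rewrite expR_le1 oppr_le0 mulr_ge0// lnn_ge0. Qed.

Lemma npow0 n : npow n 0 = 1.
Proof. by rewrite /npow mul0r oppr0 expR0. Qed.

Lemma npow_anti n m x : 0 <= x -> (0 < n)%N -> (n <= m)%N -> npow m x <= npow n x.
Proof.
move=> x0 n0 nm; rewrite ler_expR lerN2 ler_wpM2l// ler_ln ?posrE ?ltr0n//.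
  by rewrite ler_nat.
exact: leq_trans nm.
Qed.

Lemma npowM n m x : (0 < n)%N -> (0 < m)%N ->
  npow (n * m) x = npow n x * npow m x.
Proof.
move=> n0 m0; rewrite /npow natrM lnM ?posrE ?ltr0n// -expRD.
by rewrite mulrDr opprD.
Qed.

Lemma npow_expn n k x : (0 < n)%N -> npow (n ^ k) x = npow n (k%:R * x).
Proof.
move=> n0; rewrite /npow natrX lnXn ?ltr0n// -mulr_natl; congr (expR (- _)).
ring.
Qed.

Lemma normc_natpowN n s : normc (natpowN n s) = npow n (Re s).
Proof. by rewrite /natpowN normc_cexp cReN cReMr. Qed.

Lemma natpowND n s z : natpowN n (s + z) = natpowN n s * natpowN n z.
Proof. by rewrite /natpowN -cexpD mulrDl opprD. Qed.

Lemma natpowNM n m s : (0 < n)%N -> (0 < m)%N ->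
  natpowN (n * m) s = natpowN n s * natpowN m s.
Proof.
move=> n0 m0; rewrite /natpowN natrM lnM ?posrE ?ltr0n// -cexpD.
by rewrite rmorphD/= mulrDr opprD.
Qed.

Lemma natpowN1 s : natpowN 1 s = 1.
Proof. by rewrite /natpowN ln1 mulr0 oppr0 cexp0. Qed.

Lemma natpowN_expn n k s : (0 < n)%N -> natpowN (n ^ k) s = natpowN n (k%:R * s).
Proof.
move=> n0; rewrite /natpowN natrX lnXn ?ltr0n// -[ln _ *+ k]mulr_natl; congr (cexp (- _)).
by rewrite rmorphM/= -natrC; ring.
Qed.

(** Termwise derivative of the Dirichlet series with coefficients [p]. *)
Definition dcoef p n : R[i] := - ((ln n%:R)%:C%C * p n).

Definition supported S N p := forall n, p n != 0 -> S n /\ (0 < n <= N)%N.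

Lemma supported0 S N p n : supported S N p -> ~ (S n /\ (0 < n <= N)%N) -> p n = 0.
Proof. by move=> sp; apply: contra_notP => /eqP; exact: sp. Qed.

Lemma dpsum_widen S N M p s : supported S N p -> (N <= M)%N ->
  dpsum p M s = dpsum p N s.
Proof.
move=> sp NM; rewrite /dpsum (@big_cat_nat _ _ _ N.+1)//= [X in _ + X]big1_seq.
  by rewrite addr0.
move=> n /andP[_]; rewrite mem_index_iota => /andP[Nn _].
by rewrite (supported0 sp) ?mul0r// => -[_ /andP[_]]; rewrite leqNgt Nn.
Qed.

Lemma supported_dcoef S N p : supported S N p -> supported S N (dcoef p).
Proof.
move=> sp n; rewrite /dcoef oppr_eq0 mulf_eq0 negb_or => /andP[_]; exact: sp.
Qed.

Definition is_dpoly S (P P' : R[i] -> R[i]) := exists p N, supported S N p /\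
  forall s, P s = dpsum p N s /\ P' s = dpsum (dcoef p) N s.

Lemma is_dpoly0 S : is_dpoly S (fun=> 0) (fun=> 0).
Proof.
exists (fun=> 0), 0%N; split=> [n|s]; first by rewrite eqxx.
by rewrite /dpsum !big_geq.
Qed.

Lemma is_dpolyD S P P' Q Q' : is_dpoly S P P' -> is_dpoly S Q Q' ->
  is_dpoly S (fun s => P s + Q s) (fun s => P' s + Q' s).
Proof.
move=> [p [N [sp hp]]] [q [M [sq hq]]].
exists (fun n => p n + q n), (maxn N M); split=> [n|s].
  have [p0|p0 _] := eqVneq (p n) 0; last first.
    by have [? /andP[-> h]] := sp _ p0; split => //=; rewrite leq_max h.
  by rewrite p0 add0r => /sq[? /andP[-> h]]; split => //=; rewrite leq_max h orbT.
have [-> ->] := hp s; have [-> ->] := hq s.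
rewrite -(dpsum_widen s sp (leq_maxl N M)) -(dpsum_widen s sq (leq_maxr N M)).
rewrite -(dpsum_widen s (supported_dcoef sp) (leq_maxl N M)).
rewrite -(dpsum_widen s (supported_dcoef sq) (leq_maxr N M)).
by rewrite /dpsum -!big_split/=; split; apply: eq_bigr => n _;
  rewrite /dcoef; ring.
Qed.

Lemma is_dpoly_sum S I (r : seq I) (P P' : I -> R[i] -> R[i]) :
  (forall i, is_dpoly S (P i) (P' i)) ->
  is_dpoly S (fun s => \sum_(i <- r) P i s) (fun s => \sum_(i <- r) P' i s).
Proof.
move=> h; elim: r => [|i r IH].
  by under [X in is_dpoly _ X]eq_fun do rewrite big_nil;
     under [X in is_dpoly _ _ X]eq_fun do rewrite big_nil; exact: is_dpoly0.
under [X in is_dpoly _ X]eq_fun do rewrite big_cons.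
under [X in is_dpoly _ _ X]eq_fun do rewrite big_cons.
exact: is_dpolyD.
Qed.

Lemma is_dpoly_mono S n (k : R[i]) : (k != 0 -> S n /\ (0 < n)%N) ->
  is_dpoly S (fun s => k * natpowN n s)
    (fun s => - ((ln n%:R)%:C%C * k) * natpowN n s).
Proof.
have [->|k0 /(_ isT)[Sn n0]] := eqVneq k 0.
  move=> _; under [X in is_dpoly _ X]eq_fun do rewrite mul0r.
  by under [X in is_dpoly _ _ X]eq_fun do rewrite mulr0 oppr0 mul0r;
    exact: is_dpoly0.
exists (fun m => if m == n then k else 0), n; split => [m|s].
  by have [-> _|_] := eqVneq m n; rewrite ?eqxx// n0 leqnn.
rewrite /dpsum !(@big_cat_nat _ _ _ n 1 n.+1)//= !big_nat1 /dcoef eqxx.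
by split; rewrite big1_seq ?add0r// => m /andP[_];
  rewrite mem_index_iota => /andP[_ /ltn_eqF ->]; rewrite ?mulr0 ?oppr0 mul0r.
Qed.

Lemma is_dpolyM S1 S2 S P P' Q Q' : (forall a b, S1 a -> S2 b -> S (a * b)%N) ->
  is_dpoly S1 P P' -> is_dpoly S2 Q Q' ->
  is_dpoly S (fun s => P s * Q s) (fun s => P' s * Q s + P s * Q' s).
Proof.
move=> SM [p [N [sp hp]]] [q [M [sq hq]]].
have H : forall n m : nat,
    is_dpoly S (fun s => p n * natpowN n s * (q m * natpowN m s))
     (fun s => dcoef p n * natpowN n s * (q m * natpowN m s) +
       p n * natpowN n s * (dcoef q m * natpowN m s)).
  move=> n m; have [p0|p0] := eqVneq (p n) 0.
    under [X in is_dpoly _ X]eq_fun do rewrite p0 !mul0r.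
    by under [X in is_dpoly _ _ X]eq_fun do
      rewrite /dcoef p0 mulr0 oppr0 !mul0r add0r; exact: is_dpoly0.
  have [q0|q0] := eqVneq (q m) 0.
    under [X in is_dpoly _ X]eq_fun do rewrite q0 !mul0r mulr0.
    by under [X in is_dpoly _ _ X]eq_fun do
      rewrite /dcoef q0 mulr0 oppr0 !mul0r !mulr0 add0r; exact: is_dpoly0.
  have [Sn /andP[n0 _]] := sp _ p0; have [Sm /andP[m0 _]] := sq _ q0.
  under [X in is_dpoly _ X]eq_fun do rewrite mulrACA -natpowNM//.
  have := @is_dpoly_mono S (n * m)%N (p n * q m)
    (fun _ => conj (SM _ _ Sn Sm) (etrans (muln_gt0 _ _) (introT andP (conj n0 m0)))).
  congr is_dpoly; apply/funext => s.
  rewrite natpowNM// natrM lnM ?posrE ?ltr0n// /dcoef rmorphD/=; ring.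
have := @is_dpoly_sum S nat (index_iota 1 N.+1) _ _
  (fun n => @is_dpoly_sum S nat (index_iota 1 M.+1) _ _ (fun m => H n m)).
congr is_dpoly; apply/funext => s; have [-> E'] := hp s; have [-> F'] := hq s.
  rewrite /dpsum mulr_suml; apply: eq_bigr => n _.
  by rewrite mulr_sumr.
rewrite E' F' /dpsum 2!mulr_suml -big_split/=; apply: eq_bigr => n _.
by rewrite !mulr_sumr -big_split/=; apply: eq_bigr => m _.
Qed.

(** The pair ([F], [F']) is a uniform limit, on every half-plane whose closure
    lies in the right half-plane, of pairs formed by a Dirichlet polynomial and
    its derivative. Carrying the pair makes derivatives of sums, products and
    exponentials available without any differentiation. The set [S] records which
    indices occur: smoothness and divisibility of the indices have to be followed
    through these operations. *)
Definition dpoly_limit S (F F' : R[i] -> R[i]) := forall rho e : R,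
  0 < rho -> 0 < e -> exists P P', is_dpoly S P P' /\
  forall s, rho <= Re s -> normc (P s - F s) <= e /\ normc (P' s - F' s) <= e.

Lemma dpoly_limit_poly S P P' : is_dpoly S P P' -> dpoly_limit S P P'.
Proof.
move=> h rho e _ e0; exists P, P'; split => // s _.
by rewrite !subrr normc_zero ltW.
Qed.

Lemma dpoly_limit_lim S F F' : (forall rho e : R, 0 < rho -> 0 < e ->
  exists G G', dpoly_limit S G G' /\ forall s, rho <= Re s ->
    normc (G s - F s) <= e /\ normc (G' s - F' s) <= e) ->
  dpoly_limit S F F'.
Proof.
move=> h rho e r0 e0; have e20 : 0 < e / 2 by rewrite divr_gt0.
have [G [G' [hG hF]]] := h _ _ r0 e20.
have [P [P' [hP hPG]]] := hG _ _ r0 e20.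
exists P, P'; split => // s sr; have [h1 h2] := hF _ sr; have [h3 h4] := hPG _ sr.
have := normc_tri (P s) (F s) (G s); have := normc_tri (P' s) (F' s) (G' s).
lra.
Qed.

Lemma dpoly_limitD S F F' G G' : dpoly_limit S F F' -> dpoly_limit S G G' ->
  dpoly_limit S (fun s => F s + G s) (fun s => F' s + G' s).
Proof.
move=> hF hG rho e r0 e0; have e20 : 0 < e / 2 by rewrite divr_gt0.
have [P [P' [hP hPF]]] := hF _ _ r0 e20; have [Q [Q' [hQ hQG]]] := hG _ _ r0 e20.
exists (fun s => P s + Q s), (fun s => P' s + Q' s); split; first exact: is_dpolyD.
move=> s sr; have [h1 h2] := hPF _ sr; have [h3 h4] := hQG _ sr.
rewrite !opprD !(addrACA _ _ (- _)) (splitr e).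
by split; apply: (le_trans (normcD_le _ _)); rewrite lerD.
Qed.

Lemma is_dpoly_bounded S P P' : is_dpoly S P P' -> exists2 B : R, 0 <= B &
  forall s, 0 <= Re s -> normc (P s) <= B /\ normc (P' s) <= B.
Proof.
move=> [p [N [_ h]]].
have bnd (a : nat -> R[i]) s : 0 <= Re s ->
    normc (dpsum a N s) <= \sum_(1 <= n < N.+1) normc (a n).
  move=> s0; apply: (le_trans (normc_sum _ _ _)); apply: ler_sum => n _.
  by rewrite normcM normc_natpowN ler_piMr ?normc_ge0// npow_le1.
have nn (a : nat -> R[i]) : 0 <= \sum_(1 <= n < N.+1) normc (a n).
  by apply: sumr_ge0 => n _; exact: normc_ge0.
exists (\sum_(1 <= n < N.+1) normc (p n) + \sum_(1 <= n < N.+1) normc (dcoef p n)).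
  by rewrite addr_ge0.
move=> s s0; have [-> ->] := h s; split; apply: (le_trans (bnd _ _ s0)).
  by rewrite lerDl.
by rewrite lerDr.
Qed.

Lemma dpoly_limit_bounded S F F' (rho : R) : dpoly_limit S F F' -> 0 < rho ->
  exists2 B : R, 0 <= B & forall s, rho <= Re s ->
    normc (F s) <= B /\ normc (F' s) <= B.
Proof.
move=> h r0; have [P [P' [/is_dpoly_bounded[B B0 hB] hPF]]] := h _ _ r0 ltr01.
exists (B + 1); first by rewrite addr_ge0.
move=> s sr; have [h1 h2] := hPF _ sr.
have [h3 h4] := hB s (le_trans (ltW r0) sr).
have := normcB_le (P s) (P s - F s); have := normcB_le (P' s) (P' s - F' s).
rewrite !opprB !(addrC _ (_ - _)) !subrK; lra.
Qed.

Lemma dpoly_limitM S1 S2 S F F' G G' :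
  (forall a b, S1 a -> S2 b -> S (a * b)%N) ->
  dpoly_limit S1 F F' -> dpoly_limit S2 G G' ->
  dpoly_limit S (fun s => F s * G s) (fun s => F' s * G s + F s * G' s).
Proof.
move=> SM hF hG rho e r0 e0.
have [A A0 hA] := dpoly_limit_bounded hF r0.
have [B B0 hB] := dpoly_limit_bounded hG r0.
pose M := A + B + 1; have M0 : 0 < M by rewrite ltr_pwDr// addr_ge0.
pose d := Num.min 1 (e / (4 * M)).
have d0 : 0 < d by rewrite lt_min ltr01/= divr_gt0// mulr_gt0.
have d1 : d <= 1 by rewrite ge_min lexx.
have dM : 4 * M * d <= e.
  by rewrite mulrC -ler_pdivlMr ?mulr_gt0// ge_min lexx orbT.
have [P [P' [hP hPF]]] := hF _ _ r0 d0; have [Q [Q' [hQ hQG]]] := hG _ _ r0 d0.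
exists (fun s => P s * Q s), (fun s => P' s * Q s + P s * Q' s).
split; first exact: (is_dpolyM SM).
move=> s sr; have [h1 h2] := hPF _ sr; have [h3 h4] := hQG _ sr.
have [a1 a2] := hA _ sr; have [b1 b2] := hB _ sr.
have key (x y u v : R[i]) : normc (x - u) <= d -> normc (y - v) <= d ->
    normc u <= A -> normc v <= B -> normc (x * y - u * v) <= 2 * M * d.
  move=> xu yv uA vB.
  have -> : x * y - u * v = (x - u) * (y - v) + (x - u) * v + u * (y - v) by ring.
  apply: (le_trans (normcD_le _ _)).
  have i1 := normcD_le ((x - u) * (y - v)) ((x - u) * v).
  rewrite !normcM in i1 *.
  have i2 : normc (x - u) * normc (y - v) <= d * 1.
    by rewrite ler_pM ?normc_ge0// (le_trans yv).
  have i3 : normc (x - u) * normc v <= d * B by rewrite ler_pM ?normc_ge0.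
  have i4 : normc u * normc (y - v) <= A * d by rewrite ler_pM ?normc_ge0.
  have i5 : M * d = A * d + d * B + d * 1 by rewrite /M; ring.
  have i6 : 0 <= M * d by rewrite mulr_ge0 ?ltW.
  lra.
split.
  by apply: (le_trans (key _ _ _ _ h1 h3 a1 b1)); lra.
have -> : P' s * Q s + P s * Q' s - (F' s * G s + F s * G' s) =
  (P' s * Q s - F' s * G s) + (P s * Q' s - F s * G' s) by ring.
apply: (le_trans (normcD_le _ _)).
have := key _ _ _ _ h2 h3 a2 b1; have := key _ _ _ _ h1 h4 a1 b2; lra.
Qed.

Lemma dpoly_limit_mono S n (k : R[i]) : S n -> (0 < n)%N ->
  dpoly_limit S (fun s => k * natpowN n s)
    (fun s => - ((ln n%:R)%:C%C * k) * natpowN n s).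
Proof. by move=> Sn n0; apply/dpoly_limit_poly/is_dpoly_mono. Qed.

Lemma dpoly_limit_const S (k : R[i]) : S 1%N -> dpoly_limit S (fun=> k) (fun=> 0).
Proof.
move=> S1; have := @dpoly_limit_mono S 1 k S1 isT.
congr dpoly_limit; apply/funext => s; first by rewrite natpowN1 mulr1.
by rewrite ln1 !mul0r oppr0 mul0r.
Qed.

Lemma dpoly_limitZ S (k : R[i]) F F' : dpoly_limit S F F' ->
  dpoly_limit S (fun s => k * F s) (fun s => k * F' s).
Proof.
move=> h; have SM (a b : nat) : [set 1%N] a -> S b -> S (a * b)%N.
  by move=> ->; rewrite mul1n.
have := dpoly_limitM SM (@dpoly_limit_const [set 1%N] k erefl) h.
by congr dpoly_limit; apply/funext => s; rewrite mul0r add0r.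
Qed.

Lemma dpoly_limitX S F F' n : S 1%N -> (forall a b, S a -> S b -> S (a * b)%N) ->
  dpoly_limit S F F' ->
  dpoly_limit S (fun s => F s ^+ n.+1) (fun s => n.+1%:R * F' s * F s ^+ n).
Proof.
move=> S1 SM h; elim: n => [|n IH].
  rewrite (_ : (fun s => F s ^+ 1) = F)//.
  by under [X in dpoly_limit _ _ X]eq_fun do rewrite expr0 mul1r mulr1.
have := dpoly_limitM SM h IH.
congr dpoly_limit; apply/funext => s.
by rewrite -(natr1 n.+1) [F s ^+ n.+1]exprS; ring.
Qed.

End DirichletPolynomials.

Section ExpLimit.
Variable R : realType.
Implicit Types (s z w : R[i]) (S : set nat).

Lemma exprB_normc_le z w (E : R) n : normc z <= E -> normc w <= E ->
  normc (z ^+ n.+1 - w ^+ n.+1) <= n.+1%:R * E ^+ n * normc (z - w).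
Proof.
move=> zE wE; have E0 : 0 <= E by exact: le_trans (normc_ge0 _) zE.
elim: n => [|n IH]; first by rewrite !expr1 expr0 !mul1r.
have -> : z ^+ n.+2 - w ^+ n.+2 = z * (z ^+ n.+1 - w ^+ n.+1) + (z - w) * w ^+ n.+1.
  by rewrite !(exprS _ n.+1); ring.
apply: (le_trans (normcD_le _ _)); rewrite !normcM normcX.
have h1 : normc z * normc (z ^+ n.+1 - w ^+ n.+1) <=
    E * (n.+1%:R * E ^+ n * normc (z - w)).
  by rewrite ler_pM ?normc_ge0.
have h2 : normc (z - w) * normc w ^+ n.+1 <= normc (z - w) * E ^+ n.+1.
  by rewrite ler_wpM2l ?normc_ge0// lerXn2r ?nnegrE ?normc_ge0.
apply: (le_trans (lerD h1 h2)); apply: le_of_eq.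
by rewrite -(natr1 n.+1) (exprS E n); ring.
Qed.

(** Euler's limit (1 + w/K)^K is used rather than the exponential series: only
    one power has to be differentiated. *)
Lemma cexp_euler (B : R) w n : normc w <= B ->
  normc ((1 + n.+1%:R^-1 * w) ^+ n.+1 - cexp w) <= 7 * expR (2 * B) * B ^+ 2 / n.+1%:R
  /\ normc ((1 + n.+1%:R^-1 * w) ^+ n - cexp w) <=
      (7 * B ^+ 2 + B) * expR (2 * B) / n.+1%:R.
Proof.
move=> wB; have B0 : 0 <= B by exact: le_trans (normc_ge0 _) wB.
set K : R := n.+1%:R; have K0 : 0 < K by rewrite ltr0n.
pose u := n.+1%:R^-1 * w.
have uB : normc u <= B / K.
  by rewrite /u normcM normcV normc_nat mulrC ler_wpM2r// invr_ge0 ltW.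
have Ew : cexp w = cexp u ^+ n.+1.
  by rewrite -cexp_natM /u mulrA mulfV ?mul1r// pnatr_eq0.
pose E := expR (B / K).
have BK0 : 0 <= B / K by rewrite divr_ge0// ltW.
have E1 : 1 <= E by rewrite /E -expR0 ler_expR.
have EK : E ^+ n.+1 = expR B.
  by rewrite -expRM_natl mulrCA mulfV ?mulr1// gt_eqF.
have uE : normc (1 + u) <= E.
  apply: (le_trans (normcD_le _ _)); rewrite normc_one.
  by apply: le_trans (expR_ge1Dx _); rewrite lerD2l.
have Reu : Re u <= B / K.
  by apply: le_trans uB; apply: le_trans (Re_le_normc _); exact: ler_norm.
have ceE : normc (cexp u) <= E by rewrite normc_cexp ler_expR.
have d1 : normc (1 + u - cexp u) <= 7 * E * (B / K) ^+ 2.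
  have := @cexp_taylor R (B / K) u 0 0 Reu BK0 BK0.
  rewrite cexp0 mul1r !subr0 normc_zero addr0 normcB.
  have -> : 1 + u - cexp u = - (cexp u - 1 - u) by ring.
  rewrite normc_opp normcB => /le_trans; apply.
  rewrite -mulrA -expr2 ler_wpM2l ?mulr_ge0 ?expR_ge0//.
  by rewrite lerXn2r ?nnegrE ?normc_ge0.
have En : E ^+ n <= expR B by rewrite -EK exprS ler_peMl// exprn_ge0 ?expR_ge0.
have EB : E <= expR B.
  by rewrite ler_expR ler_pdivrMr// ler_peMr// ler1n.
have e2 : expR (2 * B) = expR B * expR B by rewrite -expRD; congr expR; ring.
have e0 := expR_ge0 B.
have H : normc ((1 + u) ^+ n.+1 - cexp w) <= 7 * expR (2 * B) * B ^+ 2 / K.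
  rewrite Ew; apply: (le_trans (exprB_normc_le n uE ceE)).
  apply: (@le_trans _ _ (K * expR B * (7 * expR B * (B / K) ^+ 2))).
    rewrite ler_pM ?normc_ge0//.
    - by rewrite !mulr_ge0 ?exprn_ge0 ?expR_ge0.
    - by rewrite ler_wpM2l.
    - by apply: (le_trans d1); rewrite ler_wpM2r ?sqr_ge0// ler_wpM2l.
  rewrite e2; apply: le_of_eq; field.
  by rewrite gt_eqF.
split => //.
have -> : (1 + u) ^+ n - cexp w = ((1 + u) ^+ n.+1 - cexp w) - u * (1 + u) ^+ n.
  by rewrite exprS; ring.
apply: (le_trans (normcB_le _ _)).
have -> : (7 * B ^+ 2 + B) * expR (2 * B) / K =
   7 * expR (2 * B) * B ^+ 2 / K + B / K * expR (2 * B) by ring.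
apply: lerD => //; rewrite normcM normcX ler_pM ?exprn_ge0 ?normc_ge0//.
apply: (@le_trans _ _ (E ^+ n)).
  by rewrite lerXn2r ?nnegrE ?normc_ge0// expR_ge0.
apply: (le_trans En); rewrite ler_expR; lra.
Qed.

Lemma dpoly_limit_exp S (G G' : R[i] -> R[i]) : S 1%N ->
  (forall a b, S a -> S b -> S (a * b)%N) -> dpoly_limit S G G' ->
  dpoly_limit S (fun s => cexp (G s)) (fun s => G' s * cexp (G s)).
Proof.
move=> S1 SM hG; apply: dpoly_limit_lim => rho e r0 e0.
have [B B0 hB] := dpoly_limit_bounded hG r0.
pose C := (7 * B ^+ 2 + B) * expR (2 * B) * (1 + B) + 7 * expR (2 * B) * B ^+ 2.
have C0 : 0 <= C.
  by rewrite /C addr_ge0// !mulr_ge0 ?addr_ge0 ?mulr_ge0 ?sqr_ge0 ?expR_ge0.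
pose n := Num.truncn (C / e).
have nC : C / n.+1%:R <= e.
  rewrite ler_pdivrMr ?ltr0n// mulrC -ler_pdivrMr//.
  exact/ltW/truncnS_gt.
pose H s := 1 + n.+1%:R^-1 * G s.
have hH : dpoly_limit S H (fun s => n.+1%:R^-1 * G' s).
  have := dpoly_limitD (dpoly_limit_const (1 : R[i]) S1) (dpoly_limitZ n.+1%:R^-1 hG).
  by congr dpoly_limit; apply/funext => s; rewrite add0r.
exists (fun s => H s ^+ n.+1), (fun s => G' s * H s ^+ n); split.
  have := dpoly_limitX n S1 SM hH.
  congr dpoly_limit; apply/funext => s; congr (_ * _).
  by rewrite mulrA mulfV ?mul1r// pnatr_eq0.
move=> s sr; have [g1 g2] := hB _ sr; have [h1 h2] := cexp_euler n g1.
have K0 : 0 <= (n.+1%:R : R)^-1 by rewrite invr_ge0.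
have x0 : 0 <= (7 * B ^+ 2 + B) * expR (2 * B) / n.+1%:R.
  exact: le_trans (normc_ge0 _) h2.
have y0 : 0 <= 7 * expR (2 * B) * B ^+ 2 / n.+1%:R.
  exact: le_trans (normc_ge0 _) h1.
have CE : C / n.+1%:R = (7 * B ^+ 2 + B) * expR (2 * B) / n.+1%:R +
   B * ((7 * B ^+ 2 + B) * expR (2 * B) / n.+1%:R) +
   7 * expR (2 * B) * B ^+ 2 / n.+1%:R.
  by rewrite /C; ring.
have Bx0 := mulr_ge0 B0 x0.
move: nC; rewrite CE; move: h1 h2 x0 y0 Bx0 => + + + + + {CE}.
set a := (7 * B ^+ 2 + B) * _ / _; set b := 7 * _ * _ / _.
set Ba := B * a => h1 h2 x0 y0 Bx0 nC.
split; first by apply: (le_trans h1); lra.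
rewrite -mulrBr normcM.
have : normc (G' s) * normc (H s ^+ n - cexp (G s)) <=
    Ba by rewrite ler_pM ?normc_ge0.
lra.
Qed.

End ExpLimit.

(** * Mean values and coefficients *)

Section CauchySequences.
Variable R : realType.

Lemma real_cauchy_lim (u : nat -> R) :
  (forall e, 0 < e -> exists K, forall k k', (K <= k)%N -> (K <= k')%N ->
    `|u k - u k'| <= e) ->
  exists l, forall e, 0 < e -> exists K, forall k, (K <= k)%N -> `|u k - l| <= e.
Proof.
move=> h; have /cvg_ex[l ul] : cvgn u.
  apply: cauchy_cvg; apply/cauchy_exP => e e0.
  have [K hK] := h _ (divr_gt0 e0 (ltr0Sn R 1)).
  exists (u K); exists K => // k /= Kk; rewrite /ball/=.
  by apply: (le_lt_trans (hK _ _ (leqnn K) Kk)); rewrite ltr_pdivrMr// ltr_pMr// ltr1n.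
exists l => e e0; move/cvgrPdist_le : ul => /(_ e e0)[K _ hK].
by exists K => k Kk; rewrite distrC; exact: hK.
Qed.

Lemma complex_cauchy_lim (u : nat -> R[i]) :
  (forall e : R, 0 < e -> exists K, forall k k', (K <= k)%N -> (K <= k')%N ->
    normc (u k - u k') <= e) ->
  exists l, forall e : R, 0 < e -> exists K, forall k, (K <= k)%N ->
    normc (u k - l) <= e.
Proof.
move=> h.
have [|a ha] := @real_cauchy_lim (fun k => Re (u k)).
  move=> e e0; have [K hK] := h _ e0; exists K => k k' Kk Kk'.
  by rewrite -cReN -cReD (le_trans (Re_le_normc _))// hK.
have [|b hb] := @real_cauchy_lim (fun k => Im (u k)).
  move=> e e0; have [K hK] := h _ e0; exists K => k k' Kk Kk'.
  by rewrite -cImN -cImD (le_trans (Im_le_normc _))// hK.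
exists (a +i* b)%C => e e0; have e20 : 0 < e / 2 by rewrite divr_gt0.
have [K hK] := ha _ e20; have [L hL] := hb _ e20.
exists (maxn K L) => k; rewrite geq_max => /andP[/hK h1 /hL h2].
apply: (le_trans (normc_le_ReIm _)); rewrite cReD cImD cReN cImN/=; lra.
Qed.

End CauchySequences.

Section MeanValue.
Variable R : realType.
Implicit Types (s z w : R[i]) (x y : R) (p q b : nat -> R[i]) (S : set nat).

Lemma sqmodC z : (sqmod z)%:C%C = z * conjc z.
Proof. by case: z => a b; apply: complex_ext; rewrite /sqmod/=; ring. Qed.

Lemma normc_conjc z : normc (conjc z) = normc z.
Proof. by rewrite !normcE_sqmod; case: z => a b; rewrite /sqmod/= sqrrN. Qed.

Lemma mulc_conj1 z : normc z = 1 -> z * conjc z = 1.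
Proof. by move=> z1; rewrite -sqmodC -normcX2 z1 expr1n. Qed.

(** The off-diagonal terms of the square are geometric sums of ratio different
    from 1, hence bounded: the mean square of a finite sum of distinct
    characters of the integers is the sum of the squared moduli. *)
Lemma mean_square_characters (r : seq nat) (a z : nat -> R[i]) : uniq r ->
  (forall n, normc (z n) = 1) -> {in r &, injective z} ->
  exists C : R, forall J, `|\sum_(j < J) sqmod (\sum_(n <- r) a n * z n ^+ j) -
     J%:R * \sum_(n <- r) sqmod (a n)| <= C.
Proof.
move=> ur z1 zinj.
pose G n m J : R[i] := \sum_(j < J) (z n * conjc (z m)) ^+ j.
pose B n m : R := if n == m then 0 else 2 / normc (z n * conjc (z m) - 1).
have HB n m J : n \in r -> m \in r ->
    normc (G n m J - (if n == m then J%:R else 0)) <= B n m.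
  move=> nr mr; rewrite /G /B; have [->|nm] := eqVneq n m.
    rewrite mulc_conj1// (eq_bigr (fun=> 1)); last by move=> j _; rewrite expr1n.
    by rewrite sumr_const card_ord subrr normc_zero.
  have zz : z n * conjc (z m) - 1 != 0.
    rewrite subr_eq0; apply: contra nm => /eqP h; apply/eqP/zinj => //.
    have := congr1 ( *%R ^~ (z m)) h; rewrite mul1r -mulrA (mulrC (conjc _)).
    by rewrite mulc_conj1// mulr1.
  have nz : 0 < normc (z n * conjc (z m) - 1).
    rewrite lt_def normc_ge0 andbT; apply: contra zz => /eqP/eq0_normc ->//.
  rewrite [X in normc X]subr0 ler_pdivlMr// -normcM mulrC -subrX1.
  apply: (le_trans (normcB_le _ _)); rewrite normcX normcM normc_conjc !z1.
  by rewrite mulr1 expr1n normc_one.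
have E J : (\sum_(j < J) sqmod (\sum_(n <- r) a n * z n ^+ j) -
     J%:R * \sum_(n <- r) sqmod (a n))%:C%C =
   \sum_(n <- r) \sum_(m <- r) a n * conjc (a m) *
     (G n m J - (if n == m then J%:R else 0)).
  rewrite rmorphB rmorphM /= !rmorph_sum /=.
  rewrite (eq_bigr (fun j : 'I_J => \sum_(n <- r) \sum_(m <- r)
     a n * conjc (a m) * (z n * conjc (z m)) ^+ j)); last first.
    move=> j _; rewrite sqmodC rmorph_sum mulr_suml; apply: eq_bigr => n _.
    rewrite mulr_sumr; apply: eq_bigr => m _.
    by rewrite rmorphM rmorphXn /= exprMn mulrACA.
  rewrite exchange_big/= mulr_sumr -sumrB; apply: eq_big_seq => n nr.
  rewrite exchange_big/=.
  under [RHS]eq_bigr do rewrite mulrBr.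
  rewrite sumrB; congr (_ - _).
    by apply: eq_bigr => m _; rewrite mulr_sumr.
  rewrite (bigD1_seq n)//= eqxx [X in _ + X]big1 ?addr0.
    by rewrite sqmodC mulrC rmorph_nat.
  by move=> m mn; rewrite eq_sym (negbTE mn) mulr0.
exists (\sum_(n <- r) \sum_(m <- r) normc (a n) * normc (a m) * B n m) => J.
rewrite -normc_real E; apply: (le_trans (normc_sum _ _ _)).
rewrite big_seq [leRHS]big_seq; apply: ler_sum => n nr.
apply: (le_trans (normc_sum _ _ _)).
rewrite big_seq [leRHS]big_seq; apply: ler_sum => m mr.
rewrite !normcM normc_conjc ler_wpM2l ?HB//.
by rewrite mulr_ge0 ?normc_ge0.
Qed.

(** Once h ln N is at most 1, the angles h ln n with n up to N lie in [0, pi],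
    where the cosine is injective. *)
Lemma natpowN_imag_inj (h : R) N : 0 < h -> h * ln N%:R <= 1 ->
  {in index_iota 1 N.+1 &, injective (fun n => natpowN n (0 +i* h)%C)}.
Proof.
move=> h0 hN n m; rewrite !mem_index_iota => /andP[n0 nN] /andP[m0 mN].
move=> /(congr1 (@Re R)).
rewrite /natpowN /cexp !(cReN, cImN, cReMr, cImMr)/= !mul0r !oppr0 !expR0.
rewrite !mul1r !addr0 !cosN => /cos_inj.
have itv k : (0 < k)%N -> (k < N.+1)%N -> h * ln k%:R \in `[0, pi].
  move=> k0 kN; rewrite in_itv/=; apply/andP; split.
    by rewrite mulr_ge0 ?lnn_ge0 ?ltW.
  have p1 : 1 <= pi :> R by apply: le_trans (pi_ge2 R); rewrite ler1n.
  apply: le_trans p1.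
  apply: le_trans hN; rewrite ler_pM2l// ler_ln ?posrE ?ltr0n// ?ler_nat//.
  exact: leq_trans k0 _.
move=> /(_ (itv _ n0 nN) (itv _ m0 mN)) /(mulfI (negbT (gt_eqF h0))).
move=> /ln_inj; rewrite !posrE !ltr0n => /(_ n0 m0)/eqP.
by rewrite eqr_nat => /eqP.
Qed.

Definition vstep (s0 : R[i]) (h : R) (j : nat) : R[i] := s0 + j%:R * (0 +i* h)%C.

Lemma Re_vstep s0 h j : Re (vstep s0 h j) = Re s0.
Proof. by rewrite /vstep cReD Re_natM/= mulr0 addr0. Qed.

Lemma Im_vstep s0 h j : Im (vstep s0 h j) = Im s0 + j%:R * h.
Proof. by rewrite /vstep cImD Im_natM/=. Qed.

(** Discrete form of the mean value theorem for Dirichlet polynomials: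
    sampling a vertical line replaces integrating over it as soon as the step
    separates the frequencies that occur. *)
Lemma mean_value_dpsum p N (h : R) s0 : 0 < h -> h * ln N%:R <= 1 ->
  exists C : R, forall J, `|\sum_(j < J) sqmod (dpsum p N (vstep s0 h j)) -
    J%:R * \sum_(1 <= n < N.+1) sqmod (p n) * npow n (2 * Re s0)| <= C.
Proof.
move=> h0 hN.
have z1 n : normc (natpowN n (0 +i* h)%C) = 1.
  by rewrite normc_natpowN/= npow0.
have [C hC] := @mean_square_characters (index_iota 1 N.+1)
  (fun n => p n * natpowN n s0) _ (iota_uniq _ _) z1 (natpowN_imag_inj h0 hN).
exists C => J; have := hC J.
have -> : \sum_(1 <= n < N.+1) sqmod (p n) * npow n (2 * Re s0) =
  \sum_(1 <= n < N.+1) sqmod (p n * natpowN n s0).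
  apply: eq_bigr => n _; rewrite sqmodM; congr (_ * _).
  by rewrite -normcX2 normc_natpowN npow_sqr.
suff -> : \sum_(j < J) sqmod (dpsum p N (vstep s0 h j)) =
  \sum_(j < J) sqmod (\sum_(1 <= n < N.+1)
    p n * natpowN n s0 * natpowN n (0 +i* h)%C ^+ j) by [].
apply: eq_bigr => j _; congr sqmod; apply: eq_bigr => n _.
rewrite /vstep natpowND -mulrA; congr (_ * (_ * _)).
by rewrite /natpowN -cexp_natM; congr cexp; ring.
Qed.

Lemma exists_step N : exists2 h : R, 0 < h & forall k, 0 < k <= h ->
  k * ln N%:R <= 1.
Proof.
exists (1 + ln N%:R)^-1; first by rewrite invr_gt0 ltr_wpDr// lnn_ge0.
move=> k /andP[k0 kh].
have l0 : 0 <= ln N%:R :> R by exact: lnn_ge0.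
apply: (@le_trans _ _ ((1 + ln N%:R)^-1 * (1 + ln N%:R))).
  by apply: ler_pM => //; [exact: ltW|rewrite lerDr].
by rewrite mulVf// gt_eqF// ltr_wpDr.
Qed.

Lemma arch_le0 (x C : R) : (forall J : nat, J%:R * x <= C) -> x <= 0.
Proof.
move=> h; rewrite leNgt; apply/negP => x0.
have := h (Num.truncn (C / x)).+1; rewrite -ler_pdivlMr// leNgt truncnS_gt//.
Qed.

(** The error in the mean value is bounded, hence negligible with respect to
    the number of samples. *)
Lemma bessel_line p N (sigma B : R) :
  (forall s, Re s = sigma -> sqmod (dpsum p N s) <= B) ->
  \sum_(1 <= n < N.+1) sqmod (p n) * npow n (2 * sigma) <= B.
Proof.
move=> hB; have [h h0 hh] := exists_step N.
have hN : h * ln N%:R <= 1 by apply: hh; rewrite h0 lexx.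
have [C hC] := mean_value_dpsum p (sigma +i* 0)%C h0 hN.
rewrite -subr_le0; apply: (@arch_le0 _ C) => J.
have := hC J; rewrite [Re _]/= distrC => /(le_trans (ler_norm _)).
apply: le_trans; rewrite mulrBr lerB//.
apply: (@le_trans _ _ (\sum_(j < J) B)).
  by apply: ler_sum => j _; apply: hB; rewrite Re_vstep.
by rewrite sumr_const card_ord mulr_natl.
Qed.

End MeanValue.

Section Coefficients.
Variable R : realType.
Implicit Types (s z w : R[i]) (x y : R) (p q b : nat -> R[i]) (S : set nat).

Lemma ler_sum_nat_widen (f : nat -> R) M K : (forall n, 0 <= f n) -> (M <= K)%N ->
  \sum_(1 <= n < M) f n <= \sum_(1 <= n < K) f n.
Proof.
move=> f0 MK; case: M MK => [|M] MK; first by rewrite big_geq// sumr_ge0.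
rewrite [leRHS](@big_cat_nat _ _ _ M.+1)//= lerDl sumr_ge0//.
Qed.

Lemma bessel_supported S N p (sigma e : R) M : supported S N p ->
  (forall s, Re s = sigma -> normc (dpsum p N s) <= e) ->
  \sum_(1 <= n < M) sqmod (p n) * npow n (2 * sigma) <= e ^+ 2.
Proof.
move=> sp hp.
apply: le_trans (@bessel_line R p (maxn M N) sigma (e ^+ 2) _).
  apply: ler_sum_nat_widen; last by rewrite leqW// leq_maxl.
  by move=> n; rewrite mulr_ge0 ?sqmod_ge0 ?npow_ge0.
move=> s ss; rewrite (dpsum_widen s sp (leq_maxr _ _)) -normcX2.
by rewrite lerXn2r ?nnegrE ?normc_ge0 ?hp// (le_trans (normc_ge0 _) (hp _ ss)).
Qed.

Lemma supportedB S N M p q : supported S N p -> supported S M q ->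
  supported S (maxn N M) (fun n => p n - q n).
Proof.
move=> sp sq n; have [p0|p0 _] := eqVneq (p n) 0; last first.
  by have [? /andP[-> h]] := sp _ p0; split => //=; rewrite leq_max h.
rewrite p0 sub0r oppr_eq0 => /sq[? /andP[-> h]].
by split => //=; rewrite leq_max h orbT.
Qed.

Lemma dpsumB p q N s : dpsum (fun n => p n - q n) N s =
  dpsum p N s - dpsum q N s.
Proof.
by rewrite /dpsum -sumrB; apply: eq_bigr => n _; rewrite mulrBl.
Qed.

(** Two uniform approximations of the same function have close coefficients:
    this gives both the existence and the uniqueness of the coefficients of a
    limit. *)
Lemma bessel_diff S S' N N' p q (F : R[i] -> R[i]) (rho e e' : R) M :
  supported S N p -> supported S' N' q ->
  (forall s, rho <= Re s -> normc (dpsum p N s - F s) <= e) ->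
  (forall s, rho <= Re s -> normc (dpsum q N' s - F s) <= e') ->
  \sum_(1 <= n < M) sqmod (p n - q n) * npow n (2 * rho) <= (e + e') ^+ 2.
Proof.
move=> sp sq hp hq.
have spT : supported setT N p by move=> n /sp[].
have sqT : supported setT N' q by move=> n /sq[].
apply: (bessel_supported M (supportedB spT sqT)) => s sr.
rewrite dpsumB (dpsum_widen s spT (leq_maxl _ _)) (dpsum_widen s sqT (leq_maxr _ _)).
rewrite -sr in hp hq; have h1 := hp s (lexx _); have h2 := hq s (lexx _).
rewrite normcB in h2; apply: (le_trans (normc_tri _ _ (F s))).
exact: lerD.
Qed.

Lemma sqmodD2 z w : sqmod (z + w) <= 2 * sqmod z + 2 * sqmod w.
Proof. by have := sqmodD_le z w ltr01; rewrite invr1. Qed.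

Lemma sqmodB z w : sqmod (z - w) = sqmod (w - z).
Proof. by rewrite -!normcX2 normcB. Qed.

Lemma coef_le_of_sum (x : nat -> R[i]) n (A : R) : (0 < n)%N -> 0 <= A ->
  \sum_(1 <= i < n.+1) sqmod (x i) * npow i (2 * 1) <= A ^+ 2 ->
  normc (x n) * npow n 1 <= A.
Proof.
move=> n0 A0; rewrite big_nat_recr//= => h.
rewrite -(@ler_pXn2r _ 2)// ?nnegrE ?mulr_ge0 ?normc_ge0 ?npow_ge0//.
rewrite exprMn normcX2 npow_sqr; apply: le_trans h; rewrite lerDr.
by apply: sumr_ge0 => i _; rewrite mulr_ge0 ?sqmod_ge0 ?npow_ge0.
Qed.

(** [b] collects the limits of the coefficients of approximating Dirichlet
    polynomials. The third clause comes from Bessel's inequality and concerns the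
    same approximation as the first two. *)
Definition coefs_of S (F F' : R[i] -> R[i]) b :=
  (forall n, b n != 0 -> S n /\ (0 < n)%N) /\
  forall rho e : R, 0 < rho -> 0 < e -> exists p N, [/\ supported S N p,
    forall s, rho <= Re s -> normc (dpsum p N s - F s) <= e,
    forall s, rho <= Re s ->
      normc (dpsum (dcoef p) N s - F' s) <= e &
    forall M, \sum_(1 <= n < M) sqmod (p n - b n) * npow n (2 * rho) <= e ^+ 2].

Lemma sum_sqmod_cvg (p : nat -> nat -> R[i]) b M :
  (forall n (e : R), 0 < e -> exists K, forall k, (K <= k)%N -> normc (p k n - b n) <= e) ->
  forall e : R, 0 < e -> exists K, forall k, (K <= k)%N ->
    \sum_(1 <= n < M) sqmod (p k n - b n) <= e.
Proof.
move=> h; elim: M => [|M IH] e e0; first by exists 0%N => k _; rewrite big_geq// ltW.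
case: M IH => [|M] IH; first by exists 0%N => k _; rewrite big_geq// ltW.
have e20 : 0 < e / 2 by rewrite divr_gt0.
have [K hK] := IH _ e20.
have se : 0 < Num.sqrt (e / 2) by rewrite sqrtr_gt0.
have [L hL] := h M.+1 _ se.
exists (maxn K L) => k; rewrite geq_max => /andP[/hK h1 /hL h2].
rewrite big_nat_recr//= (splitr e) lerD// -normcX2 -(sqr_sqrtr (ltW e20)).
by rewrite lerXn2r ?nnegrE ?normc_ge0 ?sqrtr_ge0.
Qed.

(** The coefficients of approximating polynomials form Cauchy sequences. The
    weighted sum is first bounded for the difference with a later approximation,
    which is close to the limit on the indices below M. *)
Lemma dpoly_limit_coefs S F F' : dpoly_limit S F F' -> exists b, coefs_of S F F' b.
Proof.
move=> h.
have /choice[P hP] : forall k : nat, exists pN : (nat -> R[i]) * nat,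
    supported S pN.2 pN.1 /\ forall s, k.+1%:R^-1 <= Re s ->
      normc (dpsum pN.1 pN.2 s - F s) <= k.+1%:R^-1 /\
      normc (dpsum (dcoef pN.1) pN.2 s - F' s) <= k.+1%:R^-1.
  move=> k; have k0 : 0 < k.+1%:R^-1 :> R by rewrite invr_gt0.
  have [Q [Q' [[p [N [sp hp]]] hQ]]] := h _ _ k0 k0.
  exists (p, N); split => //= s sr; have [<- <-] := hp s; exact: hQ.
have inv_le (e : R) : 0 < e -> exists K : nat, forall k, (K <= k)%N -> k.+1%:R^-1 <= e.
  move=> e0; exists (Num.truncn e^-1) => k Kk; rewrite -[e]invrK lef_pV2 ?posrE ?invr_gt0//.
  by apply: (le_trans (ltW (truncnS_gt _))); rewrite ler_nat.
have Pd k k' M (rho : R) : k.+1%:R^-1 <= rho -> k'.+1%:R^-1 <= rho ->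
   \sum_(1 <= n < M) sqmod ((P k).1 n - (P k').1 n) * npow n (2 * rho) <=
   (k.+1%:R^-1 + k'.+1%:R^-1) ^+ 2.
  move=> kr k'r; have [sp hp] := hP k; have [sq hq] := hP k'.
  apply: (bessel_diff (F := F) M sp sq) => s sr.
    by have [] := hp s (le_trans kr sr).
  by have [] := hq s (le_trans k'r sr).
have Pcauchy n : exists l, (0 < n)%N -> forall e : R, 0 < e ->
    exists K, forall k, (K <= k)%N -> normc ((P k).1 n - l) <= e.
  case: n => [|n]; first by exists 0.
  have [|l hl] := @complex_cauchy_lim R (fun k => (P k).1 n.+1); last by exists l.
  move=> e e0; pose w : R := npow n.+1 1.
  have w0 : 0 < w by exact: npow_gt0.
  have [K hK] := inv_le _ (divr_gt0 (mulr_gt0 e0 w0) (ltr0Sn R 1)).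
  have [L hL] := inv_le 1 ltr01.
  exists (maxn K L) => k k'.
  rewrite !geq_max => /andP[/hK k1 /hL k2] /andP[/hK k'1 /hL k'2].
  rewrite -(ler_pM2r w0).
  apply: le_trans (_ : _ <= k.+1%:R^-1 + k'.+1%:R^-1) _; last first.
    by rewrite (splitr (e * w)) lerD.
  by apply: (@coef_le_of_sum (fun i => (P k).1 i - (P k').1 i) n.+1) => //; exact: Pd.
have /choice[b0 hb0] := Pcauchy.
pose b n := if (0 < n)%N then b0 n else 0.
have P0 k : (P k).1 0%N = 0.
  have [sp _] := hP k; apply: (supported0 sp); by case=> _ /andP[].
have hb n (e : R) : 0 < e -> exists K, forall k, (K <= k)%N -> normc ((P k).1 n - b n) <= e.
  case: n => [|n] e0; last exact: (hb0 n.+1).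
  by exists 0%N => k _; rewrite P0 (_ : b 0%N = 0)// subrr normc_zero ltW.
exists b; split.
  move=> n; apply: contra_neqP => hn; apply: normc_eq0P; rewrite leNgt; apply/negP => bn.
  have [K /(_ K (leqnn _))] := hb n _ (divr_gt0 bn (ltr0Sn R 1)).
  have [sp _] := hP K; rewrite (supported0 sp) ?sub0r ?normc_opp.
    lra.
  by move=> [? /andP[? _]]; apply: hn.
move=> rho e r0 e0; have e40 : 0 < e / 4 by rewrite divr_gt0.
have [K hK] := inv_le _ r0; have [L hL] := inv_le _ e40.
pose k := maxn K L; have kr := hK k (leq_maxl _ _); have ke := hL k (leq_maxr _ _).
have e4e : e / 4 <= e by lra.
exists (P k).1, (P k).2; have [sp hp] := hP k; split => // [s sr|s sr|M].
- by have [h1 _] := hp s (le_trans kr sr); exact: le_trans h1 (le_trans ke e4e).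
- by have [_ h1] := hp s (le_trans kr sr); exact: le_trans h1 (le_trans ke e4e).
have e2 : 0 < e ^+ 2 / 4 by rewrite divr_gt0// exprn_gt0.
have [I hI] := @sum_sqmod_cvg (fun k => (P k).1) b M hb _ e2.
pose k' := maxn k I.
have k're : k'.+1%:R^-1 <= rho.
  by apply: hK; rewrite /k' /k !leq_max leqnn.
have k'e : k'.+1%:R^-1 <= e / 4.
  by apply: hL; rewrite /k' /k !leq_max leqnn orbT.
have h1 := Pd k k' M rho kr k're.
have h2 := hI k' (leq_maxr _ _).
apply: (@le_trans _ _ (\sum_(1 <= n < M) (2 * (sqmod ((P k).1 n - (P k').1 n) * npow n (2 * rho)) +
   2 * sqmod ((P k').1 n - b n)))).
  apply: ler_sum => n _.
  have -> : (P k).1 n - b n = ((P k).1 n - (P k').1 n) + ((P k').1 n - b n).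
    by rewrite addrA subrK.
  apply: (le_trans (ler_wpM2r (npow_ge0 _ _) (sqmodD2 _ _))).
  rewrite mulrDl -!mulrA lerD2l ler_wpM2l// ler_piMr ?sqmod_ge0//.
  by rewrite npow_le1// mulr_ge0// ltW.
rewrite big_split/= -!mulr_sumr.
have h3 : (k.+1%:R^-1 + k'.+1%:R^-1) ^+ 2 <= (e / 2) ^+ 2.
  rewrite lerXn2r ?nnegrE ?addr_ge0 ?invr_ge0 ?divr_ge0 ?(ltW e0)//.
  have -> : e / 2 = e / 4 + e / 4 by field.
  by rewrite lerD.
have h4 : (e / 2) ^+ 2 = e ^+ 2 / 4 by field.
rewrite h4 in h3.
have := le_trans h1 h3; lra.
Qed.

(** Only the real parts at least 1 are involved. There the elements of H^2 and
    the compositions with the symbol are both uniform limits of Dirichlet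
    polynomials, so that their coefficients can be compared. *)
Definition has_coef (F : R[i] -> R[i]) n (x : R[i]) := forall e : R, 0 < e ->
  exists p N, [/\ supported setT N p,
    forall s, 1 <= Re s -> normc (dpsum p N s - F s) <= e &
    normc (p n - x) <= e].

Lemma has_coef_uniq F G n (x y : R[i]) : (0 < n)%N ->
  (forall s, 1 <= Re s -> F s = G s) ->
  has_coef F n x -> has_coef G n y -> x = y.
Proof.
case: n => // n _ FG hx hy; apply/eqP; rewrite -subr_eq0; apply/eqP/normc_eq0P.
rewrite leNgt; apply/negP; set d := normc _ => d0.
pose w : R := npow n.+1 1; have w0 : 0 < w by exact: npow_gt0.
have w1 : w <= 1 by apply: npow_le1.
pose e := d * w / 8; have e0 : 0 < e by rewrite divr_gt0// mulr_gt0.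
have ed : e <= d / 8 by rewrite /e ler_pM2r ?invr_gt0// ler_piMr// ltW.
have [p [N [sp hp pe]]] := hx _ e0; have [q [M [sq hq qe]]] := hy _ e0.
have hq' s : 1 <= Re s -> normc (dpsum q M s - F s) <= e.
  by move=> s1; rewrite FG//; exact: hq.
have h := coef_le_of_sum (ltn0Sn n) (addr_ge0 (ltW e0) (ltW e0))
  (bessel_diff n.+2 sp sq hp hq').
have : normc (p n.+1 - q n.+1) <= d / 4.
  rewrite -(ler_pM2r w0); apply: (le_trans h); rewrite /e; lra.
have := normc_tri x y (p n.+1); have := normc_tri (p n.+1) y (q n.+1).
rewrite -/d (normcB x); lra.
Qed.

Lemma coefs_of_has_coef S F F' b n : (0 < n)%N -> coefs_of S F F' b -> has_coef F n (b n).
Proof.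
case: n => // n _ [_ h] e e0; pose w : R := npow n.+1 1.
have w0 : 0 < w by exact: npow_gt0.
have w1 : w <= 1 by apply: npow_le1.
have [p [N [sp h1 _ h2]]] := h 1 _ ltr01 (mulr_gt0 e0 w0).
have ew : e * w <= e by rewrite ler_piMr// ltW.
exists p, N; split => [m /sp[]//|s s1|]; first exact: (le_trans (h1 _ s1)).
rewrite -(ler_pM2r w0).
exact: (@coef_le_of_sum (fun i => p i - b i) n.+1 _ isT (ltW (mulr_gt0 e0 w0)) (h2 n.+2)).
Qed.

(** Cauchy-Schwarz, in additive form with a free parameter [t]. The decay
    available at [s] is shared between the coefficients and the sum over [S]. *)
Lemma dpsum_eval_le S (d : nat -> R[i]) X s (rho rho' t : R) :
  (forall n, (0 < n)%N -> d n != 0 -> S n) -> 0 < t -> rho + rho' <= Re s ->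
  normc (dpsum d X s) <=
    t * \sum_(1 <= n < X.+1) sqmod (d n) * npow n (2 * rho) +
    t^-1 * \sum_(1 <= n < X.+1 | `[< S n >]) npow n (2 * rho').
Proof.
move=> dS t0 rs; apply: (le_trans (normc_sum _ _ _)).
rewrite [X in _ * X + _]big_mkcond [X in _ + _ * X]big_mkcond/= !mulr_sumr -big_split/=.
rewrite !big_nat; apply: ler_sum => n /andP[n0 _].
have tn0 : 0 <= t by exact: ltW.
have ti0 : 0 <= t^-1 by rewrite invr_ge0.
have a0 : 0 <= t * (sqmod (d n) * npow n (2 * rho)).
  by rewrite !mulr_ge0 ?sqmod_ge0 ?npow_ge0.
have [d0|d0] := eqVneq (d n) 0.
  rewrite d0 mul0r normc_zero addr_ge0// -?d0//.
  by case: ifP => _; rewrite ?mulr0// mulr_ge0 ?npow_ge0.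
have -> : `[< S n >] by apply/asboolP/dS.
rewrite normcM normc_natpowN.
apply: (@le_trans _ _ (normc (d n) * npow n (rho + rho'))).
  by rewrite ler_wpM2l ?normc_ge0// npow_le.
rewrite npowD [leLHS]mulrA; set u := normc (d n) * npow n rho; set v := npow n rho'.
have -> : sqmod (d n) * npow n (2 * rho) = u ^+ 2.
  by rewrite exprMn normcX2 npow_sqr.
have -> : npow n (2 * rho') = v ^+ 2 by rewrite npow_sqr.
have u0 : 0 <= u by rewrite mulr_ge0 ?normc_ge0 ?npow_ge0.
have v0 : 0 <= v by exact: npow_ge0.
have h := sqr_ge0 (t * u - v).
have uv0 : 0 <= u * v by rewrite mulr_ge0.
rewrite -(ler_pM2l t0).
have -> : t * (t * u ^+ 2 + t^-1 * v ^+ 2) = t ^+ 2 * u ^+ 2 + v ^+ 2.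
  by field; rewrite gt_eqF.
have h2 : (t * u - v) ^+ 2 = t ^+ 2 * u ^+ 2 + v ^+ 2 - 2 * (t * (u * v)) by ring.
rewrite h2 in h; have tuv : 0 <= t * (u * v) by rewrite mulr_ge0.
lra.
Qed.

(** The series converges at s as soon as part of its decay makes the sum over
    S converge. For the set of all integers this forces Re s > 1/2; for smooth
    integers it holds in the whole right half-plane. *)
Lemma coefs_of_eval S F F' b s (rho rho' Zb : R) : coefs_of S F F' b ->
  0 < rho -> rho + rho' <= Re s -> 0 <= rho' ->
  (forall X, \sum_(1 <= n < X | `[< S n >]) npow n (2 * rho') <= Zb) ->
  forall e : R, 0 < e -> exists X0, forall X, (X0 <= X)%N ->
    normc (dpsum b X s - F s) <= e.
Proof.
move=> [bS h] r0 rs r'0 hZ e e0.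
have Z0 : 0 <= Zb by apply: le_trans (hZ 0%N); rewrite big_geq.
pose e1 := e / (2 + Zb); have e10 : 0 < e1 by rewrite divr_gt0// ltr_pwDl.
have [p [N [sp h1 _ h2]]] := h _ _ r0 e10.
have rs' : rho <= Re s by lra.
exists N => X NX; have hp := h1 s rs'; rewrite -(dpsum_widen s sp NX) in hp.
apply: (le_trans (normc_tri _ _ (dpsum p X s))).
rewrite -dpsumB.
have dS n : (0 < n)%N -> b n - p n != 0 -> S n.
  move=> n0; have [p0|p0 _] := eqVneq (p n) 0; last by have [] := sp _ p0.
  by rewrite p0 subr0 => /bS[].
have ie : 0 < e1^-1 by rewrite invr_gt0.
have := dpsum_eval_le X dS ie rs; rewrite invrK.
have h3 := h2 X.+1.
have h4 : e1^-1 * \sum_(1 <= n < X.+1) sqmod (b n - p n) * npow n (2 * rho) <= e1.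
  rewrite mulrC ler_pdivrMr// -expr2.
  by under eq_bigr do rewrite sqmodB.
have h5 : e1 * \sum_(1 <= n < X.+1 | `[< S n >]) npow n (2 * rho') <= e1 * Zb.
  by rewrite ler_wpM2l ?(ltW e10)//; exact: hZ.
have h6 : e1 * (2 + Zb) = e by rewrite /e1 divfK// gt_eqF// ltr_pwDl.
lra.
Qed.

End Coefficients.

(** * Sums over smooth numbers *)

Section SmoothNumbers.
Variable R : realType.

Definition smooth l : set nat :=
  [set n | (0 < n)%N /\ forall p, prime p -> (p %| n)%N -> (p <= l)%N].

Lemma smooth_max_pdiv l n : (0 < l)%N -> (0 < n)%N -> (max_pdiv n <= l)%N -> smooth l n.
Proof.
move=> l0 n0 nl; split => // p pp pn; apply: leq_trans nl.
by apply: max_pdiv_max; rewrite mem_primes pp n0 pn.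
Qed.

Lemma smoothM l n m : smooth l n -> smooth l m -> smooth l (n * m)%N.
Proof.
move=> [n0 hn] [m0 hm]; split; first by rewrite muln_gt0 n0.
by move=> p pp; rewrite Euclid_dvdM// => /orP[]; [exact: hn|exact: hm].
Qed.

Lemma smooth1 l : smooth l 1.
Proof. by split => // p pp; rewrite dvdn1 => /eqP p1; rewrite p1 in pp. Qed.

Lemma smooth_expn l n k : smooth l n -> smooth l (n ^ k)%N.
Proof.
move=> nl; elim: k => [|k IH]; first exact: smooth1.
by rewrite expnS; exact: smoothM.
Qed.

(** Each exponent of the factorization of n is divided by [K] with remainder:
    the remainders leave finitely many possibilities for [v]. *)
Lemma smooth_decomp l K n : (0 < K)%N -> smooth l n -> exists u v,
  [/\ smooth l u, (0 < v <= l`! ^ K)%N, n = (u ^ K * v)%N & (u <= n)%N].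
Proof.
move=> K0 [n0 hn].
pose u := (\prod_(p <- primes n) p ^ (logn p n %/ K))%N.
pose v := (\prod_(p <- primes n) p ^ (logn p n %% K))%N.
have pr p : p \in primes n -> [/\ prime p, (0 < p)%N & (p <= l)%N].
  by rewrite mem_primes => /and3P[pp _ pn]; rewrite pp prime_gt0// hn.
have nE : n = (u ^ K * v)%N.
  rewrite {1}(prod_prime_decomp n0) prime_decompE big_map/=.
  rewrite (big_morph (expn^~ K) (id1 := 1%N) (op1 := muln)); last 2 first.
  - by move=> a b; rewrite expnMn.
  - by rewrite exp1n.
  rewrite -big_split/=; apply: eq_bigr => p _.
  by rewrite -expnM -expnD -divn_eq.
have u0 : (0 < u)%N by move: n0; rewrite nE muln_gt0 expn_gt0 => /andP[/orP[//|/eqP K00]]; rewrite K00 in K0.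
have v0 : (0 < v)%N by move: n0; rewrite nE muln_gt0 => /andP[].
have uK : (u <= u ^ K)%N by rewrite -{1}[u]expn1 leq_pexp2l.
have un : (u <= n)%N by rewrite nE (leq_trans uK)// leq_pmulr.
exists u, v; split => //.
  split => // p pp pu; apply: hn => //.
  rewrite nE dvdn_mulr//; apply: dvdn_trans pu _.
  by rewrite -{1}[u]expn1 dvdn_exp2l.
rewrite v0/=; apply: (@leq_trans ((\prod_(p <- primes n) p) ^ K)%N).
  rewrite (big_morph (expn^~ K) (id1 := 1%N) (op1 := muln)); last 2 first.
  - by move=> a b; rewrite expnMn.
  - by rewrite exp1n.
  rewrite /v big_seq [X in (_ <= X)%N]big_seq.
  apply: leq_prod => p /pr[_ p0 _].
  by rewrite leq_pexp2l// ltnW// ltn_pmod.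
rewrite leq_exp2r// fact_prod.
have -> : (\prod_(p <- primes n) p = \prod_(1 <= i < l.+1 | i \in primes n) i)%N.
  rewrite -[RHS]big_filter; apply: perm_big; apply: uniq_perm.
  - exact: primes_uniq.
  - by rewrite filter_uniq// iota_uniq.
  - move=> p; rewrite mem_filter mem_index_iota ltnS.
    by case: (boolP (p \in primes n)) => //= /pr[_ -> ->].
rewrite big_mkcond big_nat [X in (_ <= X)%N]big_nat.
by apply: leq_prod => i /andP[i0 _]; case: ifP.
Qed.

Local Notation npow := (@npow R).

(** With n = u^K v as above, n^(-x) is at most u^(-K x), and each u occurs for
    boundedly many n. Multiplying the exponent by K thus costs a factor
    independent of x. This gives convergence for every positive exponent, and
    it makes the norms of the reproducing kernels comparable at points with
    comparable real parts. *)
Lemma smooth_sum_le l K X (x : R) : (0 < K)%N -> 0 <= x ->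
  \sum_(1 <= n < X | `[< smooth l n >]) npow n x <=
  (l`! ^ K)%:R * \sum_(1 <= u < X | `[< smooth l u >]) npow u (K%:R * x).
Proof.
move=> K0 x0; set V := (l`! ^ K)%N.
pose T u : R := \sum_(1 <= v < V.+1) npow u (K%:R * x).
have -> : V%:R * \sum_(1 <= u < X | `[< smooth l u >]) npow u (K%:R * x) =
   \sum_(1 <= u < X | `[< smooth l u >]) T u.
  rewrite mulr_sumr; apply: eq_bigr => u _.
  by rewrite /T sumr_const_nat subn1 mulr_natl.
apply: (@le_trans _ _ (\sum_(1 <= n < X | `[< smooth l n >])
  \sum_(1 <= u < X | `[< smooth l u >]) \sum_(1 <= v < V.+1)
    if n == (u ^ K * v)%N then npow u (K%:R * x) else 0)).
  rewrite big_nat_cond [leRHS]big_nat_cond.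
  apply: ler_sum => n /andP[/andP[n0 nX] /asboolP/(smooth_decomp K0)].
  move=> [u [v [su /andP[v0 vV] nE un]]].
  have u0 : (0 < u)%N by case: su.
  rewrite (big_rem u) /=; last first.
    by rewrite mem_index_iota u0 (leq_ltn_trans un).
  have -> : `[< smooth l u >] by apply/asboolP.
  rewrite (big_rem v) /=; last by rewrite mem_index_iota v0 ltnS.
  rewrite -nE eqxx -addrA ler_wpDr//.
    rewrite addr_ge0//; first by apply: sumr_ge0 => i _; case: ifP => // _; exact: npow_ge0.
    by apply: sumr_ge0 => i _; apply: sumr_ge0 => j _; case: ifP => // _; exact: npow_ge0.
  rewrite nE npowM// ?expn_gt0 ?u0// npow_expn//.
  by rewrite ler_piMr ?npow_ge0// npow_le1.
rewrite exchange_big/=; apply: ler_sum => u _.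
rewrite exchange_big/=; apply: ler_sum => v _.
rewrite big_mkcond -big_mkcond /=.
apply: (@le_trans _ _ (\sum_(1 <= n < X | n == (u ^ K * v)%N) npow u (K%:R * x))).
  rewrite [leRHS]big_mkcond [leLHS]big_mkcond/=; apply: ler_sum => n _.
  by case: `[< _ >] => //; case: ifP => // _; exact: npow_ge0.
rewrite big_const_seq.
case: (count _ _) (count_uniq_mem (u ^ K * v)%N (iota_uniq 1 (X - 1))) => [|[|k]]//=.
- by move=> _; exact: npow_ge0.
- by move=> _; rewrite addr0.
- by move=> /eqP; case: (_ \in _).
Qed.

(** Comparing the terms of indices 2v and 2v + 1 with that of index v gives
    S_{2X} <= 1 + 2^(1-x) S_X. *)
Lemma zeta_sum_le (x : R) X : 1 < x ->
  \sum_(1 <= n < X) npow n x <= (1 - 2 * npow 2 x)^-1.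
Proof.
move=> x1; have q1 : 2 * npow 2 x < 1.
  have -> : (2 : R) = expR (ln 2%:R) by rewrite lnK// posrE.
  rewrite /npow -expRD expR_lt1.
  have l2 : 0 < ln 2%:R :> R by rewrite ln_gt0// ltr1n.
  have : 1 * ln 2%:R < x * ln 2%:R :> R by rewrite ltr_pM2r.
  lra.
pose S Y : R := \sum_(1 <= n < Y) npow n x.
have SS k : (0 < k)%N -> S k.+1 = S k + npow k x by move=> k0; rewrite /S big_nat_recr.
have dbl Y : S (Y.+1.*2) <= 1 + 2 * npow 2 x * S Y.+1.
  elim: Y => [|Y IH].
    by rewrite /S big_nat1 big_geq// mulr0 addr0 npow_le1// ltW// (lt_trans ltr01).
  rewrite doubleS (SS (Y.+1).*2.+1)// (SS (Y.+1).*2)// (SS Y.+1)// mulrDr.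
  have h1 : npow (Y.+1).*2 x = npow 2 x * npow Y.+1 x by rewrite -mul2n npowM.
  have h2 : npow (Y.+1).*2.+1 x <= npow (Y.+1).*2 x.
    by rewrite npow_anti// ltW// (lt_trans ltr01).
  rewrite h1 in h2; rewrite h1.
  have -> : 2 * npow 2 x * npow Y.+1 x = npow 2 x * npow Y.+1 x + npow 2 x * npow Y.+1 x.
    by ring.
  by rewrite !addrA; apply: lerD => //; rewrite lerD2r.
rewrite -[leRHS]mul1r ler_pdivlMr ?subr_gt0// -/(S X).
have SX : S X <= S X.+1 by rewrite ler_sum_nat_widen// => n; exact: npow_ge0.
have SX2 : S X.+1 <= S (X.+1).*2.
  by rewrite ler_sum_nat_widen// => [n|]; [exact: npow_ge0|rewrite -addnn leq_addr].
have h := dbl X.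
have h0 : S X.+1 * (1 - 2 * npow 2 x) <= 1.
  have -> : S X.+1 * (1 - 2 * npow 2 x) = S X.+1 - 2 * npow 2 x * S X.+1 by ring.
  lra.
by apply: le_trans h0; rewrite ler_wpM2r// subr_ge0 ltW.
Qed.

Lemma zeta_setT_le (x : R) X : 1 < x ->
  \sum_(1 <= n < X | `[< [set: nat] n >]) npow n x <= (1 - 2 * npow 2 x)^-1.
Proof.
move=> x1; apply: le_trans (zeta_sum_le X x1); apply: le_of_eq.
by apply: eq_bigl => n; apply/asboolP.
Qed.

Lemma smooth_sum_bounded l (x : R) : 0 < x -> exists2 Z : R, 0 <= Z &
  forall X, \sum_(1 <= n < X | `[< smooth l n >]) npow n x <= Z.
Proof.
move=> x0; pose K := (Num.truncn (2 / x)).+1.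
have Kx : 2 <= K%:R * x by rewrite -ler_pdivrMr// ltW// truncnS_gt.
have K1 : 1 < K%:R * x by apply: lt_le_trans Kx; rewrite ltr1n.
exists ((l`! ^ K)%:R * (1 - 2 * npow 2 (K%:R * x))^-1).
  by rewrite mulr_ge0//; apply: le_trans (zeta_sum_le 0 K1); rewrite big_geq.
move=> X; apply: (le_trans (smooth_sum_le l X (ltn0Sn (Num.truncn (2 / x))) (ltW x0))).
rewrite ler_wpM2l//; apply: le_trans (zeta_sum_le X K1).
rewrite big_mkcond; apply: ler_sum => n _; case: ifP => // _; exact: npow_ge0.
Qed.

Lemma ln_npow_le n (a : R) : 0 < a -> (1 + ln n%:R) * npow n a <= 1 + a^-1.
Proof.
move=> a0; rewrite mulrDl mul1r; apply: lerD; first by rewrite npow_le1// ltW.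
rewrite -[leRHS]mul1r ler_pdivlMr// /npow expRN mulrAC ler_pdivrMr ?expR_gt0// mul1r.
by rewrite mulrC; have := expR_ge1Dx (a * ln n%:R); lra.
Qed.

End SmoothNumbers.

(** * Absolutely convergent Dirichlet series *)

Section AbsolutelyConvergent.
Variable R : realType.
Implicit Types (s z w : R[i]) (d : nat -> R[i]).

(** The square of the logarithm is what a Taylor estimate of order two needs. *)
Definition abs_conv (c : nat -> R[i]) := forall rho : R, 0 < rho -> exists2 A : R, 0 <= A &
  forall N, \sum_(1 <= n < N) normc (c n) * (1 + ln n%:R) ^+ 2 * npow n rho <= A.

Definition dseries_cvg (d : nat -> R[i]) (G : R[i] -> R[i]) := forall rho e : R, 0 < rho -> 0 < e ->
  exists K, forall N, (K <= N)%N -> forall s, rho <= Re s ->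
    normc (dpsum d N s - G s) <= e.

Lemma symbol_dseries_cvg (c0 : nat) Phi phi c : c0_symbol c0 Phi phi c -> dseries_cvg c phi.
Proof.
move=> h rho e r0 e0; have := symbol_uniform h (divr_gt0 r0 (ltr0Sn R 1)).
move=> H; have e0C : (0 : R[i]) < (e%:C)%C by rewrite ltcR.
have := H [set h : {uniform` halfplane (rho / 2) -> R[i]^o} |
   forall y, halfplane (rho / 2) y -> ball (phi y : R[i]^o) (e%:C)%C (h y)].
case=> [|K _ hK].
  apply/uniform_nbhs; exists [set xy | ball (xy.1 : R[i]^o) (e%:C)%C xy.2]; split => //.
  exact: entourage_ball (PosNum e0C).
exists K => N KN s sr; have /= := hK N KN s.
have sh : halfplane (rho / 2) s by rewrite /halfplane/=; lra.
by move=> /(_ sh); rewrite -ball_normE/= normrE_normc ltcR normcB => /ltW.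
Qed.

(** Convergence at rho / 4 only bounds the terms there. Absolute convergence
    comes from the sum of n^(-rho/4) over smooth integers being finite, and
    the remaining factor n^(-rho/2) absorbs the square of the logarithm. *)
Lemma symbol_abs_conv (c0 : nat) Phi phi c l : c0_symbol c0 Phi phi c ->
  (forall n, (0 < n)%N -> c n != 0 -> smooth l n) -> abs_conv c.
Proof.
move=> hP cS rho r0.
have r40 : 0 < rho / 4 by rewrite divr_gt0.
have [K hK] := symbol_dseries_cvg hP r40 ltr01.
have [Z Z0 hZ] := smooth_sum_bounded l r40.
pose s0 : R[i] := ((rho / 4)%:C)%C.
have Re0 : Re s0 = rho / 4 by [].
have tail n : (K < n)%N -> normc (c n) * npow n (rho / 4) <= 2.
  case: n => // n Kn; rewrite -Re0 -normc_natpowN -normcM.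
  have -> : c n.+1 * natpowN n.+1 s0 = dpsum c n.+1 s0 - dpsum c n s0.
    by rewrite /dpsum [X in X - _]big_nat_recr//= addrAC subrr add0r.
  apply: (le_trans (normc_tri _ _ (phi s0))).
  have h1 := hK n.+1 (leqW Kn) s0; have h2 := hK n Kn s0.
  rewrite Re0 in h1 h2; have := h1 (lexx _); have := h2 (lexx _).
  by rewrite (normcB (phi s0)); lra.
pose Cb : R := 2 + \sum_(1 <= n < K.+1) normc (c n) * npow n (rho / 4).
have Cbn n : (0 < n)%N -> normc (c n) * npow n (rho / 4) <= Cb.
  move=> n0; have [nK|Kn] := leqP n K.
    rewrite /Cb (big_rem n) ?mem_index_iota ?n0//=.
    rewrite addrCA lerDl addr_ge0// sumr_ge0// => i _.
    by rewrite mulr_ge0 ?normc_ge0 ?npow_ge0.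
  apply: (le_trans (tail _ Kn)); rewrite lerDl sumr_ge0// => i _.
  by rewrite mulr_ge0 ?normc_ge0 ?npow_ge0.
have Cb0 : 0 <= Cb.
  by apply: le_trans (Cbn 1%N isT); rewrite mulr_ge0 ?normc_ge0 ?npow_ge0.
pose L : R := (1 + (rho / 4)^-1) ^+ 2.
have L0 : 0 <= L by exact: sqr_ge0.
exists (Cb * L * Z); first exact: mulr_ge0 (mulr_ge0 Cb0 L0) Z0.
move=> N; apply: (@le_trans _ _ (\sum_(1 <= n < N | `[< smooth l n >])
   Cb * L * npow n (rho / 4))); last first.
  by rewrite -mulr_sumr; apply: ler_wpM2l => //; exact: mulr_ge0.
rewrite big_nat [leRHS]big_nat_cond big_mkcond [leRHS]big_mkcond/=.
rewrite big_mkcond [leRHS]big_mkcond/=.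
apply: ler_sum => n _; case: ifP => // /andP[n0 nN].
have [cn0|cn0] := eqVneq (c n) 0.
  rewrite cn0 normc_zero !mul0r; case: ifP => // _.
  exact: mulr_ge0 (mulr_ge0 Cb0 L0) (npow_ge0 _ _).
have -> : `[< smooth l n >] by apply/asboolP/cS.
have -> : npow n rho = npow n (rho / 4) * (npow n (rho / 4) * npow n (rho / 4)) *
    npow n (rho / 4) by rewrite -!npowD; congr npow; field.
set a := npow n (rho / 4) in Cbn *.
have a0 : 0 <= a by exact: npow_ge0.
have -> : normc (c n) * (1 + ln n%:R) ^+ 2 * (a * (a * a) * a) =
  (normc (c n) * a) * ((1 + ln n%:R) * a) ^+ 2 * a by ring.
have l1 : 0 <= (1 + ln n%:R) * a by rewrite mulr_ge0 ?addr_ge0 ?lnn_ge0.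
apply: ler_wpM2r => //.
apply: ler_pM; rewrite ?sqr_ge0 ?mulr_ge0 ?normc_ge0 ?Cbn//.
rewrite lerXn2r ?nnegrE//; last exact: ln_npow_le.
by rewrite addr_ge0// invr_ge0 ltW.
Qed.

Lemma normc_dpsum_sub_le d N M s (rho : R) : (N <= M)%N -> rho <= Re s ->
  normc (dpsum d M s - dpsum d N s) <=
  \sum_(1 <= n < M.+1) normc (d n) * npow n rho - \sum_(1 <= n < N.+1) normc (d n) * npow n rho.
Proof.
move=> NM sr; rewrite /dpsum.
have MN1 : (N.+1 <= M.+1)%N by [].
rewrite (@big_cat_nat _ _ _ N.+1 1 M.+1)//= addrAC subrr add0r.
rewrite (@big_cat_nat _ _ _ N.+1 1 M.+1)//= addrAC subrr add0r.
apply: (le_trans (normc_sum _ _ _)); apply: ler_sum => n _.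
by rewrite normcM normc_natpowN ler_wpM2l ?normc_ge0// npow_le.
Qed.

Lemma bounded_sum_cauchy (f : nat -> R) (A : R) : (forall n, 0 <= f n) ->
  (forall N, \sum_(1 <= n < N) f n <= A) ->
  forall e, 0 < e -> exists K, forall N M, (K <= N)%N -> (K <= M)%N ->
    `|\sum_(1 <= n < N.+1) f n - \sum_(1 <= n < M.+1) f n| <= e.
Proof.
move=> f0 fA e e0; pose u N := \sum_(1 <= n < N.+1) f n.
have und : nondecreasing_seq u.
  by move=> n m nm; rewrite /u ler_sum_nat_widen.
have /cvg_ex[l ul] : cvgn u.
  by apply: nondecreasing_is_cvgn => //; exists A => _ [N _ <-]; exact: fA.
move/cvgrPdist_le : ul => /(_ _ (divr_gt0 e0 (ltr0Sn R 1)))[K _ hK].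
exists K => N M KN KM; have h1 := hK N KN; have h2 := hK M KM.
rewrite -/(u N) -/(u M); have := ler_distD l (u N) (u M).
by rewrite (distrC (u N) l); move: h1 h2 => /=; lra.
Qed.

Lemma dseries_exists d : (forall rho : R, 0 < rho -> exists A,
    forall N, \sum_(1 <= n < N) normc (d n) * npow n rho <= A) ->
  exists G, dseries_cvg d G.
Proof.
move=> h.
have C (rho e : R) : 0 < rho -> 0 < e -> exists K, forall N M, (K <= N)%N ->
    (K <= M)%N -> forall s, rho <= Re s ->
    normc (dpsum d N s - dpsum d M s) <= e.
  move=> r0 e0; have [A hA] := h _ r0.
  have f0 n : 0 <= normc (d n) * npow n rho by rewrite mulr_ge0 ?normc_ge0 ?npow_ge0.
  have [K hK] := bounded_sum_cauchy f0 hA e0; exists K => N M KN KM s sr.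
  have [NM|/ltnW NM] := leqP N M.
    rewrite normcB; apply: (le_trans (normc_dpsum_sub_le d NM sr)).
    exact: le_trans (ler_norm _) (hK _ _ KM KN).
  apply: (le_trans (normc_dpsum_sub_le d NM sr)).
  exact: le_trans (ler_norm _) (hK _ _ KN KM).
have /choice[G hG] : forall s, exists l : R[i], 0 < Re s -> forall e : R, 0 < e ->
    exists K, forall k, (K <= k)%N -> normc (dpsum d k s - l) <= e.
  move=> s; have [s0|s0] := ltP 0 (Re s); last by exists 0.
  have [|l hl] := @complex_cauchy_lim R (fun k => dpsum d k s).
    move=> e e0; have [K hK] := C _ _ s0 e0.
    by exists K => k k' Kk Kk'; exact: hK.
  by exists l => _.
exists G => rho e r0 e0; have e20 : 0 < e / 2 by rewrite divr_gt0.
have [K hK] := C _ _ r0 e20; exists K => N KN s sr.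
have [L hL] := hG s (lt_le_trans r0 sr) _ e20.
have h1 := hK N (maxn K L) KN (leq_maxl _ _) s sr.
have h2 := hL (maxn K L) (leq_maxr _ _).
apply: (le_trans (normc_tri _ _ (dpsum d (maxn K L) s))).
by rewrite (splitr e) lerD.
Qed.

Lemma normc_dcoef d n : normc (dcoef d n) = ln n%:R * normc (d n).
Proof. by rewrite /dcoef normc_opp normcM normc_real ger0_norm// lnn_ge0. Qed.

Lemma abs_conv_derivative c : abs_conv c -> exists G, dseries_cvg (dcoef c) G.
Proof.
move=> h; apply: dseries_exists => rho r0; have [A _ hA] := h _ r0; exists A => N.
apply: le_trans (hA N); apply: ler_sum => n _.
rewrite normc_dcoef ler_wpM2r ?npow_ge0// mulrC ler_wpM2l ?normc_ge0//.
have t0 := lnn_ge0 R n; set t := (ln n%:R : R) in t0 *.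
have -> : (1 + t) ^+ 2 = 1 + 2 * t + t ^+ 2 by ring.
by have := sqr_ge0 t; lra.
Qed.

Lemma dseries_dpoly_limit S (c : nat -> R[i]) (phi phi' : R[i] -> R[i]) :
  (forall n, (0 < n)%N -> c n != 0 -> S n) ->
  dseries_cvg c phi -> dseries_cvg (dcoef c) phi' -> dpoly_limit S phi phi'.
Proof.
move=> cS h h' rho e r0 e0; have [K hK] := h _ _ r0 e0; have [L hL] := h' _ _ r0 e0.
pose N := maxn K L; pose p n := if (0 < n <= N)%N then c n else 0.
exists (dpsum p N), (dpsum (dcoef p) N); split.
  exists p, N; split => // n; rewrite /p; case: ifP; last by rewrite eqxx.
  by move=> /andP[n0 nN] cn; split => //; exact: cS.
move=> s sr.
have -> : dpsum p N s = dpsum c N s.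
  by rewrite /dpsum !big_nat; apply: eq_bigr => n nN; rewrite /p nN.
have -> : dpsum (dcoef p) N s = dpsum (dcoef c) N s.
  by rewrite /dpsum !big_nat; apply: eq_bigr => n nN; rewrite /dcoef /p nN.
by split; [apply: hK|apply: hL] => //; rewrite ?leq_maxl ?leq_maxr.
Qed.

Lemma le_of_slack (x y k : R) : 0 <= k -> (forall e, 0 < e -> x <= y + e * k) -> x <= y.
Proof.
move=> k0 h; rewrite leNgt; apply/negP => yx.
have d0 : 0 < x - y by rewrite subr_gt0.
have k1 : 0 < k + 1 by rewrite ltr_wpDl.
have := h ((x - y) / (2 * (k + 1))) (divr_gt0 d0 (mulr_gt0 (ltr0Sn R 1) k1)).
have : (x - y) / (2 * (k + 1)) * k <= (x - y) / 2.
  rewrite mulrAC ler_pdivrMr ?mulr_gt0//.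
  have -> : (x - y) / 2 * (2 * (k + 1)) = (x - y) * (k + 1) by field.
  by rewrite ler_wpM2l ?(ltW d0)// lerDl.
lra.
Qed.

(** First-order Taylor estimate with the derivative taken at a third point; it
    serves both to invert [phi] near a point and to control its variation. *)
Definition taylor_on (rho B : R) (phi phi' : R[i] -> R[i]) := forall s s' s0,
  rho <= Re s -> rho <= Re s' -> rho <= Re s0 ->
  normc (phi s - phi s' - phi' s0 * (s - s')) <=
    B * normc (s - s') * (normc (s - s0) + normc (s' - s0)).

Lemma dpsum_taylor (c : nat -> R[i]) N (rho A : R) : 0 <= rho ->
  (\sum_(1 <= n < N.+1) normc (c n) * (1 + ln n%:R) ^+ 2 * npow n rho <= A) ->
  taylor_on rho (7 * A) (dpsum c N) (dpsum (dcoef c) N).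
Proof.
move=> r0 hA s s' s0 sr s'r s0r.
have -> : dpsum c N s - dpsum c N s' -
   dpsum (dcoef c) N s0 * (s - s') =
   \sum_(1 <= n < N.+1) c n * (natpowN n s - natpowN n s' -
      natpowN n s0 * (- (s * (ln n%:R)%:C%C) - - (s' * (ln n%:R)%:C%C))).
  rewrite /dpsum -sumrB mulr_suml -sumrB; apply: eq_bigr => n _.
  by rewrite /dcoef; ring.
apply: (le_trans (normc_sum _ _ _)).
rewrite -[leRHS]mulrA; set D := normc (s - s') * (normc (s - s0) + normc (s' - s0)).
have D0 : 0 <= D by rewrite mulr_ge0 ?addr_ge0 ?normc_ge0.
apply: (@le_trans _ _ (\sum_(1 <= n < N.+1)
  7 * (normc (c n) * (1 + ln n%:R) ^+ 2 * npow n rho) * D)); last first.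
  by rewrite -mulr_suml -mulr_sumr ler_wpM2r// ler_wpM2l.
apply: ler_sum => n _; rewrite normcM.
have t0 := lnn_ge0 R n; set t := (ln n%:R : R) in t0 *.
have Re_le u : rho <= Re u -> Re (- (u * (t%:C)%C)) <= - (rho * t).
  by move=> ur; rewrite cReN cReMr lerN2 ler_wpM2r.
have dif u v : normc (- (u * (t%:C)%C) - - (v * (t%:C)%C)) = normc (u - v) * t.
  have -> : - (u * (t%:C)%C) - - (v * (t%:C)%C) = - ((u - v) * (t%:C)%C) by ring.
  by rewrite normc_opp normcM normc_real ger0_norm.
have := cexp_taylor (Re_le _ sr) (Re_le _ s'r) (Re_le _ s0r).
rewrite !dif => h.
apply: (le_trans (ler_wpM2l (normc_ge0 _) h)).
have -> : normc (c n) * (7 * expR (- (rho * t)) * (normc (s - s') * t) *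
  (normc (s - s0) * t + normc (s' - s0) * t)) =
  7 * (normc (c n) * t ^+ 2 * npow n rho) * D by rewrite /D /npow -/t; ring.
rewrite ler_wpM2r// ler_wpM2l// ler_wpM2r ?npow_ge0// ler_wpM2l ?normc_ge0//.
by rewrite lerXn2r ?nnegrE ?addr_ge0// lerDr.
Qed.

Lemma dseries_taylor (c : nat -> R[i]) (phi phi' : R[i] -> R[i]) (rho : R) : abs_conv c ->
  dseries_cvg c phi -> dseries_cvg (dcoef c) phi' -> 0 < rho ->
  exists2 B, 0 <= B & taylor_on rho B phi phi'.
Proof.
move=> hc h h' r0; have [A A0 hA] := hc _ r0; exists (7 * A); first by rewrite mulr_ge0.
move=> s s' s0 sr s'r s0r.
apply: (@le_of_slack _ _ (2 + normc (s - s'))); first by rewrite addr_ge0 ?normc_ge0.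
move=> e e0; have [K hK] := h _ _ r0 e0; have [L hL] := h' _ _ r0 e0.
pose N := maxn K L.
have h1 := hK N (leq_maxl _ _) s sr; have h2 := hK N (leq_maxl _ _) s' s'r.
have h3 := hL N (leq_maxr _ _) s0 s0r.
have h4 := dpsum_taylor (ltW r0) (hA N.+1) sr s'r s0r.
set P := dpsum c N in h1 h2 h4; set P' := dpsum _ N in h3 h4.
have -> : phi s - phi s' - phi' s0 * (s - s') = (P s - P s' - P' s0 * (s - s')) -
   ((P s - phi s) - (P s' - phi s') - (P' s0 - phi' s0) * (s - s')) by ring.
apply: (le_trans (normcB_le _ _)).
have h5 := normcB_le (P s - phi s - (P s' - phi s')) ((P' s0 - phi' s0) * (s - s')).
have h6 := normcB_le (P s - phi s) (P s' - phi s').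
have h7 : normc ((P' s0 - phi' s0) * (s - s')) <= e * normc (s - s').
  by rewrite normcM ler_wpM2r ?normc_ge0.
have -> : e * (2 + normc (s - s')) = 2 * e + e * normc (s - s') by ring.
move: h1 h2 h4 h5 h6 h7; set X := _ * (normc _ + normc _); lra.
Qed.

Lemma dpsum_lipschitz d N : exists2 L : R, 0 <= L & forall s s',
  0 <= Re s -> 0 <= Re s' ->
  normc (dpsum d N s - dpsum d N s') <= L * normc (s - s').
Proof.
exists (\sum_(1 <= n < N.+1) 3 * (normc (d n) * ln n%:R)).
  by apply: sumr_ge0 => n _; rewrite !mulr_ge0 ?normc_ge0 ?lnn_ge0.
move=> s s' sr s'r; rewrite /dpsum -sumrB mulr_suml.
apply: (le_trans (normc_sum _ _ _)); apply: ler_sum => n _.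
rewrite -mulrBr normcM.
have t0 := lnn_ge0 R n; set t := (ln n%:R : R) in t0 *.
have Re_le u : 0 <= Re u -> Re (- (u * (t%:C)%C)) <= 0.
  by move=> ur; rewrite cReN cReMr oppr_le0 mulr_ge0.
have := cexp_lipschitz (Re_le _ sr) (Re_le _ s'r).
have -> : - (s * (t%:C)%C) - - (s' * (t%:C)%C) = - ((s - s') * (t%:C)%C) by ring.
rewrite normc_opp normcM normc_real ger0_norm// expR0 mulr1 => h.
apply: (le_trans (ler_wpM2l (normc_ge0 _) h)).
by apply: le_of_eq; ring.
Qed.

End AbsolutelyConvergent.

(** * Local inversion and lattice point counts *)

Section LocalInversion.
Variable R : realType.
Implicit Types (s z w : R[i]).

(** Simplified Newton iteration: the derivative is only taken at the centre. The
    condition relating B and r makes each step divide the error by 4. *)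
Lemma local_inversion (Phi Phi' : R[i] -> R[i]) (rho B r : R) s0 w :
  taylor_on rho B Phi Phi' -> 0 <= B -> 0 < r -> rho + r <= Re s0 ->
  0 < normc (Phi' s0) -> 8 * B * r <= normc (Phi' s0) ->
  normc (w - Phi s0) <= normc (Phi' s0) * r / 2 ->
  exists2 s, normc (s - s0) <= r & Phi s = w.
Proof.
move=> tP B0 r0 rs m0 Bm wr; set m := normc (Phi' s0) in m0 Bm wr.
have d0 : Phi' s0 != 0.
  by apply/eqP => d0; rewrite /m d0 normc_zero ltxx in m0.
pose it n := iter n (fun s => s + (w - Phi s) / Phi' s0) s0.
have itS n : it n.+1 - it n = (w - Phi (it n)) / Phi' s0.
  by rewrite /it iterS [X in X - _]addrC addrK.
have Re_ok s : normc (s - s0) <= r -> rho <= Re s.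
  move=> sr; have := Re_le_normc (s - s0); rewrite cReD cReN ler_norml => /andP[h _].
  lra.
have s00 : rho <= Re s0 by lra.
have nstep n : normc (it n.+1 - it n) = normc (w - Phi (it n)) / m.
  by rewrite itS normcM normcV.
have H n : normc (it n - s0) <= r * (1 - 2^-1 ^+ n) /\
   normc (w - Phi (it n)) <= m * r / 2 * 4^-1 ^+ n.
  elim: n => [|n [IH1 IH2]].
    by rewrite !expr0 /it/= !subrr mulr0 normc_zero mulr1.
  have p2 : 0 <= 2^-1 ^+ n :> R by rewrite exprn_ge0// invr_ge0.
  have p4 : 0 <= 4^-1 ^+ n :> R by rewrite exprn_ge0// invr_ge0.
  have p42 : 4^-1 ^+ n <= 2^-1 ^+ n :> R.
    by rewrite lerXn2r ?nnegrE ?invr_ge0// lef_pV2 ?posrE ?ltr0n// ler_nat.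
  have st : normc (it n.+1 - it n) <= r / 2 * 4^-1 ^+ n.
    rewrite nstep ler_pdivrMr//; apply: (le_trans IH2).
    by apply: le_of_eq; field.
  have st2 : normc (it n.+1 - it n) <= r / 2 * 2^-1 ^+ n.
    by apply: (le_trans st); rewrite ler_wpM2l// divr_ge0// ltW.
  have A1 : normc (it n.+1 - s0) <= r * (1 - 2^-1 ^+ n.+1).
    apply: (le_trans (normc_tri _ _ (it n))).
    have -> : r * (1 - 2^-1 ^+ n.+1) = r / 2 * 2^-1 ^+ n + r * (1 - 2^-1 ^+ n).
      by rewrite exprS; field.
    exact: lerD.
  have le_r k : r * (1 - 2^-1 ^+ k) <= r.
    by rewrite ler_piMr ?(ltW r0)// gerBl exprn_ge0// invr_ge0.
  split => //.
  have -> : w - Phi (it n.+1) =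
     - (Phi (it n.+1) - Phi (it n) - Phi' s0 * (it n.+1 - it n)).
    by rewrite itS mulrCA mulfV// mulr1; ring.
  rewrite normc_opp.
  have ok1 := le_trans A1 (le_r _); have ok2 := le_trans IH1 (le_r _).
  apply: (le_trans (tP _ _ s0 (Re_ok _ ok1) (Re_ok _ ok2) s00)).
  apply: (@le_trans _ _ (B * normc (it n.+1 - it n) * (r + r))).
    by rewrite ler_wpM2l ?mulr_ge0 ?normc_ge0// lerD.
  rewrite nstep.
  have -> : B * (normc (w - Phi (it n)) / m) * (r + r) =
     (8 * B * r) * (normc (w - Phi (it n)) / (4 * m)).
    by field; rewrite gt_eqF.
  apply: (@le_trans _ _ (m * (normc (w - Phi (it n)) / (4 * m)))).
    by rewrite ler_wpM2r// divr_ge0 ?normc_ge0// mulr_ge0// ltW.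
  have -> : m * (normc (w - Phi (it n)) / (4 * m)) = normc (w - Phi (it n)) / 4.
    by field; rewrite gt_eqF.
  rewrite exprSr mulrA ler_wpM2r// invr_ge0//.
have le_r k : r * (1 - 2^-1 ^+ k) <= r.
  by rewrite ler_piMr ?(ltW r0)// gerBl exprn_ge0// invr_ge0.
have inball n : normc (it n - s0) <= r.
  by have [h _] := H n; apply: (le_trans h).
have half n : r * 2^-1 ^+ n = 2 * (r / 2 * 2^-1 ^+ n) :> R by field.
have st2 n : normc (it n.+1 - it n) <= r * (2^-1 ^+ n - 2^-1 ^+ n.+1).
  have [_ h] := H n; rewrite nstep ler_pdivrMr//; apply: (le_trans h).
  have -> : r * (2^-1 ^+ n - 2^-1 ^+ n.+1) * m = m * r / 2 * 2^-1 ^+ n.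
    by rewrite exprS; field.
  rewrite ler_wpM2l ?divr_ge0 ?mulr_ge0 ?(ltW m0) ?(ltW r0)//.
  by rewrite lerXn2r ?nnegrE ?invr_ge0// lef_pV2 ?posrE ?ltr0n// ler_nat.
have tel n k : normc (it (n + k)%N - it n) <= r * (2^-1 ^+ n - 2^-1 ^+ (n + k)).
  elim: k => [|k IH]; first by rewrite addn0 !subrr mulr0 normc_zero.
  rewrite addnS; apply: (le_trans (normc_tri _ _ (it (n + k)%N))).
  have -> : r * (2^-1 ^+ n - 2^-1 ^+ (n + k).+1) =
    r * (2^-1 ^+ (n + k) - 2^-1 ^+ (n + k).+1) + r * (2^-1 ^+ n - 2^-1 ^+ (n + k)).
    by ring.
  by rewrite lerD.
have small e : 0 < e -> exists K : nat, r * 2^-1 ^+ K <= e.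
  move=> e0; pose K := (Num.truncn (r / e)).+1; exists K.
  have h2 : (K%:R : R) <= 2 ^+ K by rewrite -natrX ler_nat ltnW// ltn_expl.
  have h3 : r / e < K%:R by exact: truncnS_gt.
  rewrite exprVn ler_pdivrMr ?exprn_gt0// -ler_pdivrMl// mulrC.
  exact: le_trans (ltW h3) h2.
have [|s hs] := @complex_cauchy_lim R it.
  move=> e e0; have [K hK] := small _ (divr_gt0 e0 (ltr0Sn R 1)); exists K => k k' Kk Kk'.
  have cl j : (K <= j)%N -> normc (it j - it K) <= e / 2.
    move=> Kj; rewrite -(subnKC Kj); apply: (le_trans (tel _ _)).
    by apply: le_trans hK; rewrite ler_wpM2l ?(ltW r0)// gerBl exprn_ge0// invr_ge0.
  apply: (le_trans (normc_tri _ _ (it K))); rewrite (normcB (it K)).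
  by rewrite (splitr e) lerD// cl.
have sr : normc (s - s0) <= r.
  apply: (@le_of_slack _ _ _ 1) => // e e0; have [K hK] := hs _ e0.
  have := hK K (leqnn _); have := inball K; have := normc_tri s s0 (it K).
  by rewrite (normcB s (it K)) mulr1; lra.
exists s => //; apply/eqP; rewrite -subr_eq0; apply/eqP/normc_eq0P.
apply: (@le_of_slack _ _ _ (m + B * (r + r) + 1)).
  by rewrite addr_ge0// addr_ge0 ?(ltW m0)// mulr_ge0// addr_ge0 ?(ltW r0).
move=> e e0; rewrite add0r.
have [K hK] := hs _ e0; have [L hL] := small _ (divr_gt0 e0 m0).
pose n := maxn K L; have h1 := hK n (leq_maxl _ _).
have h2 : normc (w - Phi (it n)) <= e.
  have [_ h] := H n; apply: (le_trans h).
  have h3 : r * 2^-1 ^+ n <= e / m.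
    apply: le_trans hL; rewrite ler_wpM2l ?(ltW r0)//.
    by rewrite ler_wiXn2l ?invr_ge0 ?invf_le1 ?ler1n ?leq_maxr.
  have h4 : 4^-1 ^+ n <= 2^-1 ^+ n :> R.
    by rewrite lerXn2r ?nnegrE ?invr_ge0// lef_pV2 ?posrE ?ltr0n// ler_nat.
  rewrite ler_pdivlMr// in h3; apply: le_trans h3.
  have -> : m * r / 2 * 4^-1 ^+ n = (r * 4^-1 ^+ n * m) / 2 by field.
  apply: (@le_trans _ _ (r * 4^-1 ^+ n * m)).
    rewrite ler_piMr ?mulr_ge0 ?(ltW m0) ?(ltW r0) ?exprn_ge0 ?invr_ge0//.
    by rewrite invf_le1 ?ler1n.
  by rewrite ler_wpM2r ?(ltW m0)// ler_wpM2l ?(ltW r0).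
have h5 := tP s (it n) s0 (Re_ok _ sr) (Re_ok _ (inball n)) s00.
have h6 : B * normc (s - it n) * (normc (s - s0) + normc (it n - s0)) <= B * e * (r + r).
  rewrite ler_pM ?mulr_ge0 ?addr_ge0 ?normc_ge0//; last by rewrite lerD.
  by rewrite ler_wpM2l// normcB.
have h7 : normc (Phi' s0 * (s - it n)) <= m * e.
  by rewrite normcM ler_wpM2l ?(ltW m0)// normcB.
have -> : Phi s - w = (Phi s - Phi (it n) - Phi' s0 * (s - it n)) +
   Phi' s0 * (s - it n) - (w - Phi (it n)) by ring.
apply: (le_trans (normcB_le _ _)).
have h8 := normcD_le (Phi s - Phi (it n) - Phi' s0 * (s - it n)) (Phi' s0 * (s - it n)).
have -> : e * (m + B * (r + r) + 1) = m * e + B * e * (r + r) + e by ring.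
lra.
Qed.

End LocalInversion.

Section Counting.
Variable R : realType.

Lemma count_interval_ge (y l : R) P : 0 <= y -> 2 <= l -> y + l < P%:R ->
  l / 2 <= \sum_(p < P) ((y <= p%:R <= y + l)%R : nat)%:R.
Proof.
move=> y0 l2 yP; pose p0 := (Num.truncn y).+1; pose m := Num.truncn l.
have l0 : 0 <= l by lra.
have /andP[ml lm] := truncn_itv l0.
have /andP[py yp] := truncn_itv y0.
have p0y : p0%:R <= y + 1 by rewrite /p0 -natr1 lerD2r.
have m1 : 1 <= m%:R :> R.
  by rewrite ler1n /m truncn_gt0; lra.
have lm2 : l / 2 <= m%:R.
  move: lm; rewrite -/m -natr1; lra.
apply: (le_trans lm2).
have p0mP : (p0 + m <= P)%N.
  rewrite -ltnS -(ltr_nat R) natrD -natr1; lra.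
rewrite -(big_mkord xpredT (fun p : nat => ((y <= p%:R <= y + l)%R : nat)%:R)).
rewrite (@big_cat_nat _ _ _ p0)//=; last by rewrite (leq_trans _ p0mP)// leq_addr.
rewrite ler_wpDl ?sumr_ge0//.
rewrite (@big_cat_nat _ _ _ (p0 + m)%N)//= ?leq_addr//.
rewrite ler_wpDr ?sumr_ge0//.
rewrite (@eq_big_nat _ _ _ _ _ _ (fun=> 1)).
  by rewrite sumr_const_nat addKn.
move=> p /andP[pp pm].
have h1 : p0%:R <= p%:R :> R by rewrite ler_nat.
have h2 : p%:R + 1 <= p0%:R + m%:R :> R by rewrite natr1 -natrD ler_nat.
have h3 : y < p0%:R by exact: yp.
have -> : (y <= p%:R <= y + l) by apply/andP; split; lra.
by [].
Qed.

(** The sum of p q^p is q / (1 - q)^2; with q = e^(-x) this is comparable to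
    x^(-2), uniformly in x. *)
Lemma sum_arith_geom_le (x : R) P : 0 <= x ->
  \sum_(p < P) p%:R * x ^+ 2 * expR (- (p%:R * x)) <= 4.
Proof.
rewrite le_eqVlt => /predU1P[<-|x0].
  by rewrite big1// => p _; rewrite expr0n/= mulr0 mul0r.
pose q := expR (- x); have q0 : 0 < q by exact: expR_gt0.
have q1 : q < 1 by rewrite expR_lt1 oppr_lt0.
have E : \sum_(p < P) p%:R * x ^+ 2 * expR (- (p%:R * x)) =
   x ^+ 2 * \sum_(p < P) p%:R * q ^+ p.
  rewrite mulr_sumr; apply: eq_bigr => p _.
  by rewrite -mulrN expRM_natl -/q; ring.
have S : (1 - q) ^+ 2 * \sum_(p < P) p%:R * q ^+ p <= q.
  have -> : (1 - q) ^+ 2 * \sum_(p < P) p%:R * q ^+ p =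
    q - q ^+ P * (q + P%:R * (1 - q)).
    elim: P {E} => [|P IH]; first by rewrite big_ord0 expr0; ring.
    by rewrite big_ord_recr/= mulrDr IH (exprS q P) -(natr1 P); ring.
  rewrite gerBl mulr_ge0 ?exprn_ge0 ?(ltW q0)// addr_ge0 ?(ltW q0)//.
  by rewrite mulr_ge0// subr_ge0 ltW.
have xq : x * expR (- (x / 2)) <= 2 * (1 - q).
  pose v := expR (- (x / 2)); have v0 : 0 < v by exact: expR_gt0.
  have qv : q = v * v by rewrite /q /v -expRD; congr expR; field.
  have vx : v * (1 + x / 2) <= 1.
    apply: (@le_trans _ _ (v * expR (x / 2))).
      by rewrite ler_wpM2l ?(ltW v0)// expR_ge1Dx.
    by rewrite mulrC expRxMexpNx_1.
  have v1 : v <= 1 by rewrite expR_le1 oppr_le0 divr_ge0// ltW.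
  have : v * v <= v by rewrite ler_piMr// ltW.
  rewrite -/v qv; move: vx; rewrite mulrDr mulr1 mulrA.
  rewrite (mulrC v x); lra.
have xq2 : x ^+ 2 * q <= 4 * (1 - q) ^+ 2.
  have -> : x ^+ 2 * q = (x * expR (- (x / 2))) ^+ 2.
    by rewrite exprMn -expRM_natl; congr (_ * expR _); field.
  have -> : 4 * (1 - q) ^+ 2 = (2 * (1 - q)) ^+ 2 by ring.
  rewrite lerXn2r ?nnegrE ?mulr_ge0 ?expR_ge0 ?(ltW x0)//.
  by rewrite subr_ge0 ltW.
have d0 : 0 < (1 - q) ^+ 2 by rewrite exprn_gt0// subr_gt0.
rewrite E -(ler_pM2l d0) mulrCA (mulrC _ 4); apply: le_trans xq2.
by rewrite ler_wpM2l// sqr_ge0.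
Qed.

(** With t = ln n, this bound and the next two concern Riemann sums, of mesh
    h, for the integral over sigma of sigma t^2 e^(-2 sigma t). The integral
    does not depend on t: the weight sigma compensates the factor (ln n)^2
    brought by differentiation. *)
Lemma riemann_upper (h t : R) P : 0 <= h -> 0 <= t ->
  \sum_(p < P) h * (p%:R * h) * t ^+ 2 * expR (- (2 * (p%:R * h) * t)) <= 1.
Proof.
move=> h0 t0; have x0 : 0 <= 2 * h * t by rewrite !mulr_ge0.
have := sum_arith_geom_le P x0.
rewrite -[leRHS]mulr1 -ler_pdivrMl// mulr_sumr; apply: le_trans.
apply: le_of_eq; apply: eq_bigr => p _.
have -> : 2 * (p%:R * h) * t = p%:R * (2 * h * t) by ring.
by field.
Qed.

Lemma riemann_upper_tail (h t kappa : R) P : 0 <= h -> 0 <= t ->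
  \sum_(p < P) ((kappa <= p%:R * h)%R : nat)%:R *
     (h * (p%:R * h) * t ^+ 2 * expR (- (2 * (p%:R * h) * t))) <=
  4 * expR (- (kappa * t)).
Proof.
move=> h0 t0; have x0 : 0 <= h * t by rewrite !mulr_ge0.
have := sum_arith_geom_le P x0.
rewrite -(ler_pM2r (expR_gt0 (- (kappa * t)))); apply: le_trans.
rewrite mulr_suml; apply: ler_sum => p _.
have n0 : 0 <= p%:R * (h * t) ^+ 2 :> R by rewrite mulr_ge0// sqr_ge0.
case: (leP kappa (p%:R * h)) => [kp|_]; last first.
  by rewrite mul0r mulr_ge0 ?expR_ge0// mulr_ge0 ?expR_ge0.
rewrite mul1r.
have -> : h * (p%:R * h) * t ^+ 2 = p%:R * (h * t) ^+ 2 by ring.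
rewrite -[leRHS]mulrA ler_wpM2l// -expRD ler_expR.
have : kappa * t <= p%:R * h * t by rewrite ler_wpM2r.
lra.
Qed.

(** The points at which sigma t lies in [1, 2] are enough. *)
Lemma riemann_lower (h t rho : R) P : 0 < h -> 0 < t -> h * t <= 2^-1 ->
  rho * t <= 1 -> 2 < P%:R * (h * t) ->
  expR (- 4) / 2 <=
  \sum_(p < P | rho <= p%:R * h) h * (p%:R * h) * t ^+ 2 * expR (- (2 * (p%:R * h) * t)).
Proof.
move=> h0 t0 ht rt Pht; pose l := (h * t)^-1.
have ht0 : 0 < h * t by rewrite mulr_gt0.
have l0 : 0 < l by rewrite invr_gt0.
have l2 : 2 <= l by rewrite -[2]invrK lef_pV2 ?posrE ?invr_gt0.
have llP : l + l < P%:R.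
  have -> : l + l = 2 / (h * t) by rewrite /l; field; rewrite !gt_eqF.
  by rewrite ltr_pdivrMr.
have := count_interval_ge (ltW l0) l2 llP.
rewrite -(ler_pM2l (mulr_gt0 ht0 (expR_gt0 (- 4)))).
have -> : h * t * expR (- 4) * (l / 2) = expR (- 4) / 2.
  by rewrite /l; field; rewrite !gt_eqF.
move=> /le_trans; apply.
rewrite mulr_sumr [leRHS]big_mkcond/=; apply: ler_sum => p _.
have nn : 0 <= h * (p%:R * h) * t ^+ 2 * expR (- (2 * (p%:R * h) * t)).
  by rewrite !mulr_ge0 ?expR_ge0 ?sqr_ge0 ?(ltW h0) ?(ltW t0).
case: (boolP (l <= p%:R <= l + l)) => [/andP[lp pl]|_]; last first.
  by rewrite mulr0; case: ifP.
have p1 : 1 <= p%:R * h * t.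
  by rewrite -mulrA -ler_pdivrMr// div1r.
have p2 : p%:R * h * t <= 2.
  rewrite -mulrA -ler_pdivlMr//; apply: (le_trans pl).
  by rewrite -/l; lra.
have -> : rho <= p%:R * h.
  by rewrite -(ler_pM2r t0); exact: le_trans p1.
rewrite mulr1.
have -> : h * (p%:R * h) * t ^+ 2 = h * t * (p%:R * h * t) by ring.
have e4 : expR (- 4) <= expR (- (2 * (p%:R * h) * t)) by rewrite ler_expR; lra.
have e0 := expR_ge0 (- (2 * (p%:R * h) * t)).
move: e4 e0; set e := expR (- (2 * _ * _)) => e4 e0.
have -> : h * t * (p%:R * h * t) * e = h * t * (p%:R * h * t * e) by ring.
rewrite ler_pM2l//; apply: (le_trans e4).
by rewrite -[leLHS]mul1r ler_wpM2r.
Qed.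

End Counting.

(** * The area estimate *)

Section DoubleCounting.
Variable R : realType.

Lemma count_near_ge (x r h : R) P : 0 < h -> h <= r -> r <= x -> x + r < P%:R * h ->
  r / h <= \sum_(p < P) ((`|x - p%:R * h| <= r)%R : nat)%:R.
Proof.
move=> h0 hr rx xP.
have y0 : 0 <= (x - r) / h by rewrite divr_ge0 ?subr_ge0// ltW.
have l2 : 2 <= 2 * r / h by rewrite ler_pdivlMr// ler_pM2l.
have yl : (x - r) / h + 2 * r / h < P%:R.
  by rewrite -mulrDl ltr_pdivrMr//; apply: le_lt_trans xP; lra.
have := count_interval_ge y0 l2 yl.
have -> : 2 * r / h / 2 = r / h by field; rewrite gt_eqF.
move=> /le_trans; apply; apply: ler_sum => p _.
case: (boolP ((x - r) / h <= p%:R <= _)) => // /andP[].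
rewrite -mulrDl ler_pdivrMr// ler_pdivlMr// => h1 h2.
suff -> : `|x - p%:R * h| <= r by [].
by rewrite ler_norml; apply/andP; split; lra.
Qed.

(** Each point (x, y) is at distance at most r, in both coordinates, from at
    least (r/h)^2 grid points, and each grid point is reached at most k times. *)
Lemma lattice_double_count (I J P Q k : nat) (h : R) (x y r X Y : nat -> nat -> R)
    (good : nat -> nat -> bool) :
  0 < h -> (forall i j, 0 <= X i j) -> (forall p q, 0 <= Y p q) ->
  (forall i j, (i < I)%N -> (j < J)%N -> good i j ->
    [/\ h <= r i j, r i j <= x i j, r i j <= y i j,
        x i j + r i j < P%:R * h & y i j + r i j < Q%:R * h]) ->
  (forall i j p q, (i < I)%N -> (j < J)%N -> good i j ->
    `|x i j - p%:R * h| <= r i j -> `|y i j - q%:R * h| <= r i j -> X i j <= Y p q) ->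
  (forall p q : nat, (\sum_(i < I) \sum_(j < J)
     ([&& good i j, (`|x i j - p%:R * h| <= r i j)%R &
          (`|y i j - q%:R * h| <= r i j)%R] : nat) <= k)%N) ->
  \sum_(i < I) \sum_(j < J | good i j) r i j ^+ 2 * X i j <=
  h ^+ 2 * k%:R * \sum_(p < P) \sum_(q < Q) Y p q.
Proof.
move=> h0 X0 Y0 hgood hXY hk.
pose nx i j p : R := ((`|x i j - p%:R * h| <= r i j)%R : nat)%:R.
pose ny i j q : R := ((`|y i j - q%:R * h| <= r i j)%R : nat)%:R.
apply: (@le_trans _ _ (\sum_(i < I) \sum_(j < J | good i j)
  h ^+ 2 * \sum_(p < P) \sum_(q < Q) nx i j p * ny i j q * Y p q)).
  apply: ler_sum => i _; apply: ler_sum => j gij.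
  have [hr rx ry xP yQ] := hgood i j (ltn_ord i) (ltn_ord j) gij.
  have r0 : 0 <= r i j / h by rewrite divr_ge0 ?(ltW h0)// (le_trans (ltW h0)).
  have c1 := count_near_ge h0 hr rx xP; have c2 := count_near_ge h0 hr ry yQ.
  have -> : r i j ^+ 2 * X i j = h ^+ 2 * ((r i j / h) * (r i j / h) * X i j).
    by field; rewrite gt_eqF.
  rewrite ler_wpM2l ?sqr_ge0//.
  apply: (@le_trans _ _ ((\sum_(p < P) nx i j p) * (\sum_(q < Q) ny i j q) * X i j)).
    by rewrite ler_wpM2r// ler_pM.
  rewrite -mulrA mulr_suml; apply: ler_sum => p _.
  rewrite mulr_suml mulr_sumr; apply: ler_sum => q _.
  rewrite mulrA /nx /ny.
  case: (boolP (`|x i j - p%:R * h| <= r i j)) => [h1|_]; last by rewrite !mul0r.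
  case: (boolP (`|y i j - q%:R * h| <= r i j)) => [h2|_]; last by rewrite mulr0 !mul0r.
  by rewrite !mul1r; exact: hXY.
rewrite (eq_bigr (fun i : 'I_I => h ^+ 2 * \sum_(p < P) \sum_(q < Q)
  \sum_(j < J | good i j) nx i j p * ny i j q * Y p q)); last first.
  move=> i _; rewrite -mulr_sumr exchange_big/=; congr (_ * _).
  by apply: eq_bigr => p _; rewrite exchange_big.
rewrite -mulr_sumr -mulrA ler_wpM2l ?sqr_ge0// exchange_big/= mulr_sumr.
apply: ler_sum => p _; rewrite exchange_big/= mulr_sumr.
apply: ler_sum => q _.
rewrite (eq_bigr (fun i : 'I_I => (\sum_(j < J | good i j) nx i j p * ny i j q) * Y p q));
  last by move=> i _; rewrite mulr_suml.
rewrite -mulr_suml ler_wpM2r//; apply: le_trans (_ : _ <= (_)%:R) _; last first.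
  by rewrite ler_nat; exact: (hk p q).
rewrite natr_sum; apply: ler_sum => i _; rewrite natr_sum big_mkcond/=.
apply: ler_sum => j _; case: (good i j) => //=.
by rewrite /nx /ny -natrM mulnb.
Qed.

End DoubleCounting.

Section Valence.
Variable R : realType.

(** Points of a grid of mesh h have disjoint neighbourhoods of radius h/3, so
    that distinct grid points provide distinct solutions. *)
Lemma valent_count (k : nat) (Phi : R[i] -> R[i]) (h : R) I J w (b : nat -> nat -> bool) :
  valent k Phi -> 0 < h -> 0 < Re w ->
  (forall i j, (i < I)%N -> (j < J)%N -> b i j -> exists s : R[i],
    [/\ 0 < Re s, Phi s = w,
        `|Re s - i%:R * h| <= h / 3 & `|Im s - j%:R * h| <= h / 3]) ->
  (\sum_(i < I) \sum_(j < J) (b i j : nat) <= k)%N.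
Proof.
move=> vk h0 w0 hb.
pose T := [set ij : 'I_I * 'I_J | b ij.1 ij.2]%SET.
have -> : (\sum_(i < I) \sum_(j < J) (b i j : nat) = #|T|)%N.
  rewrite pair_big/= -sum1_card [RHS]big_mkcond/=; apply: eq_bigr => ij _.
  by rewrite inE; case: (b _ _).
pose A := [set s : R[i] | halfplane 0 s /\ Phi s = w].
have /choice[g hg] : forall ij : 'I_I * 'I_J, exists s : R[i], b ij.1 ij.2 ->
    [/\ 0 < Re s, Phi s = w,
     `|Re s - ij.1%:R * h| <= h / 3 & `|Im s - ij.2%:R * h| <= h / 3].
  move=> [i j]/=; case: (boolP (b i j)) => [bij|_]; last by exists 0.
  by have [s hs] := hb i j (ltn_ord i) (ltn_ord j) bij; exists s.
have sep (x : R) (m n : nat) : `|x - m%:R * h| <= h / 3 -> `|x - n%:R * h| <= h / 3 ->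
    (m <= n)%N.
  move=> /ler_normlP[h1 h2] /ler_normlP[h3 h4]; rewrite leqNgt; apply/negP => nm.
  have : n%:R + 1 <= m%:R :> R by rewrite natr1 ler_nat.
  rewrite -(ler_pM2r h0) mulrDl mul1r; lra.
have ginj : {in T &, injective g}.
  move=> [i j] [i' j']; rewrite !inE/= => bij bij' E.
  have [_ _ /= x1 y1] := hg (i, j) bij; have [_ _ /= x2 y2] := hg (i', j') bij'.
  rewrite E in x1 y1; congr pair; apply/val_inj/eqP => /=; rewrite eqn_leq.
    by rewrite (sep _ _ _ x1 x2) (sep _ _ _ x2 x1).
  by rewrite (sep _ _ _ y1 y2) (sep _ _ _ y2 y1).
have [T0|/set0Pn[t0 t0T]] := eqVneq T finset.set0; first by rewrite T0 cards0.
pose f n := g (nth t0 (enum T) n).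
have sz : size (enum T) = #|T| by rewrite cardE.
have finj : {in `I_#|T| &, injective f}.
  move=> n m; rewrite !inE/= => nT mT; have nT' : (n < #|T|)%N by [].
  move=> /ginj; rewrite -!(mem_enum T) !mem_nth ?sz// => /(_ isT isT)/eqP.
  by rewrite nth_uniq ?sz ?enum_uniq// => /eqP.
have fA : f @` `I_#|T| `<=` A.
  move=> _ [n /= nT <-].
  have : nth t0 (enum T) n \in T by rewrite -mem_enum mem_nth ?sz.
  by rewrite inE => /hg[].
have := vk w w0; rewrite -/A => Ak.
rewrite -card_le_II; apply: card_le_trans Ak; apply: card_le_trans (subset_card_le fA).
by have := inj_card_eq finj; rewrite card_eq_le => /andP[].
Qed.

End Valence.

Section AreaEstimate.
Variable R : realType.
Implicit Types (s z w : R[i]).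

(** What the symbols of the theorem provide: [Phi'] stands for the derivative,
    through the Taylor estimate. *)
Record tame_map (c0 k : nat) (M : R) (Phi Phi' : R[i] -> R[i]) : Prop := {
  tame_c0 : (0 < c0)%N ;
  tame_Re : forall s, 0 < Re s -> c0%:R * Re s <= Re (Phi s) ;
  tame_Im : forall s, 0 < Re s ->
    `|Im (Phi s) - c0%:R * Im s| <= M ;
  tame_bound : forall rho : R, 0 < rho -> exists2 D, 0 <= D & forall s,
    rho <= Re s ->
    Re (Phi s) <= c0%:R * Re s + D /\ normc (Phi' s) <= D ;
  tame_taylor : forall rho : R, 0 < rho -> exists2 B, 0 <= B & taylor_on rho B Phi Phi' ;
  tame_valent : valent k Phi }.

(** An upper bound for Re s when Re Phi(s) is at most 2u, according to whether
    s is near the boundary, where Re s <= eps Re Phi(s), or not, where c0 Re s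
    <= Re Phi(s) is used and u is at least kappa. *)
Definition area_weight (c0 : nat) (eps kappa u : R) : R :=
  2 * u * (eps + ((kappa <= u)%R : nat)%:R / c0%:R).

(** Discrete change of variables: the cell of mesh [h] around a point of the
    source grid is mapped onto a set which contains a square of side comparable
    to [h] times the modulus of the derivative, and by valence these squares
    cover every point of the target grid at most [k] times. The first sum on the
    right is the contribution of the points where the derivative is too small
    for local inversion at scale [h]. *)
Lemma area_estimate c0 k M Phi Phi' (g : R[i] -> R[i])
    (rho D B L K tau h e delta eps : R) I J P Q :
  tame_map c0 k M Phi Phi' ->
  0 < rho <= 1 -> taylor_on (rho / 2) B Phi Phi' -> 0 <= B ->
  (forall s, rho / 2 <= Re s -> normc (Phi' s) <= D) ->
  0 < tau -> 0 < h <= rho -> D * h <= rho -> 8 * B * h <= tau ->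
  (forall s s', 0 <= Re s -> 0 <= Re s' ->
     normc (g s - g s') <= L * normc (s - s')) -> 0 <= L ->
  (forall s, 0 <= Re s -> normc (g s) <= K) ->
  0 <= e -> L * D * h <= e ->
  0 < delta -> 0 <= eps ->
  (forall s, 0 < Re s < delta -> Re s <= eps * Re (Phi s)) ->
  let h' := tau * h / 12 in
  (forall i j, (i < I)%N -> (j < J)%N -> rho <= i%:R * h ->
     Re (Phi (vstep (i%:R * h +i* 0)%C h j)) + 1 < P%:R * h') ->
  c0%:R * (J%:R * h) + 2 * M + 2 < Q%:R * h' ->
  \sum_(i < I | rho <= i%:R * h) \sum_(j < J)
     (i%:R * h) * sqmod (g (Phi (vstep (i%:R * h +i* 0)%C h j)) *
                         Phi' (vstep (i%:R * h +i* 0)%C h j)) * h ^+ 2 <=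
  \sum_(i < I) \sum_(j < J) (i%:R * h) * K ^+ 2 * tau ^+ 2 * h ^+ 2 +
  144 * h' ^+ 2 * k%:R * \sum_(p < P) \sum_(q < Q)
     area_weight c0 eps (c0%:R * delta / 2) (p%:R * h') *
     (2 * sqmod (g (vstep (p%:R * h' +i* - (M + 1))%C h' q)) + 2 * e ^+ 2).
Proof.
move=> tm /andP[r0 r1] tP B0 hD t0 /andP[h0 hr] Dh Bh gL L0 gK e0 LDh d0 ep0 heps h' hP hQ.
pose S i j := vstep (i%:R * h +i* 0)%C h j.
pose V p q := vstep (p%:R * h' +i* - (M + 1))%C h' q.
have h'E : h' = tau * h / 12 by [].
have h'0 : 0 < h' by rewrite divr_gt0 ?mulr_gt0.
clearbody h'.
have c01 : 1 <= c0%:R :> R by rewrite ler1n; exact: tame_c0 tm.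
have c0p : 0 < c0%:R :> R by rewrite ltr0n; exact: tame_c0 tm.
have ReS i j : Re (S i j) = i%:R * h by rewrite /S Re_vstep.
have ImS i j : Im (S i j) = j%:R * h by rewrite /S Im_vstep/= add0r.
have ReV p q : Re (V p q) = p%:R * h' by rewrite /V Re_vstep.
have ImV p q : Im (V p q) = q%:R * h' - (M + 1).
  by rewrite /V Im_vstep/= addrC.
pose m i j := normc (Phi' (S i j)).
pose good i j := (rho <= i%:R * h) && (tau <= m i j).
pose X i j : R := i%:R * h * sqmod (g (Phi (S i j))).
have X0 i j : 0 <= X i j by rewrite !mulr_ge0 ?sqmod_ge0 ?(ltW h0).
pose Y p q : R := area_weight c0 eps (c0%:R * delta / 2) (p%:R * h') *
     (2 * sqmod (g (V p q)) + 2 * e ^+ 2).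
have Y0 p q : 0 <= Y p q.
  rewrite /Y /area_weight; apply: mulr_ge0.
    by rewrite !mulr_ge0 ?(ltW h'0)// addr_ge0// divr_ge0.
  by rewrite addr_ge0 ?mulr_ge0 ?sqmod_ge0 ?sqr_ge0.
pose x i j := Re (Phi (S i j)).
(* the target grid starts at height -(M + 1), below the images of the source
   grid, whose imaginary parts are at least -M *)
pose y i j := Im (Phi (S i j)) + (M + 1).
(* local inversion on the disc of radius h/3 covers the disc of radius m h/6
   around the image, which contains a square of half-side m h/12 *)
pose r i j := m i j * h / 12.
have mD i j : rho <= i%:R * h -> m i j <= D.
  by move=> ri; apply: hD; rewrite ReS; lra.
have r12 i j : rho <= i%:R * h -> r i j <= rho / 12.
  move=> ri; rewrite /r ler_pM2r ?invr_gt0//; apply: le_trans Dh.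
  by rewrite ler_pM2r// mD.
have xlo i j : rho <= i%:R * h -> c0%:R * (i%:R * h) <= x i j.
  by move=> ri; rewrite /x -(ReS i j); apply: (tame_Re tm); rewrite ReS; lra.
have xlo1 i j : rho <= i%:R * h -> i%:R * h <= x i j.
  move=> ri; apply: le_trans (xlo _ _ ri); rewrite ler_peMl//; lra.
have ybd i j : rho <= i%:R * h -> `|y i j - (M + 1) - c0%:R * (j%:R * h)| <= M.
  move=> ri; rewrite /y addrK -(ImS i j); apply: (tame_Im tm); rewrite ReS; lra.
have goodP i j : (i < I)%N -> (j < J)%N -> good i j ->
    [/\ h' <= r i j, r i j <= x i j, r i j <= y i j,
        x i j + r i j < P%:R * h' & y i j + r i j < Q%:R * h'].
  move=> iI jJ /andP[ri tm_]; have rr := r12 _ j ri; have xx := xlo1 _ j ri.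
  have /ler_normlP[y1 y2] := ybd _ j ri.
  have cj0 : 0 <= c0%:R * (j%:R * h) by rewrite !mulr_ge0 ?(ltW h0).
  have cjJ : c0%:R * (j%:R * h) <= c0%:R * (J%:R * h).
    by rewrite !ler_wpM2l// ler_wpM2r ?(ltW h0)// ler_nat ltnW.
  split.
  - by rewrite /r h'E ler_pM2r ?invr_gt0// ler_pM2r.
  - lra.
  - lra.
  - have := hP i j iI jJ ri; rewrite -/(S i j) -/(x i j); lra.
  - lra.
have nearP i j p q : good i j -> `|x i j - p%:R * h'| <= r i j ->
    `|y i j - q%:R * h'| <= r i j ->
    normc (V p q - Phi (S i j)) <= m i j * (h / 3) / 2 /\ x i j / 2 <= p%:R * h'.
  move=> /andP[ri _] nx ny; split.
    apply: (le_trans (normc_le_ReIm _)); rewrite cReD cReN cImD cImN ReV ImV.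
    rewrite -/(x i j).
    have -> : q%:R * h' - (M + 1) - Im (Phi (S i j)) = - (y i j - q%:R * h').
      by rewrite /y; ring.
    rewrite normrN (distrC (p%:R * h')).
    have -> : m i j * (h / 3) / 2 = r i j + r i j by rewrite /r; field.
    exact: lerD.
  move: nx => /ler_normlP[_ nx].
  have rr := r12 _ j ri; have xx := xlo1 _ j ri; lra.
have XY i j p q : (i < I)%N -> (j < J)%N -> good i j ->
    `|x i j - p%:R * h'| <= r i j -> `|y i j - q%:R * h'| <= r i j -> X i j <= Y p q.
  move=> iI jJ gij nx ny; have [nV xV] := nearP _ _ _ _ gij nx ny.
  have /andP[ri _] := gij.
  have xx := xlo _ j ri; have xx1 := xlo1 _ j ri.
  have p0 : 0 <= p%:R * h' by rewrite mulr_ge0// ltW.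
  have wt : i%:R * h <= area_weight c0 eps (c0%:R * delta / 2) (p%:R * h').
    rewrite /area_weight; have [id|di] := ltP (i%:R * h) delta.
      have := heps (S i j); rewrite ReS id andbT => /(_ _) h1.
      have h2 : i%:R * h <= eps * x i j by apply: h1; lra.
      apply: (le_trans h2); apply: (@le_trans _ _ (2 * (p%:R * h') * eps)).
        by rewrite mulrC ler_wpM2r//; lra.
      by rewrite ler_wpM2l ?mulr_ge0 ?(ltW h'0)// lerDl divr_ge0.
    have kv : c0%:R * delta / 2 <= p%:R * h'.
      have : c0%:R * delta <= c0%:R * (i%:R * h) by rewrite ler_pM2l.
      lra.
    rewrite kv /= mul1r; apply: (@le_trans _ _ (2 * (p%:R * h') / c0%:R)).
      rewrite ler_pdivlMr// mulrC; lra.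
    by rewrite ler_wpM2l ?mulr_ge0 ?(ltW h'0)// lerDr.
  rewrite /X /Y ler_pM ?sqmod_ge0 ?mulr_ge0 ?(ltW h0)//.
  have -> : g (Phi (S i j)) = g (V p q) + (g (Phi (S i j)) - g (V p q)) by ring.
  apply: (le_trans (sqmodD2 _ _)); rewrite lerD2l ler_wpM2l//.
  rewrite -normcX2 lerXn2r ?nnegrE ?normc_ge0//.
  apply: le_trans LDh; apply: (le_trans (gL _ _ _ _)).
  - by rewrite -/(x i j); lra.
  - by rewrite ReV.
  rewrite -mulrA ler_wpM2l// normcB; apply: (le_trans nV).
  have h3 : m i j * h <= D * h by rewrite ler_pM2r// mD.
  have h4 : 0 <= m i j * h by rewrite mulr_ge0 ?normc_ge0 ?(ltW h0).
  rewrite (_ : m i j * (h / 3) / 2 = m i j * h / 6); last by field.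
  lra.
have cnt (p q : nat) : (\sum_(i < I) \sum_(j < J)
     ([&& good i j, (`|x i j - p%:R * h'| <= r i j)%R &
          (`|y i j - q%:R * h'| <= r i j)%R] : nat) <= k)%N.
  have [p0|p0] := eqVneq p 0%N.
    rewrite big1// => i _; rewrite big1// => j _.
    apply/eqP; rewrite eqb0; apply/negP => /and3P[gij nx ny].
    have [_] := nearP _ _ _ _ gij nx ny; rewrite p0 mul0r.
    have /andP[ri _] := gij; have := xlo1 _ j ri; lra.
  apply: (@valent_count _ k Phi h I J (V p q)
    (fun i j => [&& good i j, (`|x i j - p%:R * h'| <= r i j)%R &
          (`|y i j - q%:R * h'| <= r i j)%R]) (tame_valent tm) h0).
    by rewrite ReV mulr_gt0// ltr0n lt0n.
  move=> i j iI jJ /and3P[gij nx ny]; have [nV _] := nearP _ _ _ _ gij nx ny.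
  have /andP[ri tmij] := gij.
  have m0 : 0 < normc (Phi' (S i j)) by exact: lt_le_trans tmij.
  have h30 : 0 < h / 3 by rewrite divr_gt0.
  have rs : rho / 2 + h / 3 <= Re (S i j) by rewrite ReS; lra.
  have Bm : 8 * B * (h / 3) <= normc (Phi' (S i j)).
    apply: le_trans tmij; apply: le_trans Bh; rewrite ler_wpM2l ?mulr_ge0//; lra.
  have [s sS sV] := local_inversion tP B0 h30 rs m0 Bm nV.
  have h1 := le_trans (Re_le_normc _) sS; have h2 := le_trans (Im_le_normc _) sS.
  rewrite cReD cReN ReS in h1; rewrite cImD cImN ImS in h2.
  exists s; split => //; move: h1 => /ler_normlP[h1 _]; lra.
have main := lattice_double_count h'0 X0 Y0 goodP XY cnt.
rewrite -[X in _ + 144 * _ * _ * X]/(\sum_(p < P) \sum_(q < Q) Y p q).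
have -> : 144 * h' ^+ 2 * k%:R * (\sum_(p < P) \sum_(q < Q) Y p q) =
   144 * (h' ^+ 2 * k%:R * \sum_(p < P) \sum_(q < Q) Y p q) by ring.
apply: le_trans (lerD (lexx _) (ler_wpM2l (_ : 0 <= 144) main)); last by [].
rewrite mulr_sumr -big_split/= big_mkcond/=; apply: ler_sum => i _.
have nn : 0 <= i%:R * h * K ^+ 2 * tau ^+ 2 * h ^+ 2.
  exact: mulr_ge0 (mulr_ge0 (mulr_ge0 (mulr_ge0 (ler0n _ _) (ltW h0))
    (sqr_ge0 _)) (sqr_ge0 _)) (sqr_ge0 _).
have nn2 j : 0 <= r i j ^+ 2 * X i j by exact: mulr_ge0 (sqr_ge0 _) (X0 _ _).
case: ifP => ri; last first.
  apply: addr_ge0; first by apply: sumr_ge0 => j _; exact: nn.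
  by apply: mulr_ge0 => //; apply: sumr_ge0 => j _; exact: nn2.
rewrite mulr_sumr [X in _ + X]big_mkcond/= -big_split/=; apply: ler_sum => j _.
have -> : i%:R * h * sqmod (g (Phi (vstep (i%:R * h +i* 0)%C h j)) *
   Phi' (vstep (i%:R * h +i* 0)%C h j)) * h ^+ 2 = X i j * m i j ^+ 2 * h ^+ 2.
  by rewrite sqmodM /X /m normcX2; ring.
rewrite /good ri /=; have [tmij|mt] := leP tau (m i j).
  apply: ler_wpDl; first exact: nn.
  by rewrite /r; apply: le_of_eq; field.
rewrite addr0 /X ler_wpM2r ?sqr_ge0// ler_pM ?sqr_ge0//.
- by rewrite !mulr_ge0 ?sqmod_ge0 ?(ltW h0).
- rewrite ler_wpM2l ?mulr_ge0 ?(ltW h0)// -normcX2.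
  have K0 : 0 <= K by apply: le_trans (gK 0 _); rewrite ?normc_ge0.
  rewrite lerXn2r ?nnegrE ?normc_ge0// gK//.
  by have := xlo1 _ j ri; rewrite /x; lra.
- by rewrite lerXn2r ?nnegrE ?normc_ge0 ?(ltW t0)// ltW.
Qed.

End AreaEstimate.

(** * A Littlewood-Paley estimate *)

Section GridSums.
Variable R : realType.
Implicit Types (s z w : R[i]).

Lemma exists_le_natM (F : nat -> R) (n : nat) (a : R) : 0 < a ->
  exists J0, forall J, (J0 <= J)%N -> forall i, (i < n)%N -> F i <= J%:R * a.
Proof.
move=> a0; elim: n => [|n [J0 IH]]; first by exists 0%N.
exists (maxn J0 (Num.truncn (F n / a)).+1) => J; rewrite geq_max => /andP[h1 h2] i.
rewrite ltnS leq_eqVlt => /predU1P[->|/(IH J h1)//].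
rewrite -ler_pdivrMr//; apply: (le_trans (ltW (truncnS_gt _))).
by rewrite ler_nat.
Qed.

(** The threshold depends on the line, hence on the finite number of lines: the
    heights of the grids will be chosen after their widths. *)
Lemma mean_value_grid (p : nat -> R[i]) N (h : R) (u : nat -> R[i]) n (e : R) :
  0 < h -> h * ln N%:R <= 1 -> 0 < e ->
  exists J0, forall J, (J0 <= J)%N -> forall i, (i < n)%N ->
   `|\sum_(j < J) sqmod (dpsum p N (vstep (u i) h j)) -
     J%:R * \sum_(1 <= m < N.+1) sqmod (p m) * npow m (2 * Re (u i))| <=
   J%:R * e.
Proof.
move=> h0 hN e0.
have /choice[C hC] := fun i => mean_value_dpsum p (u i) h0 hN.
have [J0 hJ] := exists_le_natM C n e0; exists J0 => J /hJ JC i ni.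
exact: le_trans (hC i J) (JC i ni).
Qed.

Lemma sqmod_dcoef (a : nat -> R[i]) n : sqmod (dcoef a n) = ln n%:R ^+ 2 * sqmod (a n).
Proof. by rewrite -normcX2 normc_dcoef exprMn normcX2. Qed.

(** For the finitely many indices below Mm the weight m^(-2 rho) is bounded
    below, so that uniform approximation controls unweighted sums of squares. *)
Lemma coefs_near (S : set nat) (F F' : R[i] -> R[i]) b (rho e : R) Mm :
  coefs_of S F F' b -> 0 < rho -> rho * ln Mm%:R <= 1 -> 0 < e <= 1 ->
  exists p N, [/\ supported S N p,
    forall s, rho <= Re s -> sqmod (dpsum (dcoef p) N s) <=
       2 * sqmod (F' s) + 2 * e &
    \sum_(2 <= m < Mm) sqmod (b m) <=
       2 * \sum_(2 <= m < Mm) sqmod (p m) + 2 * expR 2 * e].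
Proof.
move=> [_ h] r0 rM /andP[e0 e1]; have [p [N [sp _ h1 h2]]] := h _ _ r0 e0.
have ee : e ^+ 2 <= e by rewrite expr2 ler_piMr// ltW.
exists p, N; split => // [s sr|].
  have -> : dpsum (dcoef p) N s = F' s + (dpsum (dcoef p) N s - F' s).
    by ring.
  apply: (le_trans (sqmodD2 _ _)); rewrite lerD2l ler_wpM2l//.
  apply: le_trans ee; rewrite -normcX2 lerXn2r ?nnegrE ?normc_ge0 ?(ltW e0)//.
  exact: h1.
apply: (@le_trans _ _ (\sum_(2 <= m < Mm) (2 * sqmod (p m) + 2 * sqmod (p m - b m)))).
  apply: ler_sum => m _; rewrite (sqmodB (p m)).
  have {1}-> : b m = p m + (b m - p m) by ring.
  exact: sqmodD2.
rewrite big_split/= -!mulr_sumr lerD2l -mulrA ler_wpM2l//.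
apply: (@le_trans _ _ (expR 2 * \sum_(1 <= m < Mm) sqmod (p m - b m) * npow m (2 * rho))).
  rewrite mulr_sumr; case: Mm rM h2 => [|[|Mm]] rM h2.
  - by rewrite !big_geq.
  - by rewrite !big_geq.
  rewrite [leRHS]big_ltn//= ler_wpDl//.
    by rewrite mulr_ge0 ?expR_ge0// mulr_ge0 ?sqmod_ge0 ?npow_ge0.
  rewrite big_nat [leRHS]big_nat; apply: ler_sum => m /andP[m2 mM].
  rewrite mulrCA ler_peMr ?sqmod_ge0// /npow -expRD//.
  apply: le_trans (expR_ge1Dx _).
  have : rho * ln m%:R <= rho * ln Mm.+2%:R.
    rewrite ler_wpM2l ?(ltW r0)// ler_ln ?posrE ?ltr0n//; last exact: leq_trans m2.
    by rewrite ler_nat ltnW.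
  lra.
by rewrite ler_wpM2l ?expR_ge0// (le_trans (h2 Mm)).
Qed.

Lemma lower_riemann_sum (p : nat -> R[i]) N S (h rho : R) I Mm :
  supported S N p -> 0 < h -> 0 < rho -> rho * ln Mm%:R <= 1 ->
  h * (1 + ln Mm%:R) <= 2^-1 -> 2 < I%:R * (h * ln 2) ->
  expR (- 4) / 2 * \sum_(2 <= m < Mm) sqmod (p m) <=
  \sum_(i < I | rho <= i%:R * h) h * (i%:R * h) *
     \sum_(1 <= m < N.+1) sqmod (dcoef p m) * npow m (2 * (i%:R * h)).
Proof.
move=> sp h0 r0 rM hM hI.
pose T m : R := \sum_(i < I | rho <= i%:R * h) h * (i%:R * h) * ln m%:R ^+ 2 *
  expR (- (2 * (i%:R * h) * ln m%:R)).
have T0 m : 0 <= T m.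
  apply: sumr_ge0 => i _; apply: mulr_ge0 (expR_ge0 _).
  by apply: mulr_ge0 (sqr_ge0 _); rewrite !mulr_ge0// ltW.
have -> : \sum_(i < I | rho <= i%:R * h) h * (i%:R * h) *
    (\sum_(1 <= m < N.+1) sqmod (dcoef p m) * npow m (2 * (i%:R * h))) =
   \sum_(1 <= m < N.+1) sqmod (p m) * T m.
  under eq_bigr do rewrite mulr_sumr.
  rewrite exchange_big/=; apply: eq_bigr => m _; rewrite mulr_sumr.
  by apply: eq_bigr => i _; rewrite sqmod_dcoef /npow; ring.
have f0 m : 0 <= sqmod (p m) * T m by rewrite mulr_ge0 ?sqmod_ge0.
have -> : \sum_(1 <= m < N.+1) sqmod (p m) * T m =
    \sum_(1 <= m < (maxn N Mm).+1) sqmod (p m) * T m.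
  rewrite [RHS](@big_cat_nat _ _ _ N.+1)//=; last by rewrite ltnS leq_maxl.
  rewrite [X in _ = _ + X]big1_seq ?addr0// => m /andP[_].
  rewrite mem_index_iota => /andP[Nm _]; rewrite (supported0 sp) ?sqmod0 ?mul0r//.
  by move=> [_ /andP[_]]; rewrite leqNgt Nm.
rewrite mulr_sumr.
apply: (@le_trans _ _ (\sum_(2 <= m < Mm) sqmod (p m) * T m)); last first.
  case: (ltnP 1 Mm) => [M2|M1]; last first.
    by rewrite big_geq ?(leqW M1)// sumr_ge0.
  rewrite [leRHS](@big_cat_nat _ _ _ 2)//=; last by rewrite ltnW// ltnS (leq_trans M2)// leq_maxr.
  rewrite ler_wpDl ?sumr_ge0// [leRHS](@big_cat_nat _ _ _ Mm)//=; last first.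
    by rewrite leqW// leq_maxr.
  by rewrite lerDl sumr_ge0.
rewrite big_nat [leRHS]big_nat; apply: ler_sum => m /andP[m2 mM].
rewrite mulrC ler_wpM2l ?sqmod_ge0//.
have m0 : (0 < m)%N by exact: leq_trans m2.
have lm : ln m%:R <= ln Mm%:R :> R.
  rewrite ler_ln ?posrE ?ltr0n// ?ler_nat; first exact: ltnW.
  exact: leq_trans mM.
have l2 : 0 < ln 2%:R :> R by rewrite ln_gt0// ltr1n.
have l2m : ln 2%:R <= ln m%:R :> R.
  by rewrite ler_ln ?posrE ?ltr0n// ler_nat.
apply: riemann_lower => //.
- exact: lt_le_trans l2m.
- by apply: le_trans hM; rewrite ler_wpM2l ?(ltW h0)//; lra.
- by apply: le_trans rM; rewrite ler_wpM2l ?(ltW r0).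
- by apply: (lt_le_trans hI); rewrite ler_wpM2l// ler_wpM2l ?(ltW h0).
Qed.

Lemma upper_riemann_sum (a : nat -> R[i]) N (c0 P : nat) (h eps kappa : R) :
  (0 < c0)%N -> 0 < h -> 0 <= eps ->
  \sum_(p < P) h * area_weight c0 eps kappa (p%:R * h) *
    (2 * \sum_(1 <= n < N.+1) sqmod (dcoef a n) * npow n (2 * (p%:R * h))) <=
  16 * \sum_(1 <= n < N.+1) sqmod (a n) * (eps + npow n kappa).
Proof.
move=> c00 h0 e0.
have c01 : 1 <= c0%:R :> R by rewrite ler1n.
have c0i : (c0%:R : R)^-1 <= 1 by rewrite invf_le1// (lt_le_trans ltr01).
have c0i0 : 0 <= (c0%:R : R)^-1 by rewrite invr_ge0.
have -> : \sum_(p < P) h * area_weight c0 eps kappa (p%:R * h) *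
    (2 * \sum_(1 <= n < N.+1) sqmod (dcoef a n) * npow n (2 * (p%:R * h))) =
  \sum_(1 <= n < N.+1) sqmod (a n) *
   (4 * eps * (\sum_(p < P) h * (p%:R * h) * ln n%:R ^+ 2 *
      expR (- (2 * (p%:R * h) * ln n%:R))) +
    4 / c0%:R * (\sum_(p < P) ((kappa <= p%:R * h)%R : nat)%:R *
      (h * (p%:R * h) * ln n%:R ^+ 2 * expR (- (2 * (p%:R * h) * ln n%:R))))).
  under eq_bigr do rewrite 2!mulr_sumr.
  rewrite exchange_big/=; apply: eq_bigr => n _.
  rewrite !mulr_sumr -big_split/= mulr_sumr; apply: eq_bigr => p _.
  by rewrite sqmod_dcoef /area_weight /npow; ring.
rewrite mulr_sumr; apply: ler_sum => n _; rewrite [leRHS]mulrCA.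
rewrite ler_wpM2l ?sqmod_ge0//.
have t0 := lnn_ge0 R n.
have u1 := riemann_upper P (ltW h0) t0.
have u2 := riemann_upper_tail kappa P (ltW h0) t0.
have v1 : 4 * eps * (\sum_(p < P) h * (p%:R * h) * ln n%:R ^+ 2 *
      expR (- (2 * (p%:R * h) * ln n%:R))) <= 4 * eps * 1.
  by rewrite ler_wpM2l// mulr_ge0.
have v2 : 4 / c0%:R * (\sum_(p < P) ((kappa <= p%:R * h)%R : nat)%:R *
      (h * (p%:R * h) * ln n%:R ^+ 2 * expR (- (2 * (p%:R * h) * ln n%:R)))) <=
   4 * (4 * npow n kappa).
  apply: ler_pM => //.
    apply: sumr_ge0 => p _; apply: mulr_ge0 => //; apply: mulr_ge0 (expR_ge0 _).
    by apply: mulr_ge0 (sqr_ge0 _); rewrite !mulr_ge0// ltW.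
  by rewrite ler_piMr.
apply: (le_trans (lerD v1 v2)); have := npow_ge0 n kappa; lra.
Qed.

End GridSums.

Section LittlewoodPaley.
Variable R : realType.
Implicit Types (s z w : R[i]).

Lemma exists_mesh (N N0 Mm : nat) (rho x1 x2 x3 : R) :
  0 < rho <= 1 -> 0 <= x1 -> 0 <= x2 -> 0 <= x3 -> forall t e : R, 0 < t -> 0 < e ->
  exists2 h : R, 0 < h <= rho & [/\ h * ln N%:R <= 1,
    forall k, 0 < k <= h -> k * ln N0%:R <= 1, h * (1 + ln Mm%:R) <= 2^-1 &
    [/\ x1 * h <= rho, x2 * h <= t & x3 * h <= e]].
Proof.
move=> /andP[r0 r1] x10 x20 x30 t e t0 e0.
have [a a0 ha] := exists_step R N; have [b b0 hb] := exists_step R N0.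
have [c c0 hc] := exists_step R Mm.
have aux (x y : R) : 0 <= x -> 0 < y -> exists2 d, 0 < d & forall k, 0 < k <= d -> x * k <= y.
  move=> x0 y0; exists (y / (1 + x)); first by rewrite divr_gt0// ltr_pwDl.
  move=> k /andP[k0 kd]; apply: (@le_trans _ _ ((1 + x) * k)).
    by rewrite ler_wpM2r ?(ltW k0)// lerDr.
  by rewrite mulrC -ler_pdivlMr// ltr_pwDl.
have [d1 d10 h1] := aux _ _ x10 r0; have [d2 d20 h2] := aux _ _ x20 t0.
have [d3 d30 h3] := aux _ _ x30 e0.
have l0 : 0 <= 1 + ln Mm%:R :> R by rewrite addr_ge0 ?lnn_ge0.
have [d4 d40 h4] := aux _ _ l0 (divr_gt0 (ltr01 : 0 < 1 :> R) (ltr0Sn R 1)).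
pose h := Num.min (Num.min (Num.min rho a) (Num.min b d1)) (Num.min (Num.min d2 d3) d4).
have h0 : 0 < h by rewrite !lt_min r0 a0 b0 d10 d20 d30 d40.
have : h <= h by []; rewrite {2}/h !le_min => /andP[/andP[/andP[hr hha] /andP[hhb hd1]]].
move=> /andP[/andP[hd2 hd3] hd4].
exists h; first by rewrite h0.
split.
- by apply: ha; rewrite h0.
- by move=> k /andP[k0 kh]; apply: hb; rewrite k0 (le_trans kh).
- by rewrite mulrC; have := h4 h; rewrite h0 hd4 div1r; exact.
- by split; [apply: h1|apply: h2|apply: h3]; rewrite h0.
Qed.

(** Littlewood-Paley bound for a composition: the squared coefficients of
    f(Phi) are recovered from the mean values of its derivative on a fine grid,
    and the area estimate turns them into mean values of f'. The weight
    [eps + n^(-kappa)] records that near the boundary Re s is at most eps times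
    Re Phi(s), while away from it Re Phi is at least kappa, where high frequencies
    are damped. *)
Lemma key_estimate c0 k M Phi Phi' (delta eps : R) (a : nat -> R[i]) N0 S
    (F F' : R[i] -> R[i]) b Mm :
  tame_map c0 k M Phi Phi' -> 0 < delta -> 0 <= eps ->
  (forall s, 0 < Re s < delta -> Re s <= eps * Re (Phi s)) ->
  coefs_of S F F' b ->
  (forall s, 0 < Re s ->
     F' s = dpsum (dcoef a) N0 (Phi s) * Phi' s) ->
  \sum_(2 <= m < Mm) sqmod (b m) <=
  4 * expR 4 * (2 * (288 * c0%:R * k%:R * 16)) *
    \sum_(1 <= n < N0.+1) sqmod (a n) * (eps + npow n (c0%:R * delta / 2)).
Proof.
move=> tm d0 ep0 heps hb hF'.
set A := \sum_(1 <= n < N0.+1) _; set kappa := c0%:R * delta / 2 in A *.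
have c01 : 1 <= c0%:R :> R by rewrite ler1n; exact: tame_c0 tm.
(* for m < Mm, the abscissas sigma with sigma ln m >= 1 are at least rho *)
pose rho : R := (1 + ln Mm%:R)^-1.
have lM0 : 0 <= ln Mm%:R :> R by exact: lnn_ge0.
have r0 : 0 < rho by rewrite invr_gt0 ltr_pwDl.
have r1 : rho <= 1 by rewrite invf_le1 ?ltr_pwDl// lerDl.
have rM : rho * ln Mm%:R <= 1.
  by rewrite /rho mulrC ler_pdivrMr ?ltr_pwDl// mul1r lerDr.
have r20 : 0 < rho / 2 by rewrite divr_gt0.
have [B B0 tP] := tame_taylor tm r20.
have [D D0 hD] := tame_bound tm r20.
have [L L0 hL] := dpsum_lipschitz (dcoef a) N0.
have [K K0 hK] : exists2 K : R, 0 <= K & forall s, 0 <= Re s ->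
    normc (dpsum (dcoef a) N0 s) <= K.
  exists (\sum_(1 <= n < N0.+1) normc (dcoef a n)).
    by apply: sumr_ge0 => n _; exact: normc_ge0.
  move=> s s0; apply: (le_trans (normc_sum _ _ _)); apply: ler_sum => n _.
  by rewrite normcM normc_natpowN ler_piMr ?normc_ge0// npow_le1.
pose ln2 : R := ln 2%:R; have ln20 : 0 < ln2 by rewrite ln_gt0// ltr1n.
(* the lower bound for the index m uses abscissas sigma with sigma ln m <= 2,
   and m >= 2 *)
pose L1 : R := 2 / ln2 + 1; have L10 : 0 <= L1 by rewrite addr_ge0// divr_ge0// ltW.
pose V : R := c0%:R * L1 + D + 2.
have V0 : 0 <= V by rewrite !addr_ge0// mulr_ge0.
(* all errors together are at most E times the accuracy e of the
   approximations *)
pose E : R := 4 * expR 4 * (2 * (L1 ^+ 2 * K ^+ 2 + 288 * c0%:R * k%:R *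
   (8 * (V + 1) ^+ 2 * (eps + 1))) + 3 * L1 ^+ 2) + 2 * expR 2.
have E0 : 0 <= E.
  rewrite /E; apply: addr_ge0; last by rewrite mulr_ge0 ?expR_ge0.
  apply: mulr_ge0; first by rewrite mulr_ge0 ?expR_ge0.
  apply: addr_ge0; last by apply: mulr_ge0 (sqr_ge0 _).
  apply: mulr_ge0 => //; apply: addr_ge0; first exact: mulr_ge0 (sqr_ge0 _) (sqr_ge0 _).
  apply: mulr_ge0; first by rewrite !mulr_ge0.
  by apply: mulr_ge0; [apply: mulr_ge0 (sqr_ge0 _)|rewrite addr_ge0].
suff slack e : 0 < e -> e <= 1 -> \sum_(2 <= m < Mm) sqmod (b m) <=
    4 * expR 4 * (2 * (288 * c0%:R * k%:R * 16)) * A + e * E.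
  apply: (le_of_slack E0) => e e0; have [e1|e1] := leP e 1; first exact: slack.
  have h1 : 0 < 1 :> R by [].
  apply: (le_trans (slack 1 h1 (lexx _))).
  by rewrite lerD2l ler_wpM2r// ltW.
move=> e0 e1.
have e01 : 0 < e <= 1 by rewrite e0.
have ee : e ^+ 2 <= e by rewrite expr2 ler_piMr// ltW.
have [p [N [sp hp hbp]]] := coefs_near hb r0 rM e01.
have r01 : 0 < rho <= 1 by rewrite r0.
have xB : 0 <= 8 * B by rewrite mulr_ge0.
have [h /andP[h0 hr] [hN hN0 hM [hD1 hB1 hL1]]] :=
  exists_mesh N N0 Mm r01 D0 xB (mulr_ge0 L0 D0) e0 e0.
have h1 : h <= 1 by exact: le_trans r1.
(* mesh of the target grid when the threshold under which the derivative is
   considered too small is e *)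
pose h' := e * h / 12.
have h'0 : 0 < h' by rewrite divr_gt0 ?mulr_gt0.
have h'h : h' <= h.
  rewrite /h' ler_pdivrMr//; apply: (@le_trans _ _ (1 * h)); first by rewrite ler_pM2r.
  rewrite mulrC ler_pM2l//; lra.
have h'1 : h' <= 1 by exact: le_trans h1.
pose I := (Num.truncn (2 / (h * ln2))).+1.
have hI : 2 < I%:R * (h * ln2).
  by rewrite -ltr_pdivrMr ?mulr_gt0// truncnS_gt.
have IL : I%:R * h <= L1.
  have q0 : 0 <= 2 / (h * ln2) by rewrite divr_ge0// mulr_ge0// ltW.
  have /andP[q1 _] := truncn_itv q0.
  rewrite /I -natr1 mulrDl mul1r lerD// -ler_pdivlMr//.
  by apply: (le_trans q1); apply: le_of_eq; field;
    rewrite !gt_eqF.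
pose P := (Num.truncn (V / h')).+1.
have VP : V < P%:R * h' by rewrite -ltr_pdivrMr// truncnS_gt.
have PV : P%:R * h' <= V + 1.
  have q0 : 0 <= V / h' by rewrite divr_ge0// ltW.
  have /andP[q1 _] := truncn_itv q0.
  by rewrite /P -natr1 mulrDl mul1r lerD// -ler_pdivlMr.
(* The heights J and Q are large enough for the mean values to be accurate. That
   Im Phi stays within M of c0 Im s allows Q h' to be at most 2 c0 J h, so that
   heights cancel in the end. *)
have [J1 hJ1] := mean_value_grid (dcoef p) (fun i => (i%:R * h +i* 0)%C) I h0 hN e0.
have h'N0 : h' * ln N0%:R <= 1 by apply: hN0; rewrite h'0.
have [J2 hJ2] := mean_value_grid (dcoef a) (fun i => (i%:R * h' +i* - (M + 1))%C) P h'0 h'N0 e0.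
pose M0 : R := `|2 * M + 3|; have M00 : 0 <= M0 by exact: normr_ge0.
have [J3 hJ3] := @exists_le_natM R (fun=> M0 + 1) 1 h h0.
pose J := maxn (maxn J1 J2) (maxn J3 1).
have J0 : (0 < J)%N by rewrite /J !leq_max /= !orbT.
have J1J : (J1 <= J)%N by rewrite /J !leq_max leqnn.
have J2J : (J2 <= J)%N by rewrite /J !leq_max leqnn orbT.
have J3J : (J3 <= J)%N by rewrite /J !leq_max leqnn !orbT.
clearbody J.
have Jp : 0 < J%:R :> R by rewrite ltr0n.
have JM : M0 + 1 <= J%:R * h by exact: (hJ3 J J3J 0%N).
pose Q := (Num.truncn ((c0%:R * (J%:R * h) + M0) / h')).+1.
have Jh0 : 0 < J%:R * h by rewrite mulr_gt0.
have q0 : 0 <= c0%:R * (J%:R * h) + M0 by rewrite addr_ge0// mulr_ge0// ltW.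
have QM : c0%:R * (J%:R * h) + M0 < Q%:R * h' by rewrite -ltr_pdivrMr// truncnS_gt.
have cJ : J%:R * h <= c0%:R * (J%:R * h) by rewrite ler_peMl// ltW.
have Q2 : Q%:R * h' <= 2 * (c0%:R * (J%:R * h)).
  have /andP[q1 _] := truncn_itv (divr_ge0 q0 (ltW h'0)).
  have : Q%:R * h' <= c0%:R * (J%:R * h) + M0 + 1.
    by rewrite /Q -natr1 mulrDl mul1r lerD// -ler_pdivlMr.
  lra.
have QJ : (J <= Q)%N.
  rewrite -(ler_nat R) -(ler_pM2r h0); apply: (@le_trans _ _ (Q%:R * h')); first lra.
  by rewrite ler_wpM2l.
pose sg i j := vstep (i%:R * h +i* 0)%C h j.
pose vg q r := vstep (q%:R * h' +i* - (M + 1))%C h' r.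
pose f' := dpsum (dcoef a) N0.
have Resg i j : Re (sg i j) = i%:R * h by rewrite /sg Re_vstep.
have area := @area_estimate R c0 k M Phi Phi' f' rho D B L K e h e delta eps I J P Q
  tm r01 tP B0 (fun s sr => (hD s sr).2) e0 (introT andP (conj h0 hr)) hD1 hB1 hL L0 hK
  (ltW e0) hL1 d0 ep0 heps.
have {}area := area _ _; rewrite -/h' in area.
pose MS : R := \sum_(i < I | rho <= i%:R * h) \sum_(j < J) h * (i%:R * h) * sqmod (F' (sg i j)).
have Ih i : (i < I)%N -> i%:R * h <= L1.
  by move=> iI; apply: le_trans IL; rewrite ler_wpM2r ?(ltW h0)// ler_nat ltnW.
have areaMS : h * MS <= \sum_(i < I) \sum_(j < J) (i%:R * h) * K ^+ 2 * e ^+ 2 * h ^+ 2 +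
  144 * h' ^+ 2 * k%:R * \sum_(q < P) \sum_(r < Q) area_weight c0 eps kappa (q%:R * h') *
     (2 * sqmod (f' (vg q r)) + 2 * e ^+ 2).
  apply: le_trans (area _ _).
  - rewrite /MS mulr_sumr; apply: le_of_eq.
    apply: eq_bigr => i ri; rewrite mulr_sumr; apply: eq_bigr => j _.
    rewrite -/(sg i j) hF' ?Resg; last by lra.
    by rewrite /f'; ring.
  - move=> i j iI jJ ri; apply: le_lt_trans VP; rewrite -/(sg i j).
    have [|xb _] := hD (sg i j); first by rewrite Resg; lra.
    rewrite Resg in xb; have : c0%:R * (i%:R * h) <= c0%:R * L1 by rewrite ler_wpM2l// Ih.
    by rewrite /V; lra.
  - apply: le_lt_trans QM; have : 2 * M + 3 <= M0 by exact: ler_norm.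
    lra.
clear area; clearbody P Q; clearbody h'.
pose AP (q : nat) : R := \sum_(1 <= n < N0.+1) sqmod (dcoef a n) * npow n (2 * (q%:R * h')).
have vbound : \sum_(q < P) \sum_(r < Q) area_weight c0 eps kappa (q%:R * h') *
     (2 * sqmod (f' (vg q r)) + 2 * e ^+ 2) <=
   Q%:R * \sum_(q < P) area_weight c0 eps kappa (q%:R * h') * (2 * AP q + 4 * e).
  rewrite mulr_sumr; apply: ler_sum => q _.
  rewrite -mulr_sumr [leRHS]mulrCA ler_wpM2l//.
    by rewrite !mulr_ge0 ?(ltW h'0)// addr_ge0// divr_ge0.
  rewrite big_split/= -mulr_sumr sumr_const card_ord -[_ *+ Q]mulr_natl.
  have /ler_normlP[_ +] := hJ2 Q (leq_trans J2J QJ) q (ltn_ord q).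
  rewrite [Re _]/= -/(AP q) -/f' => mv.
  have : \sum_(j < Q) sqmod (f' (vg q j)) - Q%:R * AP q <= Q%:R * e by exact: mv.
  have : Q%:R * (2 * e ^+ 2) <= Q%:R * (2 * e) by rewrite ler_wpM2l// ler_wpM2l.
  have -> : Q%:R * (2 * AP q + 4 * e) = 2 * (Q%:R * AP q) + 2 * (Q%:R * e) + Q%:R * (2 * e).
    by ring.
  lra.
have wbound : \sum_(q < P) h' * (area_weight c0 eps kappa (q%:R * h') * (2 * AP q + 4 * e)) <=
   16 * A + 8 * (V + 1) ^+ 2 * (eps + 1) * e.
  have := upper_riemann_sum a N0 P kappa (tame_c0 tm) h'0 ep0; rewrite -/A => up.
  have low : \sum_(q < P) h' * area_weight c0 eps kappa (q%:R * h') * (4 * e) <=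
     8 * (V + 1) ^+ 2 * (eps + 1) * e.
    apply: (@le_trans _ _ (\sum_(q < P) h' * (2 * (V + 1) * (eps + 1)) * (4 * e))).
      apply: ler_sum => q _; rewrite ler_wpM2r ?mulr_ge0 ?(ltW e0)//.
      rewrite ler_wpM2l ?(ltW h'0)// /area_weight ler_pM//.
      - by rewrite !mulr_ge0// ltW.
      - by rewrite addr_ge0// divr_ge0.
      - rewrite ler_wpM2l//; apply: le_trans PV.
        by rewrite ler_wpM2r ?(ltW h'0)// ler_nat ltnW.
      - rewrite lerD2l ler_pdivrMr ?(lt_le_trans ltr01)// mul1r.
        by apply: le_trans c01; case: (kappa <= _).
    rewrite sumr_const card_ord -[_ *+ P]mulr_natl.
    have -> : P%:R * (h' * (2 * (V + 1) * (eps + 1)) * (4 * e)) =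
      (P%:R * h') * (8 * (V + 1) * (eps + 1) * e) by ring.
    have -> : 8 * (V + 1) ^+ 2 * (eps + 1) * e =
      (V + 1) * (8 * (V + 1) * (eps + 1) * e) by ring.
    rewrite ler_wpM2r//; apply: mulr_ge0 (ltW e0).
    by apply: mulr_ge0; [apply: mulr_ge0 => //|]; rewrite addr_ge0.
  apply: le_trans (lerD up low); rewrite -big_split/=; apply: le_of_eq.
  by apply: eq_bigr => q _; rewrite /AP; ring.
have bad : \sum_(i < I) \sum_(j < J) (i%:R * h) * K ^+ 2 * e ^+ 2 * h ^+ 2 <=
   J%:R * h * (L1 ^+ 2 * K ^+ 2 * e).
  apply: (@le_trans _ _ (\sum_(i < I) \sum_(j < J) L1 * K ^+ 2 * e * h ^+ 2)).
    apply: ler_sum => i _; apply: ler_sum => j _; rewrite ler_wpM2r ?sqr_ge0//.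
    apply: ler_pM; rewrite ?sqr_ge0//.
      by apply: mulr_ge0 (sqr_ge0 _); rewrite mulr_ge0 ?(ltW h0).
    by rewrite ler_wpM2r ?sqr_ge0// Ih.
  rewrite (eq_bigr (fun=> J%:R * (L1 * K ^+ 2 * e * h ^+ 2))); last first.
    by move=> i _; rewrite sumr_const card_ord mulr_natl.
  rewrite sumr_const card_ord -[_ *+ I]mulr_natl.
  have -> : I%:R * (J%:R * (L1 * K ^+ 2 * e * h ^+ 2)) =
    (I%:R * h) * (J%:R * h * (L1 * K ^+ 2 * e)) by ring.
  have -> : J%:R * h * (L1 ^+ 2 * K ^+ 2 * e) = L1 * (J%:R * h * (L1 * K ^+ 2 * e)) by ring.
  rewrite ler_wpM2r//; apply: mulr_ge0; first exact: ltW.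
  by apply: mulr_ge0 (ltW e0); apply: mulr_ge0 (sqr_ge0 _).
(* bound for MS per point of a vertical line of the source grid *)
pose W := L1 ^+ 2 * K ^+ 2 * e +
  288 * c0%:R * k%:R * (16 * A + 8 * (V + 1) ^+ 2 * (eps + 1) * e).
have W2 : 0 <= 16 * A + 8 * (V + 1) ^+ 2 * (eps + 1) * e.
  apply: le_trans wbound; apply: sumr_ge0 => q _; apply: mulr_ge0 (ltW h'0) _.
  apply: mulr_ge0.
    by rewrite !mulr_ge0 ?(ltW h'0)// addr_ge0// divr_ge0.
  apply: addr_ge0; last by rewrite mulr_ge0// ltW.
  apply: mulr_ge0 => //; apply: sumr_ge0 => n _.
  by rewrite mulr_ge0 ?sqmod_ge0 ?npow_ge0.
have MSW : MS <= J%:R * W.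
  rewrite -(ler_pM2l h0); apply: (le_trans areaMS).
  have -> : h * (J%:R * W) = J%:R * h * (L1 ^+ 2 * K ^+ 2 * e) + 
     144 * k%:R * (2 * (c0%:R * (J%:R * h))) *
      (16 * A + 8 * (V + 1) ^+ 2 * (eps + 1) * e) by rewrite /W; ring.
  apply: lerD => //.
  apply: (le_trans (ler_wpM2l _ vbound)).
    by apply: mulr_ge0 => //; apply: mulr_ge0 (sqr_ge0 _).
  have -> : 144 * h' ^+ 2 * k%:R * (Q%:R * \sum_(q < P)
      area_weight c0 eps kappa (q%:R * h') * (2 * AP q + 4 * e)) =
    144 * k%:R * (Q%:R * h') * (\sum_(q < P) h' *
      (area_weight c0 eps kappa (q%:R * h') * (2 * AP q + 4 * e))).
    by rewrite -mulr_sumr; ring.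
  apply: (@le_trans _ _ (144 * k%:R * (Q%:R * h') *
     (16 * A + 8 * (V + 1) ^+ 2 * (eps + 1) * e))).
    by rewrite ler_wpM2l// !mulr_ge0// ltW.
  by rewrite ler_wpM2r// ler_wpM2l ?mulr_ge0.
pose SI (i : nat) : R := \sum_(1 <= m < N.+1) sqmod (dcoef p m) * npow m (2 * (i%:R * h)).
have SIb (i : 'I_I) : rho <= i%:R * h ->
    J%:R * SI i <= 2 * (\sum_(j < J) sqmod (F' (sg i j))) + J%:R * (3 * e).
  move=> ri.
  have /ler_normlP[+ _] := hJ1 J J1J i (ltn_ord i).
  rewrite [Re _]/= -/(SI i) => mv.
  have : \sum_(j < J) sqmod (dpsum (dcoef p) N (sg i j)) <=
     2 * (\sum_(j < J) sqmod (F' (sg i j))) + J%:R * (2 * e).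
    apply: (@le_trans _ _ (\sum_(j < J) (2 * sqmod (F' (sg i j)) + 2 * e))).
      by apply: ler_sum => j _; apply: hp; rewrite Resg.
    by rewrite big_split/= -mulr_sumr sumr_const card_ord -[_ *+ J]mulr_natl.
  rewrite -/(sg i) in mv *; move: mv; set X := \sum_(j < J) _; set X2 := \sum_(j < J) _.
  have -> : J%:R * (3 * e) = J%:R * (2 * e) + J%:R * e by ring.
  lra.
have hiL : \sum_(i < I | rho <= i%:R * h) h * (i%:R * h) <= L1 ^+ 2.
  apply: (@le_trans _ _ (\sum_(i < I) h * L1)).
    rewrite big_mkcond/=; apply: ler_sum => i _; case: ifP => _.
      by rewrite ler_wpM2l ?(ltW h0)// Ih.
    by rewrite mulr_ge0 ?(ltW h0).
  by rewrite sumr_const card_ord -[_ *+ I]mulr_natl mulrA expr2 ler_wpM2r.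
have low := lower_riemann_sum sp h0 r0 rM hM hI.
have low2 : J%:R * (expR (- 4) / 2 * \sum_(2 <= m < Mm) sqmod (p m)) <=
    J%:R * (2 * W + 3 * e * L1 ^+ 2).
  apply: (le_trans (ler_wpM2l (ltW Jp) low)).
  rewrite mulr_sumr.
  apply: (@le_trans _ _ (\sum_(i < I | rho <= i%:R * h) (h * (i%:R * h) *
     (2 * (\sum_(j < J) sqmod (F' (sg i j))) + J%:R * (3 * e))))).
    apply: ler_sum => i ri; rewrite mulrCA ler_wpM2l ?SIb//.
    by rewrite !mulr_ge0// ltW.
  have -> : \sum_(i < I | rho <= i%:R * h) (h * (i%:R * h) *
     (2 * (\sum_(j < J) sqmod (F' (sg i j))) + J%:R * (3 * e))) =
     2 * MS + J%:R * (3 * e) * (\sum_(i < I | rho <= i%:R * h) h * (i%:R * h)).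
    rewrite /MS !mulr_sumr -big_split/=; apply: eq_bigr => i _.
    by rewrite -mulr_sumr; ring.
  have -> : J%:R * (2 * W + 3 * e * L1 ^+ 2) = 2 * (J%:R * W) + J%:R * (3 * e) * L1 ^+ 2 by ring.
  by apply: lerD; rewrite ler_wpM2l// !mulr_ge0// ltW.
rewrite ler_pM2l// in low2.
apply: (le_trans hbp).
have e44 : expR 4 * expR (- 4) = 1 :> R by rewrite expRxMexpNx_1.
have -> : \sum_(2 <= m < Mm) sqmod (p m) = 2 * expR 4 *
   (expR (- 4) / 2 * \sum_(2 <= m < Mm) sqmod (p m)).
  have -> : forall x y z : R, 2 * x * (y / 2 * z) = (x * y) * z by move=> *; field.
  by rewrite e44 mul1r.
have -> : 4 * expR 4 * (2 * (288 * c0%:R * k%:R * 16)) * A + e * E =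
  2 * (2 * expR 4 * (2 * W + 3 * e * L1 ^+ 2)) + 2 * expR 2 * e by rewrite /E /W; ring.
by rewrite lerD2r ler_wpM2l// ler_wpM2l// mulr_ge0 ?expR_ge0.
Qed.

End LittlewoodPaley.

(** * Composition with the symbol *)

Section CoefficientsLinear.
Variable R : realType.
Implicit Types (s z w : R[i]) (S : set nat).

Lemma coefs_ofS S S' (F F' : R[i] -> R[i]) b : S `<=` S' ->
  coefs_of S F F' b -> coefs_of S' F F' b.
Proof.
move=> SS [hb h]; split=> [n /hb[Sn n0]|rho e r0 e0]; first by split => //; exact: SS.
have [p [N [sp h1 h2 h3]]] := h _ _ r0 e0; exists p, N; split => // n /sp[Sn nN].
by split => //; exact: SS.
Qed.

Lemma dpoly_limit_ext S (F F' G G' : R[i] -> R[i]) :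
  (forall s, 0 < Re s -> F s = G s) ->
  (forall s, 0 < Re s -> F' s = G' s) ->
  dpoly_limit S F F' -> dpoly_limit S G G'.
Proof.
move=> FG FG' h rho e r0 e0; have [P [P' [hP h1]]] := h _ _ r0 e0.
exists P, P'; split => // s sr; rewrite -FG ?(lt_le_trans r0)// -FG' ?(lt_le_trans r0)//.
exact: h1.
Qed.

Lemma coefs_of0 S : coefs_of S (fun=> 0 : R[i]) (fun=> 0) (fun=> 0).
Proof.
split => [n|rho e r0 e0]; first by rewrite eqxx.
exists (fun=> 0), 0%N; split => [n|s _|s _|M]; rewrite ?eqxx//.
- by rewrite /dpsum big_geq// subrr normc_zero ltW.
- by rewrite /dpsum big_geq// subrr normc_zero ltW.
- by rewrite big1 ?sqr_ge0// => n _; rewrite subrr sqmod0 mul0r.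
Qed.

Lemma supportedD S N M (p q : nat -> R[i]) : supported S N p -> supported S M q ->
  supported S (maxn N M) (fun n => p n + q n).
Proof.
move=> sp sq n; have [p0|p0 _] := eqVneq (p n) 0; last first.
  by have [? /andP[-> h]] := sp _ p0; split => //=; rewrite leq_max h.
rewrite p0 add0r => /sq[? /andP[-> h]].
by split => //=; rewrite leq_max h orbT.
Qed.

Lemma dpsumD (p q : nat -> R[i]) N s : dpsum (fun n => p n + q n) N s =
  dpsum p N s + dpsum q N s.
Proof.
by rewrite /dpsum -big_split; apply: eq_bigr => n _; rewrite mulrDl.
Qed.

Lemma dpsumZ (k : R[i]) (p : nat -> R[i]) N s :
  dpsum (fun n => k * p n) N s = k * dpsum p N s.
Proof.
by rewrite /dpsum mulr_sumr; apply: eq_bigr => n _; rewrite mulrA.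
Qed.

Lemma coefs_ofD S (F F' G G' : R[i] -> R[i]) b d : coefs_of S F F' b ->
  coefs_of S G G' d ->
  coefs_of S (fun s => F s + G s) (fun s => F' s + G' s) (fun n => b n + d n).
Proof.
move=> [hb h] [hd h']; split=> [n|rho e r0 e0].
  have [b0|b0 _] := eqVneq (b n) 0; last exact: hb.
  by rewrite b0 add0r; exact: hd.
have e20 : 0 < e / 2 by rewrite divr_gt0.
have [p [N [sp h1 h2 h3]]] := h _ _ r0 e20.
have [q [M [sq g1 g2 g3]]] := h' _ _ r0 e20.
exists (fun n => p n + q n), (maxn N M); split => [|s sr|s sr|K].
- exact: supportedD.
- rewrite dpsumD (dpsum_widen s sp (leq_maxl _ _)) (dpsum_widen s sq (leq_maxr _ _)).
  rewrite opprD addrACA; apply: (le_trans (normcD_le _ _)).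
  by rewrite (splitr e) lerD ?h1 ?g1.
- have -> : dpsum (dcoef (fun n => p n + q n)) (maxn N M) s =
     dpsum (dcoef p) (maxn N M) s + dpsum (dcoef q) (maxn N M) s.
    by rewrite -dpsumD; apply: eq_bigr => n _; rewrite /dcoef; ring.
  rewrite (dpsum_widen s (supported_dcoef sp) (leq_maxl _ _)).
  rewrite (dpsum_widen s (supported_dcoef sq) (leq_maxr _ _)).
  rewrite opprD addrACA; apply: (le_trans (normcD_le _ _)).
  by rewrite (splitr e) lerD ?h2 ?g2.
- apply: (@le_trans _ _ (\sum_(1 <= n < K) (2 * (sqmod (p n - b n) * npow n (2 * rho)) +
     2 * (sqmod (q n - d n) * npow n (2 * rho))))).
    apply: ler_sum => n _; rewrite opprD addrACA !mulrA -mulrDl.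
    by rewrite ler_wpM2r ?npow_ge0// sqmodD2.
  rewrite big_split/= -!mulr_sumr.
  have -> : e ^+ 2 = 2 * (e / 2) ^+ 2 + 2 * (e / 2) ^+ 2 by field.
  by rewrite lerD// ler_wpM2l.
Qed.

Lemma coefs_ofZ S (k : R[i]) (F F' : R[i] -> R[i]) b : coefs_of S F F' b ->
  coefs_of S (fun s => k * F s) (fun s => k * F' s) (fun n => k * b n).
Proof.
move=> [hb h]; split=> [n|rho e r0 e0].
  by rewrite mulf_eq0 negb_or => /andP[_]; exact: hb.
have k0 := normc_ge0 k; have k1 : 0 < 1 + normc k by rewrite ltr_pwDl.
have ke0 : 0 < e / (1 + normc k) by rewrite divr_gt0.
have kke : normc k * (e / (1 + normc k)) <= e.
  by rewrite mulrCA ler_piMr ?(ltW e0)// ler_pdivrMr// mul1r lerDr.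
have [p [N [sp h1 h2 h3]]] := h _ _ r0 ke0.
have est z : normc z <= e / (1 + normc k) -> normc (k * z) <= e.
  by move=> zb; rewrite normcM (le_trans _ kke)// ler_wpM2l.
exists (fun n => k * p n), N; split => [n|s sr|s sr|K].
- by rewrite mulf_eq0 negb_or => /andP[_]; exact: sp.
- by rewrite dpsumZ -mulrBr est ?h1.
- have -> : dpsum (dcoef (fun n => k * p n)) N s =
     dpsum (fun n => k * dcoef p n) N s.
    by apply: eq_bigr => n _; rewrite /dcoef; ring.
  by rewrite dpsumZ -mulrBr est ?h2.
- rewrite (eq_bigr (fun n => sqmod k * (sqmod (p n - b n) * npow n (2 * rho)))); last first.
    by move=> n _; rewrite -mulrBr sqmodM mulrA.
  rewrite -mulr_sumr -normcX2.
  apply: (@le_trans _ _ ((normc k * (e / (1 + normc k))) ^+ 2)).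
    by rewrite exprMn ler_wpM2l ?sqr_ge0.
  by rewrite lerXn2r ?nnegrE ?(mulr_ge0 k0 (ltW ke0)) ?(ltW e0).
Qed.

Lemma coefs_of_sum S (r : seq nat) (F F' : nat -> R[i] -> R[i]) (b : nat -> nat -> R[i]) :
  (forall n, n \in r -> coefs_of S (F n) (F' n) (b n)) ->
  coefs_of S (fun s => \sum_(n <- r) F n s) (fun s => \sum_(n <- r) F' n s)
    (fun m => \sum_(n <- r) b n m).
Proof.
elim: r => [_|n r IH h].
  have := @coefs_of0 S; congr coefs_of; apply/funext => s; by rewrite big_nil.
have h1 : coefs_of S (F n) (F' n) (b n) by apply: h; rewrite mem_head.
have {}IH := IH (fun m mr => h m (mem_behead (s := n :: r) mr)).
have := coefs_ofD h1 IH.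
by congr coefs_of; apply/funext => s; rewrite big_cons.
Qed.

End CoefficientsLinear.

Section SymbolComposition.
Variable R : realType.
Implicit Types (s z w : R[i]).

Lemma symbol_tame (c0 k l : nat) (M : R) Phi phi (c : nat -> R[i]) :
  c0_symbol c0 Phi phi c -> (forall n, (0 < n)%N -> c n != 0 -> smooth l n) ->
  (forall s, halfplane 0 s -> `|Im (phi s)| <= M) -> valent k Phi ->
  exists phi', dpoly_limit (smooth l) phi phi' /\
    tame_map c0 k M Phi (fun s => c0%:R + phi' s).
Proof.
move=> hP cS hIm hv.
have hc := symbol_abs_conv hP cS; have h1 := symbol_dseries_cvg hP.
have [phi' h2] := abs_conv_derivative hc; exists phi'.
have hl := dseries_dpoly_limit cS h1 h2; split => //.
have pos s : 0 < Re s -> 0 < Re (phi s).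
  by move=> s0; apply: (symbol_phi_maps hP); exists s.
have PE s : 0 < Re s -> Phi s = c0%:R * s + phi s by move=> s0; exact: (symbolE hP).
split => //.
- exact: symbol_c0_ge1 hP.
- by move=> s s0; rewrite PE// cReD Re_natM lerDl ltW// pos.
- by move=> s s0; rewrite PE// cImD Im_natM addrAC subrr add0r; exact: hIm.
- move=> rho r0; have [B B0 hB] := dpoly_limit_bounded hl r0.
  exists (c0%:R + B); first by rewrite addr_ge0.
  move=> s sr; have [b1 b2] := hB s sr; split.
    rewrite PE ?(lt_le_trans r0)// cReD Re_natM lerD2l.
    apply: (le_trans (ler_norm _)); apply: (le_trans (Re_le_normc _)).
    by apply: (le_trans b1); rewrite lerDr.
  by apply: (le_trans (normcD_le _ _)); rewrite normc_nat lerD2l.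
- move=> rho r0; have [B B0 hB] := dseries_taylor hc h1 h2 r0; exists B => //.
  move=> s s' s0 sr s'r s0r; rewrite !PE ?(lt_le_trans r0)//.
  have -> : c0%:R * s + phi s - (c0%:R * s' + phi s') - (c0%:R + phi' s0) * (s - s') =
    phi s - phi s' - phi' s0 * (s - s') by ring.
  exact: hB.
Qed.

(** The indices that occur in n^(-Phi) are the products of n^(c0) by a smooth
    integer. That they are at least n makes the composition operator
    triangular; that they are smooth for n smooth makes the composed series
    converge in the whole right half-plane. *)
Definition comp_support l n : set nat :=
  [set m | (n <= m)%N /\ (smooth l n -> smooth l m)].

Lemma natpow_symbol_limit (c0 l n : nat) Phi (phi phi' : R[i] -> R[i]) :
  (0 < c0)%N -> (0 < n)%N ->
  (forall s, 0 < Re s -> Phi s = c0%:R * s + phi s) ->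
  dpoly_limit (smooth l) phi phi' ->
  dpoly_limit (comp_support l n) (fun s => natpowN n (Phi s))
    (fun s => - (ln n%:R)%:C%C * natpowN n (Phi s) * (c0%:R + phi' s)).
Proof.
move=> c00 n0 PE hphi.
have h1 := dpoly_limit_exp (smooth1 l) (@smoothM l) (dpoly_limitZ (- (ln n%:R)%:C%C) hphi).
have nc0 : (0 < n ^ c0)%N by rewrite expn_gt0 n0.
have h2 := @dpoly_limit_mono R [set (n ^ c0)%N] (n ^ c0)%N 1 erefl nc0.
have SM (x y : nat) : [set (n ^ c0)%N] x -> smooth l y -> comp_support l n (x * y)%N.
  move=> -> hy; split.
    apply: (@leq_trans (n ^ c0)); first by rewrite -{1}[n]expn1 leq_pexp2l.
    by rewrite leq_pmulr//; case: hy.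
  by move=> hn; apply: smoothM => //; exact: smooth_expn.
apply: dpoly_limit_ext (dpoly_limitM SM h2 h1) => s s0.
  rewrite mul1r PE// natpowN_expn// natpowND; congr (_ * _).
  by rewrite /natpowN; congr cexp; ring.
have -> : natpowN n (Phi s) = natpowN (n ^ c0) s * cexp (- (ln n%:R)%:C%C * phi s).
  rewrite PE// natpowN_expn// natpowND; congr (_ * _).
  by rewrite /natpowN; congr cexp; ring.
rewrite natrX lnXn ?ltr0n// -[ln _ *+ c0]mulr_natl rmorphM /= -natrC; ring.
Qed.

(** One matrix b serves all index sets S: a large set for the norm estimates,
    the smooth integers for evaluations near the boundary. *)
Lemma composition_coefs (c0 l : nat) Phi (phi phi' : R[i] -> R[i]) :
  (0 < c0)%N -> (forall s, 0 < Re s -> Phi s = c0%:R * s + phi s) ->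
  dpoly_limit (smooth l) phi phi' ->
  exists b : nat -> nat -> R[i],
    (forall n m, b n m != 0 -> (0 < m)%N /\ (n <= m)%N) /\
    forall (S : set nat) (a : nat -> R[i]) N,
      (forall n, (0 < n <= N)%N -> a n != 0 -> comp_support l n `<=` S) ->
      coefs_of S (fun s => dpsum a N (Phi s))
        (fun s => dpsum (dcoef a) N (Phi s) * (c0%:R + phi' s))
        (fun m => \sum_(1 <= n < N.+1) a n * b n m).
Proof.
move=> c00 PE hphi.
have /choice[b hb] : forall n, exists b : nat -> R[i],
    (forall m, b m != 0 -> (0 < m)%N /\ (n <= m)%N) /\ ((0 < n)%N ->
    coefs_of (comp_support l n) (fun s => natpowN n (Phi s))
      (fun s => - (ln n%:R)%:C%C * natpowN n (Phi s) * (c0%:R + phi' s)) b).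
  move=> n; case: (posnP n) => [->|n0].
    by exists (fun=> 0); split => // m; rewrite eqxx.
  have [b hb] := dpoly_limit_coefs (natpow_symbol_limit c00 n0 PE hphi).
  by exists b; split => [m /hb.1[[]]|].
exists b; split => [n|S a N aS]; first by have [] := hb n.
have H n : n \in index_iota 1 N.+1 -> coefs_of S (fun s => a n * natpowN n (Phi s))
    (fun s => a n * (- (ln n%:R)%:C%C * natpowN n (Phi s) * (c0%:R + phi' s)))
    (fun m => a n * b n m).
  rewrite mem_index_iota ltnS => nN; have [a0|a0] := eqVneq (a n) 0.
    have := @coefs_of0 R S; rewrite a0.
    by congr coefs_of; apply/funext => s; rewrite mul0r.
  apply: coefs_ofZ; apply: coefs_ofS (aS n nN a0) _.
  by have [_] := hb n; apply; case/andP: nN.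
have := coefs_of_sum H; congr coefs_of; apply/funext => s.
rewrite /dpsum mulr_suml; apply: eq_bigr => n _.
by rewrite /dcoef; ring.
Qed.

End SymbolComposition.

(** * Triangular operators on square-summable coefficients *)

Section TriangularOperator.
Variable R : realType.
Implicit Types (s z w : R[i]) (f g : H2 R).

(** The sum is finite because the entries beyond the diagonal vanish. *)
Definition tri_coef (b : nat -> nat -> R[i]) (a : nat -> R[i]) m : R[i] :=
  \sum_(1 <= n < m.+1) a n * b n m.

Definition triangular (b : nat -> nat -> R[i]) :=
  forall n m, b n m != 0 -> (0 < m)%N /\ (n <= m)%N.

Lemma tri_coef_widen b a m X : triangular b -> (m <= X)%N ->
  tri_coef b a m = \sum_(1 <= n < X.+1) a n * b n m.
Proof.
move=> tb mX; rewrite [RHS](@big_cat_nat _ _ _ m.+1)//= [X in _ + X]big1_seq ?addr0//.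
move=> n /andP[_]; rewrite mem_index_iota => /andP[mn _].
have [->|/tb[_]] := eqVneq (b n m) 0; first by rewrite mulr0.
by rewrite leqNgt mn.
Qed.

Lemma tri_coef_poly b a m N : triangular b -> (forall n, (N < n)%N -> a n = 0) ->
  tri_coef b a m = \sum_(1 <= n < N.+1) a n * b n m.
Proof.
move=> tb aN; rewrite (tri_coef_widen a tb (leq_maxl m N)).
rewrite (@big_cat_nat _ _ _ N.+1)//=; last by rewrite ltnS leq_maxr.
rewrite [X in _ + X]big1_seq ?addr0// => n /andP[_].
by rewrite mem_index_iota => /andP[Nn _]; rewrite aN// mul0r.
Qed.

Lemma series_sqmodE (a : nat -> R[i]) N : a 0%N = 0 ->
  series (@sqmod R \o a) N = \sum_(1 <= n < N) sqmod (a n).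
Proof.
move=> a0; rewrite /series/=; case: N => [|N]; first by rewrite !big_geq.
by rewrite big_ltn// a0 sqmod0 add0r.
Qed.

Definition l2_bounded (b : nat -> nat -> R[i]) (C : R) :=
  forall (a : nat -> R[i]) X, \sum_(1 <= m < X.+1) sqmod (tri_coef b a m) <=
    C * \sum_(1 <= n < X.+1) sqmod (a n).

Lemma sum_sqmod_h2_le f X : \sum_(1 <= n < X) sqmod (f n) <= sqsum f.
Proof.
rewrite -series_sqmodE ?h2_coef0//; apply: sqseries_le; exact: h2_sqsummable.
Qed.

Lemma tri_coef_sqsummable b C (a : nat -> R[i]) (A : R) : 0 <= C -> l2_bounded b C ->
  (forall X, \sum_(1 <= n < X) sqmod (a n) <= A) ->
  sqsummable (tri_coef b a) /\ sqsum (tri_coef b a) <= C * A.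
Proof.
move=> C0 hb hA; apply: sqsummable_bounded => N.
have t0 : tri_coef b a 0%N = 0 by rewrite /tri_coef big_geq.
rewrite series_sqmodE//; case: N => [|N].
  rewrite big_geq// mulr_ge0//; apply: le_trans (hA 0%N); by rewrite big_geq.
by apply: (le_trans (hb a N)); rewrite ler_wpM2l.
Qed.

Lemma tri_op_proof b (hb : exists2 C : R, 0 <= C & l2_bounded b C) f :
  tri_coef b f \in @h2_pred R.
Proof.
apply/asboolP; split; first by rewrite /tri_coef big_geq.
have [C C0 hC] := hb.
by have [] := tri_coef_sqsummable C0 hC (sum_sqmod_h2_le f).
Qed.

Definition tri_op b (hb : exists2 C : R, 0 <= C & l2_bounded b C) f : H2 R :=
  MkH2 (tri_op_proof hb f).

Lemma tri_op_is_linear b (hb : exists2 C : R, 0 <= C & l2_bounded b C) :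
  linear (tri_op hb).
Proof.
move=> k f g; apply: val_inj; apply/funext => m /=.
rewrite -[RHS]/(k * tri_coef b f m + tri_coef b g m).
rewrite /tri_coef mulr_sumr -big_split/=; apply: eq_bigr => n _.
rewrite -[LHS]/((k * f n + g n) * b n m); ring.
Qed.

HB.instance Definition _ b (hb : exists2 C : R, 0 <= C & l2_bounded b C) :=
  GRing.isLinear.Build R[i] (H2 R) (H2 R) _ (tri_op hb) (tri_op_is_linear hb).

Lemma dirichlet_seriesE (a : nat -> R[i]) s z :
  (forall e : R, 0 < e -> exists X0, forall X, (X0 <= X)%N ->
     normc (dpsum a X s - z) <= e) ->
  dirichlet_series a s = z.
Proof.
move=> h; apply: (@cvg_lim R[i]^o); first exact: norm_hausdorff.
apply/cvgrPdist_le => e e0.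
have eE : e = ((Re e)%:C)%C.
  by move: e0; rewrite ltcE => /andP[/eqP/= ei _]; apply: complex_ext => //=.
have e0' : 0 < Re e by move: e0; rewrite ltcE => /andP[].
have [X0 hX] := h _ e0'; exists X0 => // X /= /hX.
by rewrite normrE_normc eE lecR normcB.
Qed.

Lemma h2_eval_small (x e : R) : 2^-1 < x -> 0 < e ->
  exists2 eta : R, 0 < eta & forall (d : nat -> R[i]) X,
    \sum_(1 <= n < X.+1) sqmod (d n) <= eta ->
    forall s, x <= Re s -> normc (dpsum d X s) <= e.
Proof.
move=> x2 e0; have x1 : 1 < 2 * x by lra.
pose Z := (1 - 2 * npow 2 (2 * x))^-1.
have Z0 : 0 <= Z by apply: le_trans (zeta_sum_le 0 x1); rewrite big_geq.
(* [t] makes the contribution of the sum of n^(-2x) at most e / 2 *)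
pose t := 2 * (Z + 1) / e.
have t0 : 0 < t by rewrite divr_gt0// mulr_gt0// ltr_wpDl.
exists (e / (2 * t)); first by rewrite divr_gt0// mulr_gt0.
move=> d X dX s xs; have rs : 0 + x <= Re s by rewrite add0r.
have := @dpsum_eval_le R setT d X s 0 x t (fun _ _ _ => I) t0 rs.
move=> /le_trans; apply.
have h1 : t * \sum_(1 <= n < X.+1) sqmod (d n) * npow n (2 * 0) <= e / 2.
  have -> : e / 2 = t * (e / (2 * t)) by field; rewrite gt_eqF.
  rewrite ler_pM2l//; apply: le_trans dX; apply: le_of_eq.
  by apply: eq_bigr => n _; rewrite mulr0 npow0 mulr1.
have h2 : t^-1 * \sum_(1 <= n < X.+1 | `[< setT n >]) npow n (2 * x) <= e / 2.
  have Zt : t^-1 * Z <= e / 2.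
    have -> : t^-1 * Z = (Z / (Z + 1)) * (e / 2).
      by rewrite /t; field; rewrite !gt_eqF// ltr_wpDl.
    by rewrite ler_piMl ?divr_ge0 ?(ltW e0)// ler_pdivrMr ?ltr_wpDl// mul1r lerDl.
  apply: le_trans Zt; rewrite ler_wpM2l ?invr_ge0 ?(ltW t0)//.
  exact: zeta_setT_le.
lra.
Qed.

Definition cut N (a : nat -> R[i]) n := if (n <= N)%N then a n else 0.

Definition rest N (a : nat -> R[i]) n := if (n <= N)%N then 0 else a n.

Lemma cut_rest N a n : a n = cut N a n + rest N a n.
Proof. by rewrite /cut /rest; case: ifP => _; rewrite ?addr0 ?add0r. Qed.

Lemma rest_small (a : nat -> R[i]) (A : R) :
  (forall X, \sum_(1 <= n < X) sqmod (a n) <= A) -> forall e, 0 < e ->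
  exists N, forall X, \sum_(1 <= n < X) sqmod (rest N a n) <= e.
Proof.
move=> hA e e0; have [K hK] := bounded_sum_cauchy (fun n => sqmod_ge0 (a n)) hA e0.
exists K => X.
have r0 n : 0 <= sqmod (rest K a n) by exact: sqmod_ge0.
apply: (le_trans (ler_sum_nat_widen r0 (leqW (leq_maxl X K)))).
have KM : (K.+1 <= (maxn X K).+1)%N by rewrite ltnS leq_maxr.
rewrite (@big_cat_nat _ _ _ K.+1 1 (maxn X K).+1)//=.
rewrite big1_seq ?add0r; last first.
  move=> n /andP[_]; rewrite mem_index_iota ltnS => /andP[_ nK].
  by rewrite /rest nK sqmod0.
have := hK _ _ (leq_maxr X K) (leqnn K).
rewrite (@big_cat_nat _ _ _ K.+1 1 (maxn X K).+1)//= addrAC subrr add0r.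
move=> /(le_trans (ler_norm _)); apply: le_trans.
apply: le_of_eq; apply: eq_big_nat => n /andP[Kn _].
by rewrite /rest leqNgt Kn.
Qed.

Lemma dpsum_rest (a : nat -> R[i]) N W s : (N <= W)%N ->
  dpsum a W s = dpsum a N s + dpsum (rest N a) W s.
Proof.
move=> NW; have NW1 : (N.+1 <= W.+1)%N by [].
rewrite /dpsum (@big_cat_nat _ _ _ N.+1 1 W.+1)//=.
rewrite [X in _ = _ + X](@big_cat_nat _ _ _ N.+1 1 W.+1)//=.
rewrite [X in _ = _ + (X + _)]big1_seq ?add0r; last first.
  move=> n /andP[_]; rewrite mem_index_iota ltnS => /andP[_ nK].
  by rewrite /rest nK mul0r.
congr (_ + _); apply: eq_big_nat => n /andP[Kn _].
by rewrite /rest leqNgt Kn.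
Qed.

Lemma sqmod_cut_le N a n : sqmod (cut N a n) <= sqmod (a n).
Proof. by rewrite /cut; case: ifP => // _; rewrite sqmod0 sqmod_ge0. Qed.

Lemma sqmod_rest_le N a n : sqmod (rest N a n) <= sqmod (a n).
Proof. by rewrite /rest; case: ifP => // _; rewrite sqmod0 sqmod_ge0. Qed.

Lemma tri_coef_cut_rest b N a m :
  tri_coef b a m = tri_coef b (cut N a) m + tri_coef b (rest N a) m.
Proof.
by rewrite /tri_coef -big_split/=; apply: eq_bigr => n _; rewrite {1}(cut_rest N a n) mulrDl.
Qed.

Lemma h2_series_exists f s : 2^-1 < Re s -> exists z : R[i],
  forall e : R, 0 < e -> exists X0, forall X, (X0 <= X)%N ->
     normc (dpsum f X s - z) <= e.
Proof.
move=> s2; apply: complex_cauchy_lim => e e0.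
have e20 : 0 < e / 2 by rewrite divr_gt0.
have [eta eta0 heta] := h2_eval_small s2 e20.
have [N hN] := rest_small (sum_sqmod_h2_le f) eta0.
exists N => X Y NX NY.
rewrite (dpsum_rest f s NX) (dpsum_rest f s NY) opprD addrACA subrr add0r.
apply: (le_trans (normcB_le _ _)); rewrite (splitr e) lerD//; apply: (heta _ _ (hN _) _ (lexx _)).
Qed.

(** By density: the identity holds for Dirichlet polynomials, and both sides are
    continuous in the coefficients. *)
Lemma tri_op_composition (Phi : R[i] -> R[i]) b
   (hb : exists2 C : R, 0 <= C & l2_bounded b C) : triangular b ->
  (forall s, 2^-1 < Re s -> 2^-1 < Re (Phi s)) ->
  (forall (a : nat -> R[i]) N, exists G, coefs_of setT (fun s => dpsum a N (Phi s)) G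
     (fun m => \sum_(1 <= n < N.+1) a n * b n m)) ->
  is_composition_operator Phi (tri_op hb).
Proof.
move=> tb PhiR hcoef f s; rewrite /halfplane/= => s2.
have [C C0 hC] := hb; have p2 := PhiR _ s2.
have [z hz] := h2_series_exists f p2.
rewrite [RHS](dirichlet_seriesE hz).
apply: dirichlet_seriesE => e e0; have e40 : 0 < e / 4 by rewrite divr_gt0.
have [eta eta0 heta] := h2_eval_small s2 e40.
have [eta' eta'0 heta'] := h2_eval_small p2 e40.
pose tau := Num.min eta' (eta / (1 + C)).
have C1 : 0 < 1 + C by rewrite ltr_pwDl.
have tau0 : 0 < tau by rewrite lt_min eta'0 divr_gt0.
have [N hN] := rest_small (sum_sqmod_h2_le f) tau0.
have [G' hG'] := hcoef (cut N f) N.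
pose rho' := (Re s + 2^-1) / 2; pose rho := Re s - rho'.
have r0 : 0 < rho by rewrite /rho /rho'; lra.
have r'0 : 0 <= rho' by rewrite /rho'; lra.
have rs : rho + rho' <= Re s by rewrite /rho subrK.
have r'1 : 1 < 2 * rho' by rewrite /rho'; lra.
have hZ X := zeta_setT_le X r'1.
have [X0 hX0] := coefs_of_eval hG' r0 rs r'0 hZ e40.
have [X1 hX1] := hz _ e40.
exists (maxn N (maxn X0 X1)) => X; rewrite !geq_max => /and3P[NX X0X X1X].
have h1 := hX0 _ X0X; have h2 := hX1 _ X1X.
have cutN n : (N < n)%N -> cut N f n = 0 by move=> Nn; rewrite /cut leqNgt Nn.
have h3 : normc (dpsum (tri_coef b (rest N f)) X s) <= e / 4.
  apply: heta (lexx _); apply: (le_trans (hC _ _)).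
  apply: (@le_trans _ _ (C * (eta / (1 + C)))).
    by rewrite ler_wpM2l// (le_trans (hN _))// ge_min lexx orbT.
  by rewrite mulrCA ler_piMr ?(ltW eta0)// ler_pdivrMr// mul1r lerDr.
have h4 : normc (dpsum (rest N f) X (Phi s)) <= e / 4.
  by apply: heta' (lexx _); rewrite (le_trans (hN _))// ge_min lexx.
have e1 : dpsum (tri_op hb f) X s =
   dpsum (fun m => \sum_(1 <= n < N.+1) cut N f n * b n m) X s +
   dpsum (tri_coef b (rest N f)) X s.
  rewrite -dpsumD; apply: eq_bigr => m _; congr (_ * _).
  rewrite -[LHS]/(tri_coef b f m) (tri_coef_cut_rest b N); congr (_ + _).
  exact: tri_coef_poly.
have e2 : dpsum f X (Phi s) = dpsum (cut N f) N (Phi s) +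
    dpsum (rest N f) X (Phi s).
  rewrite (dpsum_rest f _ NX); congr (_ + _).
  by apply: eq_big_nat => n /andP[_ nN]; rewrite /cut -ltnS nN.
rewrite e1.
have -> : forall x y : R[i], x + y - z = (x - dpsum (cut N f) N (Phi s)) + y +
   (dpsum f X (Phi s) - z) - dpsum (rest N f) X (Phi s).
  by move=> x y; rewrite e2; ring.
apply: (le_trans (normcB_le _ _)).
have := normcD_le (dpsum (fun m => \sum_(1 <= n < N.+1) cut N f n * b n m) X s
   - dpsum (cut N f) N (Phi s) + dpsum (tri_coef b (rest N f)) X s)
   (dpsum f X (Phi s) - z).
have := normcD_le (dpsum (fun m => \sum_(1 <= n < N.+1) cut N f n * b n m) X s
   - dpsum (cut N f) N (Phi s)) (dpsum (tri_coef b (rest N f)) X s).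
lra.
Qed.

End TriangularOperator.

(** * Compactness *)

Section CompactOperators.
Variable R : realType.
Implicit Types (f g : H2 R).

Lemma h2_normE f : `|f| = ((Num.sqrt (sqsum f))%:C)%C.
Proof. by []. Qed.

Lemma h2_norm_le1 f : (`|f| <= 1) = (sqsum f <= 1).
Proof.
by rewrite h2_normE -[1]/((1%:C)%C) lecR -[X in _ <= X]sqrtr1 ler_sqrt.
Qed.

Lemma complex_gt0E (e : R[i]) : 0 < e -> e = ((Re e)%:C)%C /\ 0 < Re e.
Proof.
by rewrite ltcE => /andP[/eqP/= ei e0]; split => //; apply: complex_ext => //=.
Qed.

Lemma h2_norm_lt f (e : R) : 0 < e -> sqsum f <= (e / 2) ^+ 2 -> `|f| < (e%:C)%C.
Proof.
move=> e0 fe; rewrite h2_normE ltcR; apply: (@le_lt_trans _ _ (e / 2)); last lra.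
have e2 : 0 <= e / 2 by rewrite divr_ge0// ltW.
by rewrite -(ger0_norm e2) -sqrtr_sqr ler_wsqrtr.
Qed.

(** The restrictions to the sequences supported beyond N tend to 0 in norm:
    the operator is a limit of operators which only depend on finitely many
    coordinates. *)
Definition tail_small (b : nat -> nat -> R[i]) := forall eta : R, 0 < eta ->
  exists N, forall (a : nat -> R[i]), (forall n, (n <= N)%N -> a n = 0) ->
  forall X, \sum_(1 <= m < X.+1) sqmod (tri_coef b a m) <=
    eta * \sum_(1 <= n < X.+1) sqmod (a n).

Local Notation seqspace := (prod_topology (fun _ : nat => (R * R)%type)).

(** The closed unit ball, with the topology of coordinatewise convergence. *)
Definition ball_coords : set seqspace :=
  [set x | x 0%N = (0, 0) /\ forall N, \sum_(n < N) ((x n).1 ^+ 2 + (x n).2 ^+ 2) <= 1].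

Lemma ball_coords_compact : compact ball_coords.
Proof.
pose box : set (R * R) := `[(-1), 1] `*` `[(-1), 1].
have cbox : compact (box : set (R * R)%type).
  by apply: compact_setX; exact: segment_compact.
have cprod : compact ([set x : seqspace | forall i, box (x i)]).
  exact: (@tychonoff nat (fun=> (R * R)%type : topologicalType) (fun=> box)).
apply: (subclosed_compact _ cprod).
  rewrite (_ : ball_coords = [set x : seqspace | x 0%N = (0, 0)] `&`
     \bigcap_(N in [set: nat]) [set x : seqspace | \sum_(n < N) ((x n).1 ^+ 2 + (x n).2 ^+ 2) <= 1]); last first.
    apply/seteqP; split => x /= [h1 h2]; split => // N; first by move=> _; exact: h2.
    exact: (h2 N I).
  have cproj n : continuous (fun x : seqspace => x n).
    exact: (@proj_continuous nat (fun=> (R * R)%type : topologicalType) n).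
  have c1 n : continuous (fun x : seqspace => (x n).1).
    by move=> x; apply: (@continuous_comp _ _ _ (fun x : seqspace => x n) fst); [exact: cproj|exact: cvg_fst].
  have c2 n : continuous (fun x : seqspace => (x n).2).
    by move=> x; apply: (@continuous_comp _ _ _ (fun x : seqspace => x n) snd); [exact: cproj|exact: cvg_snd].
  apply: closedI.
    rewrite (_ : [set x | _] = (fun x : seqspace => (x 0%N).1) @^-1` [set 0] `&`
       (fun x : seqspace => (x 0%N).2) @^-1` [set 0]); last first.
      apply/seteqP; split => x /=; first by move=> ->.
      by case: (x 0%N) => u v /= [-> ->].
    apply: closedI.
      by apply: closed_comp => [x _|]; [exact: c1|exact: closed_eq].
    by apply: closed_comp => [x _|]; [exact: c2|exact: closed_eq].
  apply: closed_bigI => N _.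
  pose F N (x : seqspace) : R := \sum_(n < N) ((x n).1 ^+ 2 + (x n).2 ^+ 2).
  have cF : continuous (F N).
    elim: N => [|N IH] x.
      rewrite (_ : F 0%N = fun=> 0); first exact: cst_continuous.
      by apply/funext => y; rewrite /F big_ord0.
    rewrite (_ : F N.+1 = fun y => F N y + ((y N).1 ^+ 2 + (y N).2 ^+ 2)); last first.
      by apply/funext => y; rewrite /F big_ord_recr.
    have c3 (u : seqspace -> R) : {for x, continuous u} -> {for x, continuous (fun y => u y ^+ 2)}.
      move=> cu; under [X in {for x, continuous X}]eq_fun do rewrite expr2.
      exact: (@continuousM _ _ u u x cu cu).
    apply: (@continuousD _ _ _ (F N) _ x (IH x)).
    apply: (@continuousD _ _ _ (fun y : seqspace => (y N).1 ^+ 2)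
      (fun y : seqspace => (y N).2 ^+ 2) x); apply: c3; [exact: c1|exact: c2].
  rewrite (_ : [set x | _] = F N @^-1` [set y | y <= 1])//.
  by apply: closed_comp => [x _|]; [exact: cF|exact: closed_le].
move=> x [x0 hx] i.
have h := hx i.+1; rewrite big_ord_recr/= in h.
have s0 : 0 <= \sum_(n < i) ((x n).1 ^+ 2 + (x n).2 ^+ 2).
  by apply: sumr_ge0 => n _; rewrite addr_ge0 ?sqr_ge0.
have le1 (u : R) : u ^+ 2 <= 1 -> u \in `[(-1), 1].
  move=> u2; rewrite in_itv/= -ler_norml -sqrtr_sqr -[leRHS]sqrtr1.
  exact: ler_wsqrtr.
have a0 := sqr_ge0 (x i).1; have b0 := sqr_ge0 (x i).2.
by split; apply: le1; lra.
Qed.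

(** Such an operator is continuous from the unit ball, with the topology of
    coordinatewise convergence, to the norm topology, and this ball is
    compact. *)
Lemma tri_op_compact b (hb : exists2 C : R, 0 <= C & l2_bounded b C) :
  tail_small b -> compact_operator (tri_op hb).
Proof.
move=> tb; have [C C0 hC] := hb.
pose co (x : seqspace) n : R[i] := ((x n).1 +i* (x n).2)%C.
pose mk (x : seqspace) : H2 R := insubd (0 : H2 R) (co x).
have comem x : ball_coords x -> co x \in @h2_pred R.
  move=> [x0 hx]; apply/asboolP; split; first by rewrite /co x0.
  apply: (proj1 (@sqsummable_bounded R (co x) 1 _)) => N.
  by rewrite /series/= big_mkord; exact: hx.
have mkE x : ball_coords x -> (mk x : nat -> R[i]) = co x.
  by move=> xB; rewrite /mk -[LHS]/(val _) insubdK//; exact: comem.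
pose Psi x := tri_op hb (mk x).
have img : tri_op hb @` [set v : H2 R | `|v| <= 1] = Psi @` ball_coords.
  apply/seteqP; split => [_ [v /= v1 <-]|_ [x xB <-]]; last first.
    exists (mk x) => //=; rewrite h2_norm_le1 mkE//.
    have [_ hx] := xB; apply: (proj2 (@sqsummable_bounded R (co x) 1 _)) => N.
    by rewrite /series/= big_mkord; exact: hx.
  rewrite h2_norm_le1 in v1.
  pose x : seqspace := fun n => (Re (v n), Im (v n)).
  have xB : ball_coords x.
    split; first by rewrite /x h2_coef0.
    move=> N; apply: le_trans v1.
    have := sqseries_le N (@h2_sqsummable R v); apply: le_trans.
    by rewrite /series/= big_mkord.
  exists x => //; rewrite /Psi; congr tri_op; apply: val_inj => /=.
  by rewrite mkE//; apply/funext => n; rewrite /co/=; case: (v n).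
have cPsi : {within ball_coords, continuous Psi}.
  apply/subspace_continuousP => x xB.
  apply/cvgrPdist_lt => ec ec0; have [ecE e0] := complex_gt0E ec0.
  rewrite ecE; move: (Re ec) e0 => e e0 {ec ec0 ecE}.
  pose q := (e / 2) ^+ 2; have q0 : 0 < q by rewrite exprn_gt0// divr_gt0.
  have [N hN] := tb (q / 32) (divr_gt0 q0 (ltr0Sn R 31)).
  pose D := 4 * (C + 1) * N.+1%:R.
  have D0 : 0 < D by rewrite !mulr_gt0// ltr_wpDl.
  pose eta := Num.sqrt (q / (2 * D)).
  have eta0 : 0 < eta by rewrite sqrtr_gt0 divr_gt0// mulr_gt0.
  have eta2 : eta ^+ 2 = q / (2 * D) by rewrite sqr_sqrtr// ltW// divr_gt0// mulr_gt0.
  have nearx : nbhs (x : seqspace) [set y : seqspace | forall i : 'I_N.+1,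
      `|(x i).1 - (y i).1| < eta /\ `|(x i).2 - (y i).2| < eta].
    apply: (@filter_forall seqspace 'I_N.+1 (fun i => [set y : seqspace |
      `|(x i).1 - (y i).1| < eta /\ `|(x i).2 - (y i).2| < eta]) (nbhs (x : seqspace))
      (nbhs_filter _)) => i.
    have := (@proj_continuous nat (fun=> (R * R)%type : topologicalType) i) x.
    have eb (u : R * R) : nbhs u [set z : R * R | `|u.1 - z.1| < eta /\ `|u.2 - z.2| < eta].
      by apply/nbhs_ballP; exists eta => // z [z1 z2].
    by move=> /(_ _ (eb (x i))).
  rewrite near_withinE; near=> y => yB.
  have hy : forall i : 'I_N.+1, `|(x i).1 - (y i).1| < eta /\ `|(x i).2 - (y i).2| < eta.
    by near: y.
  rewrite /Psi -linearB; apply: h2_norm_lt => //.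
  set d := mk x - mk y.
  have dE n : (d : nat -> R[i]) n = co x n - co y n by rewrite -mkE// -(mkE y).
  have dsmall n : (n <= N)%N -> sqmod (d n) <= 2 * eta ^+ 2.
    move=> nN; have [h1 h2] := hy (Ordinal (nN : (n < N.+1)%N)).
    rewrite dE /co /sqmod/= mulr2n mulrDl mul1r.
    rewrite -(real_normK (num_real ((x n).1 - _))) -(real_normK (num_real ((x n).2 - _))).
    by rewrite lerD// lerXn2r ?nnegrE ?(ltW eta0)// ltW.
  have dle X : \sum_(1 <= n < X) sqmod (d n) <= 4.
    have one z M : ball_coords z -> \sum_(1 <= n < M) sqmod (co z n) <= 1.
      move=> [z0 hz]; rewrite -series_sqmodE; last by rewrite /co z0.
      by rewrite /series/= big_mkord; exact: hz.
    apply: (@le_trans _ _ (\sum_(1 <= n < X) (2 * sqmod (co x n) + 2 * sqmod (co y n)))).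
      apply: ler_sum => n _; rewrite dE; apply: (le_trans (sqmodD2 _ _)).
      by rewrite -[sqmod (- _)]normcX2 normc_opp normcX2.
    rewrite big_split/= -!mulr_sumr; have := one x X xB; have := one y X yB; lra.
  apply: (proj2 (@sqsummable_bounded R (tri_coef b d) _ _)) => X.
  have t0 : tri_coef b d 0%N = 0 by rewrite /tri_coef big_geq.
  rewrite series_sqmodE// -/q.
  apply: (le_trans (ler_sum_nat_widen (fun m => sqmod_ge0 _) (leqnSn X))).
  apply: (@le_trans _ _ (\sum_(1 <= m < X.+1) (2 * sqmod (tri_coef b (cut N d) m) +
     2 * sqmod (tri_coef b (rest N d) m)))).
    by apply: ler_sum => m _; rewrite (tri_coef_cut_rest b N) sqmodD2.
  rewrite big_split/= -!mulr_sumr.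
  have r0 n : (n <= N)%N -> rest N d n = 0 by move=> nN; rewrite /rest nN.
  have h1 := hN (rest N d) r0 X; have h2 := hC (cut N d) X.
  have h3 : \sum_(1 <= n < X.+1) sqmod (rest N d n) <= 4.
    by apply: le_trans (dle X.+1); apply: ler_sum => n _; exact: sqmod_rest_le.
  have h4 : \sum_(1 <= n < X.+1) sqmod (cut N d n) <= N.+1%:R * (2 * eta ^+ 2).
    have c0 n : 0 <= sqmod (cut N d n) by exact: sqmod_ge0.
    apply: (@le_trans _ _ (\sum_(1 <= n < (maxn X N).+1) sqmod (cut N d n))).
      by apply: ler_sum_nat_widen => //; rewrite ltnS leq_maxl.
    rewrite (@big_cat_nat _ _ _ N.+1)//=; last by rewrite ltnS leq_maxr.
    rewrite [X in _ + X]big1_seq ?addr0; last first.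
      move=> n /andP[_]; rewrite mem_index_iota => /andP[Nn _].
      by rewrite /cut leqNgt Nn sqmod0.
    apply: (@le_trans _ _ (\sum_(1 <= n < N.+1) (2 * eta ^+ 2))).
      rewrite !big_nat; apply: ler_sum => n /andP[_ nN].
      by apply: (le_trans (sqmod_cut_le _ _ _)); exact: dsmall.
    rewrite sumr_const_nat subn1/= -[_ *+ N]mulr_natl ler_wpM2r//.
      by rewrite mulr_ge0// sqr_ge0.
    by rewrite ler_nat.
  have h5 : C * (N.+1%:R * (2 * eta ^+ 2)) <= q / 4.
    have -> : q / 4 = (C + 1) * (N.+1%:R * (2 * eta ^+ 2)).
      rewrite eta2 /D; move: (N.+1%:R : R) (ltr0Sn R N) => u u0.
      by field; rewrite !gt_eqF// ltr_wpDl.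
    by rewrite ler_wpM2r ?lerDl// mulr_ge0// mulr_ge0// sqr_ge0.
  have h6 : C * \sum_(1 <= n < X.+1) sqmod (cut N d n) <= C * (N.+1%:R * (2 * eta ^+ 2)).
    by rewrite ler_wpM2l.
  have h7 : q / 32 * \sum_(1 <= n < X.+1) sqmod (rest N d n) <= q / 32 * 4.
    by rewrite ler_wpM2l// divr_ge0// ltW.
  lra.
rewrite /compact_operator img.
have cI : compact (Psi @` ball_coords) := continuous_compact cPsi ball_coords_compact.
rewrite -(closure_id _).1//; apply: compact_closed cI; exact: norm_hausdorff.
Unshelve. all: by end_near.
Qed.

(** Near each sequence the tails and the norm are controlled by those of the
    sequence itself, and finitely many such neighbourhoods cover the set. *)
Lemma compact_uniform_tails (A : set (H2 R)) (e : R) : compact A -> 0 < e ->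
  exists N, forall g, A g -> sqsum g <= N%:R /\
    forall X, \sum_(1 <= n < X) sqmod (rest N g n) <= e.
Proof.
move=> /compact_near_coveringP cA e0.
have [] := cA nat \oo (fun N g => sqsum g <= N%:R /\
    forall X, \sum_(1 <= n < X) sqmod (rest N g n) <= e) _ _; last first.
  by move=> N _ hN; exists N => g Ag; exact: (hN N (leqnn N) g Ag).
move=> f Af.
have [K hK] := rest_small (sum_sqmod_h2_le f) (divr_gt0 e0 (ltr0Sn R 3)).
pose r := Num.min 1 (e / 4).
have r0 : 0 < r by rewrite lt_min ltr01 divr_gt0.
have rC0 : (0 : R[i]) < ((Num.sqrt r)%:C)%C by rewrite ltcR sqrtr_gt0.
pose B0 := (Num.truncn (2 * sqsum f + 2)).+1.
exists (ball f ((Num.sqrt r)%:C)%C, [set N : nat | (maxn K B0 <= N)%N]).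
  by split; [exact: nbhsx_ballx|exists (maxn K B0)].
move=> [g N] [/= fg]; rewrite geq_max => /andP[KN BN].
have {}fg : sqsum (g - f) <= r.
  move: fg; rewrite -ball_normE/= distrC h2_normE ltcR.
  by rewrite ltr_sqrt// => /ltW.
have sg n : sqmod (g n) <= 2 * sqmod (f n) + 2 * sqmod ((g - f : H2 R) n).
  have -> : g n = f n + (g - f : H2 R) n by rewrite -[(g - f : H2 R) n]/(g n - f n) addrCA subrr addr0.
  exact: sqmodD2.
split.
  apply: (@le_trans _ _ (2 * sqsum f + 2)); last first.
    by apply: (le_trans (ltW (truncnS_gt _))); rewrite ler_nat.
  apply: (proj2 (@sqsummable_bounded R g _ _)) => X.
  rewrite series_sqmodE ?h2_coef0//.
  apply: (@le_trans _ _ (\sum_(1 <= n < X) (2 * sqmod (f n) + 2 * sqmod ((g - f : H2 R) n)))).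
    by apply: ler_sum => n _.
  rewrite big_split/= -!mulr_sumr.
  have := sum_sqmod_h2_le f X; have := sum_sqmod_h2_le (g - f) X.
  have : r <= 1 by rewrite ge_min lexx.
  lra.
move=> X.
apply: (@le_trans _ _ (\sum_(1 <= n < X) (2 * sqmod (rest K f n) + 2 * sqmod ((g - f : H2 R) n)))).
  apply: ler_sum => n _; rewrite /rest; case: (leqP n N) => [_|Nn].
    by rewrite sqmod0 addr_ge0// mulr_ge0// sqmod_ge0.
  by rewrite leqNgt (leq_ltn_trans KN Nn)/=; exact: sg.
rewrite big_split/= -!mulr_sumr.
have := hK X; have := sum_sqmod_h2_le (g - f) X.
have : r <= e / 4 by rewrite ge_min lexx orbT.
lra.
Qed.

End CompactOperators.

(** * The equivalences *)

Section Vanishing.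
Variable R : realType.
Implicit Types (s z w : R[i]).

Lemma vanishes_at_boundaryP (F : R[i] -> \bar R) : vanishes_at_boundary F <->
  forall e : R, 0 < e -> exists2 theta : R, 0 < theta &
    forall s, 0 < Re s < theta -> (`|F s| <= e%:E)%E.
Proof.
split=> [h e e0|h].
  have /h : nbhs (0%E : \bar R) [set x : \bar R | (x < e%:E)%E].
    by apply: open_nbhs_nbhs; split; [exact: open_ereal_lt_ereal|rewrite /= lte_fin].
  rewrite nbhs_simpl/= => -[d /= d0 hd].
  exists (d / 2); first by rewrite divr_gt0.
  move=> s sd; have := hd (d / 2); rewrite /= sub0r normrN gtr0_norm ?divr_gt0//.
  have dd : d / 2 < d by lra.
  move=> /(_ dd isT) /ltW; apply: le_trans.
  by apply: ereal_sup_ubound; exists s.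
apply/fine_cvgP.
have key (e : R) : 0 < e -> \forall t \near (0 : R)^'+,
   (0 <= ereal_sup [set `|F s|%E | s in [set s | (0 < Re s < t)%R]] <= e%:E)%E.
  move=> e0; have [theta t0 ht] := h e e0.
  near=> t; have t00 : 0 < t by near: t; exact: nbhs_right_gt.
  have tt : t < theta by near: t; exact: nbhs_right_lt.
  apply/andP; split.
    apply: (@le_trans _ _ `|F ((t / 2)%:C)%C|%E); first exact: abse_ge0.
    apply: ereal_sup_ubound; exists ((t / 2)%:C)%C => //=; lra.
  apply: ge_ereal_sup => _ [s /= /andP[s0 st] <-]; apply: ht.
  by rewrite s0 (lt_trans st).
split.
  near=> t; have /andP[h0 h1] : (0 <= ereal_sup [set `|F s|%E | s in
      [set s | (0 < Re s < t)%R]] <= 1%:E)%E by near: t; exact: key.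
  by rewrite ge0_fin_numE// (le_lt_trans h1)// ltry.
apply/cvgrPdist_le => e e0; near=> t.
have /andP[h0 h1] : (0 <= ereal_sup [set `|F s|%E | s in
      [set s | (0 < Re s < t)%R]] <= e%:E)%E by near: t; exact: key.
rewrite /= sub0r normrN ger0_norm ?fine_ge0//.
rewrite -lee_fin fineK// ge0_fin_numE// (le_lt_trans h1)// ltry.
Unshelve. all: by end_near.
Qed.

Lemma counting_function_le k (Phi : R[i] -> R[i]) w (m : R) : valent k Phi -> 0 <= m ->
  0 < Re w ->
  (forall s, 0 < Re s -> Phi s = w -> Re s <= m) ->
  (counting_function Phi w <= (k%:R * m)%:E)%E.
Proof.
move=> vk m0 w0 hm; rewrite /counting_function.
apply: ge_ereal_sup => _ [X [finX XA] <-].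
rewrite fsbig_finite//=.
have cX := geq_card_fset_set (card_le_trans (subset_card_le XA) (vk w w0)).
apply: (@le_trans _ _ (\sum_(i <- finmap.enum_fset (fset_set X)) m%:E)%E).
  rewrite big_seq [leRHS]big_seq; apply: lee_sum => s.
  rewrite in_fset_set// inE => /XA[s0 sw]; rewrite lee_fin; exact: hm.
rewrite sumEFin lee_fin big_const_seq count_predT iter_addr_0 -[m *+ _]mulr_natl.
rewrite ler_wpM2r// ler_nat; exact: cX.
Qed.

Lemma counting_function_ge (Phi : R[i] -> R[i]) s : 0 < Re s ->
  ((Re s)%:E <= counting_function Phi (Phi s))%E.
Proof.
move=> s0; rewrite /counting_function.
have -> : (Re s)%:E = (\sum_(x \in [set s]) (Re x)%:E)%E.
  by rewrite fsbig_set1.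
apply: ereal_sup_ubound; exists [set s] => //; split; first exact: finite_set1.
by move=> _ ->.
Qed.

(** N_Phi(w) lies between the real part of any preimage of w and k times the
    largest one. The preimages of a point near the boundary are near the
    boundary, since Re s <= Re Phi(s). *)
Lemma ratio_iff_counting (c0 k : nat) M (Phi Phi' : R[i] -> R[i]) :
  tame_map c0 k M Phi Phi' ->
  vanishes_at_boundary (fun s : R[i] => (Re s / Re (Phi s))%:E) <->
  vanishes_at_boundary
     (fun s : R[i] => (counting_function Phi s * ((Re s)^-1)%:E)%E).
Proof.
move=> tm.
have PhiRe s : 0 < Re s -> Re s <= Re (Phi s).
  move=> s0; apply: le_trans (tame_Re tm s0).
  by rewrite ler_peMl ?(ltW s0)// ler1n (tame_c0 tm).
have cf0 s : (0 <= counting_function Phi s)%E.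
  by apply: esum_ge0 => a [a0 _]; rewrite lee_fin ltW.
rewrite !vanishes_at_boundaryP; split=> h e e0.
  have k1 : 0 < k%:R + 1 :> R by rewrite ltr_wpDl.
  have [theta t0 ht] := h _ (divr_gt0 e0 k1); exists theta => //.
  move=> w /andP[w0 wt].
  have cfw : (counting_function Phi w <= (k%:R * (e / (k%:R + 1) * Re w))%:E)%E.
    apply: (counting_function_le (tame_valent tm) _ w0).
      exact: mulr_ge0 (divr_ge0 (ltW e0) (ltW k1)) (ltW w0).
    move=> s s0 sw; have sr := PhiRe _ s0; rewrite sw in sr.
    have := ht s; rewrite s0 (le_lt_trans sr wt) sw => /(_ isT).
    by rewrite abse_EFin lee_fin => /(le_trans (ler_norm _)); rewrite ler_pdivrMr.
  rewrite gee0_abs; last by rewrite mule_ge0// lee_fin invr_ge0 ltW.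
  apply: (@le_trans _ _ ((k%:R * (e / (k%:R + 1) * Re w))%:E * ((Re w)^-1)%:E)%E).
    by rewrite lee_wpmul2r// lee_fin invr_ge0 ltW.
  rewrite -EFinM lee_fin -!mulrA mulfV ?gt_eqF// mulr1 mulrCA ler_piMr ?(ltW e0)//.
  by rewrite ler_pdivrMr// mul1r lerDl.
have [theta t0 ht] := h _ e0; exists (theta * e); first by rewrite mulr_gt0.
move=> s /andP[s0 st]; have sr := PhiRe _ s0.
have p0 : 0 < Re (Phi s) by exact: lt_le_trans sr.
rewrite abse_EFin lee_fin ger0_norm ?divr_ge0 ?(ltW s0) ?(ltW p0)//.
rewrite ler_pdivrMr//; have [pt|tp] := ltP (Re (Phi s)) theta; last first.
  by apply: (le_trans (ltW st)); rewrite mulrC ler_pM2l.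
have := ht (Phi s); rewrite p0 pt => /(_ isT).
rewrite gee0_abs; last by rewrite mule_ge0// lee_fin invr_ge0 ltW.
rewrite -ler_pdivrMr// -lee_fin; apply: le_trans.
rewrite EFinM lee_wpmul2r ?lee_fin ?invr_ge0 ?(ltW p0)//.
exact: counting_function_ge.
Qed.

End Vanishing.

Section Sufficiency.
Variable R : realType.
Implicit Types (s z w : R[i]).

Lemma npow_small (kappa e : R) : 0 < kappa -> 0 < e -> exists N, forall n, (N < n)%N ->
  npow n kappa <= e.
Proof.
move=> k0 e0; pose N := (Num.truncn (expR (e^-1 / kappa))).+1; exists N => n Nn.
have n0 : (0 < n)%N by exact: leq_trans Nn.
have ln_n : e^-1 / kappa <= ln n%:R.
  rewrite -ler_expR lnK ?posrE ?ltr0n//.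
  by apply: (le_trans (ltW (truncnS_gt _))); rewrite ler_nat ltnW.
have h : e^-1 <= kappa * ln n%:R by rewrite mulrC -ler_pdivrMr.
rewrite /npow expRN -[leRHS]invrK lef_pV2 ?posrE ?expR_gt0 ?invr_gt0//.
by apply: (le_trans h); have := expR_ge1Dx (kappa * ln n%:R); lra.
Qed.

(** The constant term is lost by differentiation, hence treated apart; by
    triangularity only the coefficient of index 1 contributes to it. *)
Lemma composition_sum_le (c0 k l : nat) M Phi phi' (b : nat -> nat -> R[i])
    (delta eps : R) (a : nat -> R[i]) X :
  tame_map c0 k M Phi (fun s => c0%:R + phi' s) -> triangular b ->
  (forall (S : set nat) (a : nat -> R[i]) N,
      (forall n, (0 < n <= N)%N -> a n != 0 -> comp_support l n `<=` S) ->
      coefs_of S (fun s => dpsum a N (Phi s))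
        (fun s => dpsum (dcoef a) N (Phi s) * (c0%:R + phi' s))
        (fun m => \sum_(1 <= n < N.+1) a n * b n m)) ->
  0 < delta -> 0 <= eps ->
  (forall s, 0 < Re s < delta -> Re s <= eps * Re (Phi s)) ->
  \sum_(1 <= m < X.+1) sqmod (tri_coef b a m) <=
  sqmod (a 1%N) * sqmod (b 1%N 1%N) + 4 * expR 4 * (2 * (288 * c0%:R * k%:R * 16)) *
    \sum_(1 <= n < X.+1) sqmod (a n) * (eps + npow n (c0%:R * delta / 2)).
Proof.
move=> tm tb hb d0 e0 heps.
have hc := hb setT a X (fun _ _ _ _ _ => I).
have := key_estimate X.+1 tm d0 e0 heps hc (fun _ _ => erefl).
set B := _ * \sum_(1 <= n < X.+1) _ => key.
have B0 : 0 <= B.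
  apply: mulr_ge0; first by rewrite !mulr_ge0 ?expR_ge0.
  by apply: sumr_ge0 => n _; rewrite mulr_ge0 ?sqmod_ge0// addr_ge0 ?npow_ge0.
clearbody B; case: X {hc} key => [|X] key.
  by rewrite big_geq// addr_ge0// mulr_ge0 ?sqmod_ge0.
rewrite big_ltn//; apply: lerD.
  by rewrite /tri_coef big_nat1 sqmodM.
apply: le_trans key; apply: le_of_eq.
apply: eq_big_nat => m /andP[_ mX]; congr sqmod.
exact: tri_coef_widen.
Qed.

End Sufficiency.

Section H2Coefficients.
Variable R : realType.
Implicit Types (s z w : R[i]).

Lemma h2_has_coef (g : H2 R) n : has_coef (dirichlet_series g) n (g n).
Proof.
move=> e e0; have half1 : 2^-1 < 1 :> R by lra.
have [eta eta0 heta] := h2_eval_small half1 e0.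
have [K hK] := rest_small (sum_sqmod_h2_le g) eta0.
pose N := maxn K n; pose p := cut N g.
have sp : supported setT N p.
  move=> [|m]; rewrite /p /cut; first by rewrite h2_coef0 eqxx.
  by case: ifP => //; rewrite eqxx.
exists p, N; split => // [s s1|]; last first.
  by rewrite /p /cut leq_maxr subrr normc_zero ltW.
have s2 : 2^-1 < Re s by lra.
have [z hz] := h2_series_exists g s2.
rewrite (dirichlet_seriesE hz).
apply: (@le_of_slack _ _ _ 1) => // d d0; have [X0 hX] := hz _ d0.
pose X := maxn N X0; have h1 := hX X (leq_maxr _ _).
have E : dpsum g X s = dpsum p N s + dpsum (rest N g) X s.
  rewrite (dpsum_rest g s (leq_maxl N X0)); congr (_ + _).
  by apply: eq_big_nat => m /andP[_ mN]; rewrite /p /cut -ltnS mN.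
have h2 : normc (dpsum (rest N g) X s) <= e.
  apply: heta s1; apply: le_trans (hK X.+1); apply: ler_sum => m _; rewrite /rest.
  case: (leqP m N) => [_|Nm]; first by rewrite sqmod0; case: ifP; rewrite ?sqmod0 ?sqmod_ge0.
  by rewrite leqNgt (leq_ltn_trans (leq_maxl K n) Nm).
have -> : dpsum p N s - z =
    (dpsum g X s - z) - dpsum (rest N g) X s by rewrite E; ring.
by apply: (le_trans (normcB_le _ _)); lra.
Qed.

End H2Coefficients.

Section Necessity.
Variable R : realType.
Implicit Types (s z w : R[i]).

(** The powers of 2 are enough. *)
Lemma smooth_sum_unbounded l (B : R) : (1 < l)%N -> exists2 theta : R, 0 < theta &
  forall sigma : R, 0 < sigma < theta -> exists X,
    B <= \sum_(1 <= n < X.+1 | `[< smooth l n >]) npow n (2 * sigma).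
Proof.
move=> l1; pose m := (Num.truncn (2 * B)).+1.
have mB : 2 * B <= m%:R by exact/ltW/truncnS_gt.
exists (4 * m%:R)^-1; first by rewrite invr_gt0 mulr_gt0.
move=> sigma /andP[s0 st]; exists (2 ^ m)%N.
have sm2 j : smooth l (2 ^ j)%N.
  by apply: smooth_expn; split => // p pp /(dvdn_leq (isT : (0 < 2)%N)) p2; exact: leq_trans l1.
have f0 n : 0 <= npow n (2 * sigma) by exact: npow_ge0.
have S j : \sum_(i < j.+1) npow (2 ^ i) (2 * sigma) <=
    \sum_(1 <= n < (2 ^ j).+1 | `[< smooth l n >]) npow n (2 * sigma).
  elim: j => [|j IH].
    rewrite big_ord1 big_mkcond/= big_nat1.
    by case: asboolP => // h; have := sm2 0%N.
  rewrite big_ord_recr/= [leRHS]big_mkcond/= big_nat_recr/=; last by rewrite expn_gt0.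
  apply: lerD; last by case: asboolP => // h; have := sm2 j.+1.
  apply: (le_trans IH); rewrite big_mkcond/=; apply: ler_sum_nat_widen.
    by move=> n; case: ifP.
  by rewrite ltn_exp2l.
apply: le_trans (S m).
apply: (@le_trans _ _ (\sum_(i < m.+1) 2^-1)).
  rewrite sumr_const card_ord -[_ *+ _]mulr_natl -natr1; lra.
apply: ler_sum => i _; rewrite npow_expn//.
have im : (i%:R : R) <= m%:R by rewrite ler_nat -ltnS.
have m0 : 0 < m%:R :> R by rewrite ltr0n.
have sm : sigma * (4 * m%:R) <= 1.
  by rewrite -ler_pdivlMr ?mulr_gt0// div1r ltW.
have h : i%:R * (2 * sigma) <= 2^-1.
  have : i%:R * sigma <= m%:R * sigma by rewrite ler_wpM2r// ltW.
  lra.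
have l2 : ln 2%:R <= 1 :> R.
  have := @le_ln1Dx R 1; rewrite (_ : 1 + 1 = 2%:R); last by ring.
  by apply; lra.
have l20 : 0 <= ln 2%:R :> R by exact: lnn_ge0.
have i0 : 0 <= i%:R * (2 * sigma) by rewrite !mulr_ge0// ltW.
have h2 : i%:R * (2 * sigma) * ln 2%:R <= 2^-1.
  by apply: (le_trans _ h); rewrite ler_piMr.
rewrite /npow; have := expR_ge1Dx (- (i%:R * (2 * sigma) * ln 2%:R)); lra.
Qed.

(** The image of f is evaluated at s, outside the half-plane where all
    elements of H^2 converge; this is possible because its coefficients are
    supported by smooth integers. The first terms are bounded by the norm, the
    others by Cauchy-Schwarz. *)
Lemma composition_eval_bound l N (Phi F' : R[i] -> R[i]) (b : nat -> R[i])
    (T : {linear H2 R -> H2 R}) (f : H2 R) s N' (eta Z t : R) :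
  is_composition_operator Phi T ->
  (forall s, 2^-1 < Re s -> 2^-1 < Re (Phi s)) ->
  coefs_of (smooth l) (fun s => dpsum f N (Phi s)) F' b ->
  (forall n, (N < n)%N -> f n = 0) -> 0 < Re s -> 0 < t ->
  sqsum (T f) <= N'%:R -> (forall X, \sum_(1 <= n < X) sqmod (rest N' (T f) n) <= eta) ->
  (forall X, \sum_(1 <= n < X | `[< smooth l n >]) npow n (2 * Re s) <= Z) ->
  normc (dpsum f N (Phi s)) <= 2 * N'%:R + t * eta + t^-1 * Z.
Proof.
move=> hT PhiR hb fN s0 t0 hN hr hZ.
have Tb : b = T f.
  apply/funext => -[|n].
    rewrite h2_coef0; apply/eqP; apply/negP => /negP b0.
    by have [_] := hb.1 _ b0.
  apply: (@has_coef_uniq _ _ _ n.+1 _ _ isT _ (coefs_of_has_coef (ltn0Sn n) hb)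
    (h2_has_coef (T f) n.+1)) => u u1.
  have u2 : 2^-1 < Re u by lra.
  rewrite hT//; symmetry; apply: dirichlet_seriesE => e e0; exists N => X NX.
  rewrite (dpsum_rest f _ NX) (_ : dpsum (rest N f) X (Phi u) = 0).
    by rewrite addr0 subrr normc_zero ltW.
  apply: big1 => m _; rewrite /rest.
  by case: leqP => [_|/fN ->]; rewrite mul0r.
rewrite Tb in hb.
pose r := Re s / 2; have r0 : 0 < r by rewrite divr_gt0.
have rr : r + r <= Re s by rewrite /r; lra.
have r20 : 0 < 2 * r by rewrite mulr_gt0.
have [Z' Z'0 hZ'] := smooth_sum_bounded l r20.
have ev := coefs_of_eval hb r0 rr (ltW r0) hZ'.
apply: (@le_of_slack _ _ _ 1) => // e e0; have [X0 hX] := ev _ e0.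
pose X := maxn N' X0; have h1 := hX X (leq_maxr _ _).
have h2 : normc (dpsum (T f) N' s) <= 2 * N'%:R.
  apply: (le_trans (normc_sum _ _ _)).
  apply: (@le_trans _ _ (\sum_(1 <= n < N'.+1) (1 + sqmod (T f n)))).
    apply: ler_sum => n _; rewrite normcM normc_natpowN -normcX2.
    apply: (@le_trans _ _ (normc (T f n))).
      by rewrite ler_piMr ?normc_ge0// npow_le1// ltW.
    set x := normc _; have := sqr_ge0 (x - 1); have := normc_ge0 (T f n).
    rewrite -/x sqrrB mulr1 expr1n; lra.
  rewrite big_split/= sumr_const_nat subn1/=.
  have := sum_sqmod_h2_le (T f) N'.+1; lra.
have dS n : (0 < n)%N -> rest N' (T f) n != 0 -> smooth l n.
  by move=> n0; rewrite /rest; case: ifP => [|_ /hb.1[]//]; rewrite eqxx.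
have rs : 0 + Re s <= Re s by rewrite add0r.
have h3 := @dpsum_eval_le R _ (rest N' (T f)) X s 0 _ t dS t0 rs.
have h4 : t * \sum_(1 <= n < X.+1) sqmod (rest N' (T f) n) * npow n (2 * 0) <= t * eta.
  rewrite ler_pM2l//; apply: le_trans (hr X.+1); apply: le_of_eq.
  by apply: eq_bigr => n _; rewrite mulr0 npow0 mulr1.
have h5 : t^-1 * \sum_(1 <= n < X.+1 | `[< smooth l n >]) npow n (2 * Re s) <= t^-1 * Z.
  by rewrite ler_wpM2l ?invr_ge0 ?(ltW t0).
rewrite (dpsum_rest (T f) s (leq_maxl N' X0)) -/X in h1.
have h6 := normcD_le (dpsum (T f) N' s) (dpsum (rest N' (T f)) X s).
have h7 := normc_tri (dpsum f N (Phi s)) 0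
  (dpsum (T f) N' s + dpsum (rest N' (T f)) X s).
rewrite !subr0 in h7; rewrite normcB in h1.
move: h1 h2 h3 h4 h5 h6 h7.
set a1 := normc (dpsum f N (Phi s)); set a2 := t * \sum_(_ <= _ < _) _.
set a3 := t^-1 * \sum_(_ <= _ < _ | _) _.
lra.
Qed.

(** Test functions: partial sums, over smooth integers, of the reproducing
    kernel at Phi(s). Their images stay in a compact set, hence have uniformly
    small tails, so that the norm of the kernel at Phi(s) is negligible with
    respect to the norm of the kernel at s; the two norms are comparable as long
    as the real parts are. *)
Lemma compact_ratio (l : nat) (Phi phi' : R[i] -> R[i]) (b : nat -> nat -> R[i]) c0
    (T : {linear H2 R -> H2 R}) :
  (1 < l)%N -> is_composition_operator Phi T -> compact_operator T ->
  (forall s, 2^-1 < Re s -> 2^-1 < Re (Phi s)) ->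
  (forall s, 0 < Re s -> 0 < Re (Phi s)) ->
  (forall (S : set nat) (a : nat -> R[i]) N,
      (forall n, (0 < n <= N)%N -> a n != 0 -> comp_support l n `<=` S) ->
      coefs_of S (fun s => dpsum a N (Phi s))
        (fun s => dpsum (dcoef a) N (Phi s) * (c0 + phi' s))
        (fun m => \sum_(1 <= n < N.+1) a n * b n m)) ->
  forall e : R, 0 < e -> exists2 theta : R, 0 < theta &
    forall s, 0 < Re s < theta -> Re s <= e * Re (Phi s).
Proof.
move=> l1 hT cT PhiR Phi0 hb e e0.
(* if the conclusion fails at s, then Re Phi(s) is at most K Re s *)
pose K := (Num.truncn e^-1).+1.
have eK : e^-1 <= K%:R by exact/ltW/truncnS_gt.
have l0 : (0 < l`! ^ K)%N by rewrite expn_gt0 fact_gt0.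
pose V : R := (l`! ^ K)%:R; have V0 : 0 < V by rewrite ltr0n.
(* v times the norm Y of the kernel at s is a lower bound for the norm r of
   the truncated kernel at Phi(s) *)
pose v := Num.sqrt (2 * V)^-1.
have v0 : 0 < v by rewrite sqrtr_gt0 invr_gt0 mulr_gt0.
have v2 : v ^+ 2 = (2 * V)^-1 by rewrite sqr_sqrtr// invr_ge0 mulr_ge0// ltW.
(* With this bound on the tails, [composition_eval_bound] for t = Y / kap
   gives r <= 2 N' + v Y / 4, which contradicts v Y <= r as soon as Y exceeds
   Y0. *)
pose kap := v / 8; have kap0 : 0 < kap by rewrite divr_gt0.
have [N' hN'] := compact_uniform_tails cT (exprn_gt0 2 kap0).
pose Y0 := 8 * N'%:R / (3 * v).
have Y00 : 0 <= Y0 by rewrite divr_ge0 ?mulr_ge0 ?(ltW v0).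
have [theta t0 ht] := smooth_sum_unbounded (Y0 ^+ 2 + 1) l1.
exists theta => // s /andP[s0 st]; rewrite leNgt; apply/negP => hs.
set w := Phi s in hs; set sigma := Re s in s0 st hs.
have w0 : 0 < Re w by exact: Phi0.
have wK : Re w <= K%:R * sigma.
  apply: (@le_trans _ _ (e^-1 * sigma)); last by rewrite ler_wpM2r// ltW.
  by rewrite ler_pdivlMl// ltW.
have s20 : 0 < 2 * sigma by rewrite mulr_gt0.
pose SX X : R := \sum_(1 <= n < X | `[< smooth l n >]) npow n (2 * sigma).
have [Zm Zm0 hZm] := smooth_sum_bounded l s20.
pose E := [set SX X | X in [set: nat]].
have supE : has_sup E.
  split; first by exists (SX 0%N); exists 0%N.
  by exists Zm => _ [X _ <-]; exact: hZm.
pose Z := sup E.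
have ZX X : SX X <= Z by apply: sup_upper_bound => //; exists X.
have ZB : Y0 ^+ 2 + 1 <= Z.
  by have [|X hX] := ht sigma; [rewrite s0|exact: le_trans hX (ZX _)].
have Z0 : 0 < Z by apply: lt_le_trans ZB; rewrite ltr_wpDl// sqr_ge0.
have [_ [X' _ <-] hX'] := sup_adherent (divr_gt0 Z0 (ltr0Sn R 1)) supE.
have [X hX] : exists X, Z / 2 <= SX X.+1.
  have mono : SX X' <= SX X'.+1.
    rewrite /SX big_mkcond [leRHS]big_mkcond/=; apply: ler_sum_nat_widen => // n.
    by case: ifP => // _; exact: npow_ge0.
  by exists X'; apply: le_trans mono; move: hX'; rewrite -/Z; lra.
pose p : R := \sum_(1 <= n < X.+1 | `[< smooth l n >]) npow n (2 * Re w).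
have pZ : Z / (2 * V) <= p.
  rewrite ler_pdivrMr ?mulr_gt0//.
  have h1 : SX X.+1 <= V * p.
    apply: (le_trans (smooth_sum_le l X.+1 (ltn0Sn (Num.truncn e^-1)) (ltW s20))).
    rewrite -/K -/V ler_wpM2l ?(ltW V0)//; apply: ler_sum => n _.
    by apply: npow_le; rewrite mulrCA ler_wpM2l.
  have -> : p * (2 * V) = 2 * (V * p) by ring.
  by move: hX h1; lra.
have p0 : 0 < p by apply: lt_le_trans pZ; rewrite divr_gt0// mulr_gt0.
pose r := Num.sqrt p; have r0 : 0 < r by rewrite sqrtr_gt0.
have r2 : r ^+ 2 = p by rewrite sqr_sqrtr// ltW.
pose a n : R[i] := if `[< smooth l n >] && (n <= X)%N then conjc (natpowN n w) * (r^-1)%:C%C else 0.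
have a00 : a 0%N = 0 by rewrite /a; case: asboolP => // -[].
have aX n : (X < n)%N -> a n = 0 by move=> Xn; rewrite /a leqNgt Xn andbF.
have sqa n : sqmod (a n) = if `[< smooth l n >] && (n <= X)%N then npow n (2 * Re w) / p else 0.
  rewrite /a; case: ifP => _; last by rewrite sqmod0.
  rewrite sqmodM -[sqmod (conjc _)]normcX2 normc_conjc normc_natpowN.
  rewrite -[sqmod (_%:C)%C]normcX2 normc_real real_normK ?num_real// exprVn r2.
  by rewrite npow_sqr.
have sumX (G : nat -> R) : \sum_(1 <= n < X.+1 | `[< smooth l n >]) G n =
   \sum_(1 <= n < X.+1) if `[< smooth l n >] && (n <= X)%N then G n else 0.
  rewrite big_mkcond/=; apply: eq_big_nat => n /andP[_]; rewrite ltnS => ->.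
  by rewrite andbT.
have suma M : \sum_(1 <= n < M) sqmod (a n) <= 1.
  apply: (@le_trans _ _ (\sum_(1 <= n < (maxn M X).+1) sqmod (a n))).
    by apply: ler_sum_nat_widen => [n|]; [exact: sqmod_ge0|rewrite leqW// leq_maxl].
  rewrite (@big_cat_nat _ _ _ X.+1)//=; last by rewrite ltnS leq_maxr.
  rewrite [X in _ + X]big1_seq ?addr0; last first.
    by move=> n /andP[_]; rewrite mem_index_iota => /andP[Xn _]; rewrite aX// sqmod0.
  rewrite (eq_bigr _ (fun n _ => sqa n)) -sumX -mulr_suml -/p divff//.
  by rewrite gt_eqF.
have [sa sa1] : sqsummable a /\ sqsum a <= 1.
  by apply: sqsummable_bounded => M; rewrite series_sqmodE.
have ah : a \in @h2_pred R by apply/asboolP.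
pose f : H2 R := MkH2 ah.
have fQ : closure (T @` [set v : H2 R | `|v| <= 1]) (T f).
  by apply: subset_closure; exists f => //=; rewrite h2_norm_le1.
have [hN1 hN2] := hN' _ fQ.
have smf n : (0 < n <= X)%N -> (f : nat -> R[i]) n != 0 -> comp_support l n `<=` smooth l.
  move=> _; rewrite -[(f : nat -> R[i]) n]/(a n) /a; case: asboolP => /= [sn _ m [_]|_]; last by rewrite eqxx.
  exact.
have hbf := hb (smooth l) f X smf.
pose Y := Num.sqrt Z; have Yp : 0 < Y by rewrite sqrtr_gt0.
have Y2 : Y ^+ 2 = Z by rewrite sqr_sqrtr// ltW.
have tp : 0 < Y / kap by rewrite divr_gt0.
have hZX X0 : \sum_(1 <= n < X0 | `[< smooth l n >]) npow n (2 * Re s) <= Z by exact: ZX.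
have key := composition_eval_bound hT PhiR hbf aX s0 tp hN1 hN2 hZX.
have fw : dpsum f X (Phi s) = (r%:C)%C.
  rewrite -[Phi s]/w.
  have -> : r = p / r by rewrite -r2 expr2 mulfK// gt_eqF.
  rewrite rmorphM /= /p sumX rmorph_sum/= mulr_suml; apply: eq_bigr => n _.
  rewrite /a; case: ifP => _; last by rewrite !mul0r.
  rewrite mulrAC (mulrC (conjc _)) -sqmodC; congr ((_)%:C%C * _).
  by rewrite -normcX2 normc_natpowN npow_sqr.
rewrite fw normc_real (gtr0_norm r0) in key.
have vY : v * Y <= r.
  rewrite -(@ler_pXn2r _ 2)// ?nnegrE ?mulr_ge0 ?(ltW v0) ?(ltW Yp) ?(ltW r0)//.
  by rewrite exprMn v2 Y2 r2 mulrC.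
have kk : Y / kap * kap ^+ 2 + (Y / kap)^-1 * Z = v * Y / 4.
  rewrite -Y2 (_ : v = 8 * kap); last by rewrite /kap; field.
  by field; rewrite !gt_eqF.
have YY : Y0 < Y.
  rewrite -(@ltr_pXn2r _ 2)// ?nnegrE ?(ltW Yp)// Y2; apply: lt_le_trans ZB.
  by rewrite ltrDl.
have : 8 * N'%:R < Y * (3 * v) by rewrite -ltr_pdivrMr ?mulr_gt0.
have -> : Y * (3 * v) = 3 * (v * Y) by ring.
have : r <= 2 * N'%:R + v * Y / 4 by rewrite -kk addrA.
by move: vY; set q := v * Y; lra.
Qed.

End Necessity.

Theorem theorem6 (R : realType) (l : nat) (hl : (1 <= l)%N)
  (c0 : nat) (Phi phi : R[i] -> R[i]) (c : nat -> R[i])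
  (hPhi : c0_symbol c0 Phi phi c)
  (hc : forall n : nat, (1 <= n)%N -> (l < max_pdiv n)%N -> c n = 0)
  (hIm : exists M : R, forall s : R[i],
     halfplane 0 s -> `|complex.Im (phi s)| <= M)
  (hval : finite_valent Phi) :
  (composition_compact_on_H2 Phi <->
   vanishes_at_boundary
     (fun s : R[i] => (complex.Re s / complex.Re (Phi s))%:E)) /\
  (vanishes_at_boundary
     (fun s : R[i] => (complex.Re s / complex.Re (Phi s))%:E) <->
   vanishes_at_boundary
     (fun s : R[i] => (counting_function Phi s * ((complex.Re s)^-1)%:E)%E)).
Proof.
have [M hM] := hIm; have [k hk] := hval.
(* the divergence of the kernels at the boundary needs at least one prime *)
pose L := maxn l 2; have L1 : (1 < L)%N by rewrite leq_max orbT.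
have cS n : (0 < n)%N -> c n != 0 -> smooth L n.
  move=> n0 cn; apply: smooth_max_pdiv => //; first exact: ltnW.
  rewrite leqNgt; apply: contra cn => h; apply/eqP/hc => //.
  by apply: leq_trans h; rewrite ltnS leq_maxl.
have [phi' [hphi tm]] := symbol_tame hPhi cS hM hk.
have c00 := symbol_c0_ge1 hPhi.
have PE s : 0 < Re s -> Phi s = c0%:R * s + phi s by move=> s0; exact: (symbolE hPhi).
have [b [tb hb]] := composition_coefs c00 PE hphi.
have c01 : 1 <= c0%:R :> R by rewrite ler1n.
have PhiRe s : 0 < Re s -> Re s <= Re (Phi s).
  by move=> s0; apply: le_trans (tame_Re tm s0); rewrite ler_peMl// ltW.
have Phi0 s : 0 < Re s -> 0 < Re (Phi s).
  by move=> s0; apply: lt_le_trans (PhiRe s s0).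
have PhiR s : 2^-1 < Re s -> 2^-1 < Re (Phi s).
  by move=> s0; apply: (lt_le_trans s0); apply: PhiRe; lra.
split; last exact: ratio_iff_counting tm.
rewrite vanishes_at_boundaryP; split.
  move=> [T hT cT] e e0.
  have [theta t0 ht] := compact_ratio L1 hT cT PhiR Phi0 hb e0.
  exists theta => // s st; have /andP[s0 _] := st; have p0 := Phi0 _ s0.
  rewrite abse_EFin lee_fin ger0_norm; last by rewrite divr_ge0 ?(ltW p0)// ltW.
  by rewrite ler_pdivrMr// ht.
move=> hv.
pose Ck : R := 4 * expR 4 * (2 * (288 * c0%:R * k%:R * 16)).
have Ck0 : 0 <= Ck by rewrite !mulr_ge0 ?expR_ge0.
have tail : tail_small b.
  move=> eta eta0; pose e := eta / (2 * (Ck + 1)).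
  have Ck1 : 0 < Ck + 1 by rewrite ltr_wpDl.
  have e0 : 0 < e by rewrite divr_gt0// mulr_gt0.
  have [delta d0 hd] := hv _ e0.
  have heps s : 0 < Re s < delta -> Re s <= e * Re (Phi s).
    move=> sd; have /andP[s0 _] := sd; have p0 := Phi0 _ s0.
    have := hd s sd; rewrite abse_EFin lee_fin => /(le_trans (ler_norm _)).
    by rewrite ler_pdivrMr.
  have kap0 : 0 < c0%:R * delta / 2 by rewrite divr_gt0// mulr_gt0// (lt_le_trans ltr01).
  have [N hN] := npow_small kap0 e0.
  exists (maxn N 1) => a aN X.
  apply: (le_trans (composition_sum_le a X tm tb hb d0 (ltW e0) heps)).
  rewrite aN ?leq_maxr// sqmod0 mul0r add0r -/Ck.
  apply: (@le_trans _ _ (Ck * \sum_(1 <= n < X.+1) sqmod (a n) * (2 * e))).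
    rewrite ler_wpM2l//; apply: ler_sum => n _.
    have [nN|Nn] := leqP n (maxn N 1); first by rewrite aN// sqmod0 !mul0r.
    rewrite ler_wpM2l ?sqmod_ge0//.
    have := hN n (leq_ltn_trans (leq_maxl N 1) Nn); lra.
  rewrite -mulr_suml mulrCA mulrC ler_wpM2r//.
    by apply: sumr_ge0 => n _; exact: sqmod_ge0.
  have -> : Ck * (2 * e) = Ck / (Ck + 1) * eta by rewrite /e; field; rewrite gt_eqF.
  by rewrite ler_piMl ?(ltW eta0)// ler_pdivrMr// mul1r lerDl.
have bounded : exists2 C : R, 0 <= C & l2_bounded b C.
  exists (sqmod (b 1%N 1%N) + Ck * 2); first by rewrite addr_ge0 ?sqmod_ge0// mulr_ge0.
  move=> a [|X]; first by rewrite !big_geq// mulr0.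
  (* for boundedness the trivial ratio 1 is enough *)
  have heps s : 0 < Re s < 1 -> Re s <= 1 * Re (Phi s).
    by rewrite mul1r => /andP[s0 _]; exact: PhiRe.
  apply: (le_trans (composition_sum_le a X.+1 tm tb hb ltr01 ler01 heps)).
  rewrite [leRHS]mulrDl; apply: lerD.
    rewrite mulrC ler_wpM2l ?sqmod_ge0// big_ltn// lerDl.
    by apply: sumr_ge0 => n _; exact: sqmod_ge0.
  rewrite -/Ck -[leRHS]mulrA ler_wpM2l// mulr_sumr; apply: ler_sum => n _.
  rewrite mulrC ler_wpM2r ?sqmod_ge0//.
  have : npow n (c0%:R * 1 / 2) <= 1 :> R.
    by rewrite npow_le1// divr_ge0// mulr_ge0.
  lra.
exists (tri_op bounded); last exact: tri_op_compact.
apply: tri_op_composition => // a N.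
exists (fun s => dpsum (dcoef a) N (Phi s) * (c0%:R + phi' s)).
exact: (hb setT a N (fun _ _ _ _ _ => I)).
Qed.
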